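(* Let $r\ge 1$ and consider the semi-explicit differential-algebraic equation $$\dot x = f(x,t) - \tilde B^{\top}\lambda,\qquad 0 = g(x,t) = \tilde B x - \tilde g(t),\qquad t\in[0,T],\qquad x(0)=x_0,$$ with unknowns $x(t)\in\mathbb R^n$ and $\lambda(t)\in\mathbb R^m$, where the right-hand side $f\colon\mathbb R^n\times[0,T]\to\mathbb R^n$ is sufficiently smooth, $\tilde B\in\mathbb R^{m\times n}$ has full row rank, $\tilde g\in C^{r+2}(0,T)$ with values in $\mathbb R^m$, and the initial condition is consistent, i.e. $\tilde B x(0)=\tilde g(0)$. Assume that this problem has a unique solution $(x,\lambda)$ and that $x\in C^{r+1}(0,T)$. Assume further that on each sub-interval the Lagrange points are such that $t_0$ and $t_r$ are the starting point and the end point of that sub-interval, respectively. For sufficiently small constant step size $\Delta>0$ with $T/\Delta\in\mathbb N$, let $X$ and $\Lambda$ be the cG approximation of degree $r$ with step size $\Delta$ (defined in the context). Then there is a constant $C>0$, independent of $\Delta$, of $t$ and of the sub-interval $I$, such that $$\|x(t)-X(t)\|\le C\,\Delta^{r+1}$$ for all $t\in[0,T]$ and $$\|\lambda-\Lambda\|_{*,I} := \sup_{0\ne v\in C^\infty(I)}\frac{\|\langle\lambda-\Lambda,v\rangle\|}{\|v\|_{C^\infty(I)}}\le C\,\Delta^{r+1}$$ for all sub-intervals $I=[(\ell-1)\Delta,\ell\Delta]$, $\ell=1,\dots,T/\Delta$. Here the constant $C$ includes (may depend on) the Lebesgue constants $L_{r,\varphi}$ and $L_{r,\psi}$, which in turn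 depend on the distribution of the Lagrange points.
   Context: Nodes and bases. Fix pairwise distinct reference points $\tau_0=0,\tau_1,\dots,\tau_{r-1},\tau_r=1$ in $[0,1]$ (not necessarily equispaced). On the sub-interval $I=[(\ell-1)\Delta,\ell\Delta]$ the Lagrange points are $t_j=(\ell-1)\Delta+\Delta\tau_j$, $j=0,\dots,r$. Let $\varphi_0,\dots,\varphi_r$ be the Lagrange basis of the polynomials of degree at most $r$ on $I$ with respect to $t_0,\dots,t_r$ (so $\varphi_j(t_k)=\delta_{j,k}$), and $\psi_1,\dots,\psi_r$ the Lagrange basis of the polynomials of degree at most $r-1$ on $I$ with respect to $t_1,\dots,t_r$ (so $\psi_i(t_k)=\delta_{i,k}$). Put $$D_{ij}=\int_I\dot\varphi_j(t)\,\psi_i(t)\,dt,\qquad M_{ij}=\int_I\varphi_j(t)\,\psi_i(t)\,dt,\qquad i=1,\dots,r,\ j=0,\dots,r.$$ cG scheme of degree $r$. On each sub-interval $I$, given $x_0\in\mathbb R^n$ (the initial value $x(0)$ on the first sub-interval, and the coefficient $x_r$ of the previous sub-interval otherwise), the unknowns $x_1,\dots,x_r\in\mathbb R^n$ and $\lambda_1,\dots,\lambda_r\in\mathbb R^m$ solve $$\sum_{j=0}^r x_j D_{ij}-\sum_{j=0}^r f(x_j,t_j)M_{ij}+\tilde B^{\top}\lambda_i=0\quad(i=1,\dots,r),\qquad \tilde Bx_k-\tilde g(t_k)=0\quad(k=1,\dots,r).$$ For sufficiently small step size this system is understood to be solved by its locally unique solution, namely the one on the branch which, for fixed left end point of the sub-interval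 and fixed start value $x_0$, depends continuously on the step size and reduces for step size $0$ (all $t_j$ equal to the left end point, $M=0$, $D$ unchanged because it is independent of the step size) to the unique solution of the resulting linear system. The approximation of the state on $I$ is $X(t)=\sum_{j=0}^r x_j\varphi_j(t)$, and the approximation of the Lagrange multiplier on $I$ is the functional $\Lambda=\sum_{k=1}^r\lambda_k\,\xi_k$, where $\xi_k$ is the point evaluation (Dirac measure) at $t_k$. For scalar functions $v\in C^\infty(I)$, $$\langle\lambda,v\rangle=\int_I\lambda(t)v(t)\,dt\in\mathbb R^m,\qquad \langle\Lambda,v\rangle=\sum_{k=1}^r\lambda_k\,v(t_k)\in\mathbb R^m,\qquad \langle\lambda-\Lambda,v\rangle=\langle\lambda,v\rangle-\langle\Lambda,v\rangle.$$ Norms. $\|\cdot\|$ is the Euclidean norm. $C^k(0,T)$ denotes $k$ times continuously differentiable functions with finite norm $\|\cdot\|_{C^k(0,T)}$ (all derivatives up to order $k$ bounded). $\|v\|_{C^\infty(I)}=\sup_{k\ge0}\max_{t\in I}|v^{(k)}(t)|\in[0,\infty]$, with the quotient in the supremum read as $0$ if this is infinite. Lebesgue constants (on a sub-interval $I=[(\ell-1)\Delta,\ell\Delta]$ with the Lagrange points $t_j=(\ell-1)\Delta+\Delta\tau_j$, $j=0,\dots,r$): $L_{r,\varphi}=\max_{t\in I}\sum_{j=0}^r|\varphi_j(t)|$ and $L_{r,\psi}=\max_{t\in I}\sum_{i=1}^r|\psi_i(t)|$. ''Sufficiently smooth'' means of class $C^k$ for some sufficiently large $k$. *)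

(* Defs.v *)
From HB Require Import structures.
From mathcomp Require Import all_boot all_order all_algebra.
From mathcomp Require Import all_classical all_reals all_analysis.

Set Implicit Arguments.
Unset Strict Implicit.
Unset Printing Implicit Defensive.

Import Order.TTheory GRing.Theory Num.Theory.
Import numFieldNormedType.Exports.

Local Open Scope classical_set_scope.
Local Open Scope ring_scope.

(* The library norm `|x| on matrices is the max norm, hence this definition. *)
Definition norm2 {R : realType} {d : nat} (x : 'cV[R]_d) : R :=
  Num.sqrt (\sum_(i < d) x i ord0 ^+ 2).

Section Smoothness.
Context {R : realType}.

(* Differentiation relative to a set A: the difference quotient is taken along
   points s of A only, so the derivative at an end point of a closed interval
   is one-sided.  At points of A, all of this depends only on f restricted
   to A. *)
Definition diff_quotient {V : normedModType R} (f : R -> V) (t s : R) : V :=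
  (s - t)^-1 *: (f s - f t).

Definition derivable_on {V : normedModType R} (A : set R) (f : R -> V)
    (t : R) : Prop :=
  cvg (diff_quotient f t @ within A t^').

Definition derive_on {V : normedModType R} (A : set R) (f : R -> V)
    (t : R) : V :=
  lim (diff_quotient f t @ within A t^').

(* The space C^k(0,T): the derivatives up to order k exist on the open interval
   ]0,T[, are continuous there and are bounded. *)
Definition Ck_bounded {d : nat} (k : nat) (T : R) (v : R -> 'cV[R]_d) : Prop :=
  [/\ forall j (t : R), (j < k)%N -> t \in `]0, T[ -> derivable (derive1n j v) t 1,
      forall t : R, t \in `]0, T[ -> {for t, continuous (derive1n k v)} &
      forall j, (j <= k)%N ->
        exists K : R, forall t : R, t \in `]0, T[ -> norm2 (derive1n j v t) <= K].

(* Class C^k on R^n x [0,T]: all partial derivatives up to order k exist and are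
   continuous on R^n x [0,T]. *)
Fixpoint Ck_cylinder {n p : nat} (T : R) (k : nat)
    (F : 'cV[R]_n -> R -> 'cV[R]_p) : Prop :=
  {within [set z : 'cV[R]_n * R | z.2 \in `[0, T]],
    continuous (fun z : 'cV[R]_n * R => F z.1 z.2)} /\
  (if k is k'.+1 then
     [/\ forall (y : 'cV[R]_n) (t : R), t \in `[0, T] ->
           (forall i : 'I_n, derivable (F^~ t) y (delta_mx i ord0)) /\
           derivable_on `[0, T] (F y) t,
         forall i : 'I_n,
           Ck_cylinder T k' (fun y t => derive (F^~ t) y (delta_mx i ord0)) &
         Ck_cylinder T k' (fun y t => derive_on `[0, T] (F y) t)]
   else True).

Definition Cinfty_on (A : set R) (v : R -> R) : Prop :=
  forall (k : nat) (t : R), A t ->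
    derivable_on A (iter k (@derive_on R^o A) v) t.

Definition Cinfty_norm (A : set R) (v : R -> R) : \bar R :=
  ereal_sup [set ereal_sup
      [set `|iter k (@derive_on R^o A) v t|%:E | t in A] | k in [set: nat]].

(* In \bar R, +oo^-1 = 0, so the quotient is 0 when the norm of v is +oo. *)
Definition dual_norm {m : nat} (A : set R) (F : (R -> R) -> 'cV[R]_m) : \bar R :=
  ereal_sup [set ((norm2 (F v))%:E / Cinfty_norm A v)%E |
    v in [set v | Cinfty_on A v /\ exists2 t, A t & v t != 0]].

End Smoothness.

Section DAE.
Context {R : realType} {n m : nat}.
Variables (f : 'cV[R]_n -> R -> 'cV[R]_n) (B : 'M[R]_(m, n)).
Variables (g : R -> 'cV[R]_m) (T : R) (x0 : 'cV[R]_n).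

Definition DAE_solution (x : R -> 'cV[R]_n) (lam : R -> 'cV[R]_m) : Prop :=
  [/\ forall t : R, t \in `[0, T] ->
        diff_quotient x t @ within `[0, T] t^' --> f (x t) t - B^T *m lam t,
      forall t : R, t \in `[0, T] -> B *m x t - g t = 0 &
      x 0 = x0].

Definition DAE_unique_solution (x : R -> 'cV[R]_n) (lam : R -> 'cV[R]_m) :
    Prop :=
  DAE_solution x lam /\
  forall x' lam', DAE_solution x' lam' ->
    forall t : R, t \in `[0, T] -> x' t = x t /\ lam' t = lam t.

End DAE.

Section Basis.
Context {R : realType}.

Definition lagrange_basis {I : finType} (t : I -> R) (j : I) : {poly R} :=
  \prod_(k | k != j) ((t j - t k)^-1 *: ('X - (t k)%:P)).

Context {r : nat}.
Variable tau : 'I_r.+1 -> R.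

(* Everything below refers to the interval [a, a + h]. *)
Definition node (a h : R) (j : 'I_r.+1) : R := a + h * tau j.

(* The indices 1, ..., r are encoded as i : 'I_r; the corresponding
   element of {0, ..., r} is lift ord0 i, of value i + 1. *)
Definition phi (a h : R) (j : 'I_r.+1) : {poly R} :=
  lagrange_basis (node a h) j.

Definition psi (a h : R) (i : 'I_r) : {poly R} :=
  lagrange_basis (fun k : 'I_r => node a h (lift ord0 k)) i.

Definition Dmx (a h : R) : 'M[R]_(r, r.+1) :=
  \matrix_(i, j) \int[lebesgue_measure]_(t in `[a, a + h])
    ((phi a h j)^`().[t] * (psi a h i).[t]).

Definition Mmx (a h : R) : 'M[R]_(r, r.+1) :=
  \matrix_(i, j) \int[lebesgue_measure]_(t in `[a, a + h])
    ((phi a h j).[t] * (psi a h i).[t]).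

End Basis.

Section Scheme.
Context {R : realType} {n m r : nat}.
Variables (f : 'cV[R]_n -> R -> 'cV[R]_n) (B : 'M[R]_(m, n)).
Variables (g : R -> 'cV[R]_m) (tau : 'I_r.+1 -> R).

Definition cG_system (D M : 'M[R]_(r, r.+1)) (t : 'I_r.+1 -> R)
    (x : 'I_r.+1 -> 'cV[R]_n) (lam : 'I_r -> 'cV[R]_m) : Prop :=
  (forall i : 'I_r,
     \sum_(j < r.+1) D i j *: x j - \sum_(j < r.+1) M i j *: f (x j) (t j)
       + B^T *m lam i = 0) /\
  (forall k : 'I_r, B *m x (lift ord0 k) - g (t (lift ord0 k)) = 0).

(* The coefficients on [a, a + h], h > 0, with start value x ord0.  The system is
   solved on a continuous branch over the step sizes s in [0, h]; at s = 0 all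
   nodes are a, M = 0 and D keeps its (step size independent) value. *)
Definition cG_step (a h : R) (x : 'I_r.+1 -> 'cV[R]_n)
    (lam : 'I_r -> 'cV[R]_m) : Prop :=
  exists (y : R -> 'I_r.+1 -> 'cV[R]_n) (mu : R -> 'I_r -> 'cV[R]_m),
  [/\ (forall j, {within `[0, h], continuous (y^~ j)}) /\
      (forall i, {within `[0, h], continuous (mu^~ i)}),
      forall s : R, s \in `[0, h] -> y s ord0 = x ord0,
      cG_system (Dmx tau a h) 0 (fun=> a) (y 0) (mu 0),
      forall s : R, s \in `]0, h] ->
        cG_system (Dmx tau a s) (Mmx tau a s) (node tau a s) (y s) (mu s) &
      y h = x /\ mu h = lam].

(* The sub-intervals are numbered l = 0, ..., N - 1, so that the l-th one starts
   at l * h.  Lam l k is the coefficient of the point evaluation at the node of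
   index k + 1 of the l-th sub-interval. *)
Definition sub_itv (h : R) (l : nat) : set R := `[l%:R * h, l.+1%:R * h].

Definition cG_approximation (x0 : 'cV[R]_n) (h : R) (N : nat)
    (X : R -> 'cV[R]_n) (Lam : nat -> 'I_r -> 'cV[R]_m) : Prop :=
  exists x : nat -> 'I_r.+1 -> 'cV[R]_n,
  [/\ x 0%N ord0 = x0,
      forall l, (l.+1 < N)%N -> x l.+1 ord0 = x l ord_max,
      forall l, (l < N)%N -> cG_step (l%:R * h) h (x l) (Lam l) &
      forall l t, (l < N)%N -> sub_itv h l t ->
        X t = \sum_(j < r.+1) (phi tau (l%:R * h) h j).[t] *: x l j].

Definition lam_pairing (A : set R) (lam : R -> 'cV[R]_m) (v : R -> R) :
    'cV[R]_m :=
  \col_i \int[lebesgue_measure]_(t in A) (lam t i ord0 * v t).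

Definition Lam_pairing (h : R) (l : nat) (Lam : nat -> 'I_r -> 'cV[R]_m)
    (v : R -> R) : 'cV[R]_m :=
  \sum_(k < r) v (node tau (l%:R * h) h (lift ord0 k)) *: Lam l k.

End Scheme.

(* Main.v *)
(** Let P be the orthogonal projection onto the kernel of B.  Applying P to the
    discrete equations and inverting the part of D that belongs to the unknown
    nodes turns the scheme into an implicit Runge-Kutta method for P x, the
    component of x orthogonal to the kernel being prescribed by g; the multipliers
    are then explicit.  With f truncated outside a ball the stages are a fixed
    point of a contraction that depends continuously on the step size, and a
    continuous branch cannot leave the ball for small steps, which gives existence
    and control of every branch.

    The stages have defect O(h^(r+1)).  Since the psi_i sum to 1, the last stage is
    the quadrature rule of the r+1 nodes applied to P f(x, t), so its defect is
    O(h^(r+2)), provided t |-> f(x(t), t) has r+1 bounded derivatives; this follows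
    from the chain rule.  Hence the end points, by a discrete Gronwall argument,
    and then all the nodes are accurate to O(h^(r+1)).

    The pairing of Lambda with v equals the integral of a polynomial
    multiplier, which is O(h^r)-close to lambda, against the interpolant of v,
    which is O(h^r)-close to v; the length h of the interval gives the last
    factor. *)

Require Import Defs.
From HB Require Import structures.
From mathcomp Require Import all_boot all_order all_algebra.
From mathcomp Require Import all_classical all_reals all_analysis.
From mathcomp Require Import measurable_realfun ring lra.

Set Implicit Arguments.
Unset Strict Implicit.
Unset Printing Implicit Defensive.

Import Order.TTheory GRing.Theory Num.Theory.
Import numFieldNormedType.Exports.

Local Open Scope classical_set_scope.
Local Open Scope ring_scope.

(** * Polynomials and their integrals *)

Section PolynomialIntegral.
Context {R : realType}.
Implicit Types (p q : {poly R}) (a b h : R).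

(** The obstacle is the regularity of x'. With x of class C^(r+1), the derivative f(x,t) - B^T
    lambda has only r bounded derivatives, whereas the defect h^(r+2) of the last stage needs r+1.
    Since P B^T = 0, the projected derivative (P x)' = P f(x,t) does not see the multiplier and is
    as smooth as x itself. The r derivatives of x' are used where they are enough: to interpolate x
    and to estimate the multiplier.

    Smoothness is known on open intervals only. Estimates are therefore proved there, with
    approximating polynomials built by repeated integration from an interior point, and are carried
    to the end points by continuity.

    The general stage defect is one order worse than that of the last stage, but within a step it is
    multiplied by h before it reaches the end point. So every step contributes h^(r+2), and the T/h
    steps cost one power of h. *)

Definition primitive p : {poly R} :=
  \poly_(i < (size p).+1) (p`_i.-1 / i%:R).

Lemma coef_primitive p i : (primitive p)`_i = p`_i.-1 / i%:R.
Proof.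
rewrite coef_poly; case: ltnP => // pi; case: i pi => // i pi.
by rewrite nth_default ?mul0r.
Qed.

Lemma primitive_is_linear : linear primitive.
Proof.
move=> c p q; apply/polyP => i.
by rewrite !(coefD, coefZ, coef_primitive); ring.
Qed.

HB.instance Definition _ :=
  GRing.isLinear.Build R {poly R} {poly R} _ primitive primitive_is_linear.

Lemma size_primitive p : (size (primitive p) <= (size p).+1)%N.
Proof. exact: size_poly. Qed.

Lemma deriv_primitive p : (primitive p)^`() = p.
Proof.
apply/polyP => i; rewrite coef_deriv coef_primitive /= -[LHS]mulr_natr.
by rewrite divfK // pnatr_eq0.
Qed.

Lemma primitive_deriv p : primitive p^`() = p - (p`_0)%:P.
Proof.
apply/polyP => -[|i]; rewrite coef_primitive coefB coefC /=.
  by rewrite invr0 mulr0 subrr.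
by rewrite coef_deriv subr0 -[_ *+ _]mulr_natr mulfK // pnatr_eq0.
Qed.

(** An algebraic integral: it is linear in p without integrability conditions, and [Rintegral_poly]
    is the only bridge to the Lebesgue integral needed for [Dmx] and [Mmx]. *)
Definition poly_int a b p : R := (primitive p).[b] - (primitive p).[a].

Lemma poly_int_is_linear a b : linear_for *%R (poly_int a b).
Proof.
by move=> c p q; rewrite /poly_int linearP !hornerE /=; ring.
Qed.

HB.instance Definition _ a b :=
  GRing.isLinear.Build R {poly R} R *%R (poly_int a b) (poly_int_is_linear a b).

Lemma poly_int_deriv a b p : poly_int a b p^`() = p.[b] - p.[a].
Proof. by rewrite /poly_int primitive_deriv !hornerE; ring. Qed.

Lemma Rintegral_poly a b p : a < b ->
  \int[lebesgue_measure]_(t in `[a, b]) p.[t] = poly_int a b p.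
Proof.
move=> ab; rewrite /Rintegral.
rewrite (@continuous_FTC2 _ (horner p) (horner (primitive p)) a b ab).
- by rewrite /poly_int -EFinB.
- by apply: continuous_subspaceT => x; exact: continuous_horner.
- split.
  + by move=> x _; exact: derivable_horner.
  + apply: cvg_at_right_filter; exact: continuous_horner.
  + apply: cvg_at_left_filter; exact: continuous_horner.
- by move=> x _; rewrite -derivE deriv_primitive.
Qed.

Lemma poly_vanish_itv p : (forall t, 0 <= t <= 1 -> p.[t] = 0) -> p = 0.
Proof.
move=> p0; pose n := size p.
(* The n + 1 points i / (n + 1), with n = size p, are more roots than a nonzero p can have. *)
apply: (@roots_geq_poly_eq0 _ p [seq i%:R / n.+1%:R | i <- iota 0 n.+1]).
- apply/allP => _ /mapP [i + ->]; rewrite mem_iota add0n => /andP[_ ilt].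
  apply/rootP/p0; rewrite divr_ge0 //= ler_pdivrMr ?ltr0n // mul1r ler_nat.
  exact: ltnW.
- rewrite map_inj_uniq ?iota_uniq // => i j /mulIf.
  by rewrite invr_eq0 pnatr_eq0 => /(_ isT)/eqP; rewrite eqr_nat => /eqP.
- by rewrite size_map size_iota ltnW.
Qed.

(** The primitive of p^2 is nondecreasing on [0, 1] and takes equal values at 0 and 1. So it is
    constant there, hence constant as a polynomial, and its derivative p^2 is 0. *)
Lemma poly_int_sqr_eq0 p : poly_int 0 1 (p * p) = 0 -> p = 0.
Proof.
move=> p0; pose Q := primitive (p * p).
have Qmono : {in `[0, 1]%R &, {homo (horner Q) : x y / x <= y}}.
  apply: (@ger0_derive1_le _ (horner Q) 0 1 _ _ true false).
  - by move=> x _; exact: derivable_horner.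
  - by move=> x _; rewrite -derivE deriv_primitive hornerM -expr2 sqr_ge0.
  - by apply: continuous_subspaceT => x; exact: continuous_horner.
have Qc : Q - (Q.[0])%:P = 0.
  apply: poly_vanish_itv => t /andP[t0 t1]; rewrite !hornerE.
  have Q10 : Q.[1] = Q.[0] by apply/eqP; rewrite -subr_eq0; apply/eqP.
  apply/eqP; rewrite subr_eq0 eq_le -{1}Q10.
  by rewrite !Qmono // in_itv /= ?t0 ?t1 ?lexx ?ler01.
have : (p * p) = 0.
  rewrite -[LHS]deriv_primitive -/Q.
  have -> : Q = (Q.[0])%:P by apply/eqP; rewrite -subr_eq0 Qc.
  by rewrite derivC.
by move=> /eqP; rewrite mulf_eq0 orbb => /eqP.
Qed.

Definition affine_poly a h : {poly R} := a%:P + h *: 'X.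

Lemma horner_affine a h t : (affine_poly a h).[t] = a + h * t.
Proof. by rewrite /affine_poly !hornerE. Qed.

Lemma deriv_affine a h p : (p \Po affine_poly a h)^`() = h *: (p^`() \Po affine_poly a h).
Proof.
by rewrite deriv_comp /affine_poly derivD derivC derivZ derivX add0r alg_polyC mulrC mul_polyC.
Qed.

Lemma poly_int_affine a h p :
  poly_int a (a + h) p = h * poly_int 0 1 (p \Po affine_poly a h).
Proof.
have -> : h * poly_int 0 1 (p \Po affine_poly a h) =
    poly_int 0 1 (primitive p \Po affine_poly a h)^`().
  by rewrite deriv_affine deriv_primitive linearZ.
by rewrite poly_int_deriv !horner_comp !horner_affine mulr1 mulr0 addr0.
Qed.

End PolynomialIntegral.

(** * Lagrange interpolation at distinct nodes *)

Section Lagrange.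
Context {R : realType} {I : finType}.
Variable t : I -> R.
Hypothesis t_inj : injective t.

Lemma lagrange_basis_node j k : (lagrange_basis t j).[t k] = (j == k)%:R.
Proof.
rewrite /lagrange_basis horner_prod; case: eqP => [<-|/eqP jk].
  rewrite big1 // => i ij; rewrite !hornerE mulVf //.
  by rewrite subr_eq0 (inj_eq t_inj) eq_sym.
rewrite (bigD1 k) 1?eq_sym //=.
by rewrite !hornerE subrr mulr0 mul0r.
Qed.

Lemma size_lagrange_basis j : (size (lagrange_basis t j) <= #|I|)%N.
Proof.
have -> : #|I| = #|[pred k | k != j]|.+1.
  by rewrite cardC1 prednK //; apply/card_gt0P; exists j.
rewrite /lagrange_basis -big_filter; have [e _ _ [_ card_e]] := big_enumP.
rewrite -card_e {card_e}.
elim: e => [|k s IH].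
  by rewrite big_nil size_poly1.
rewrite big_cons; apply: leq_trans (size_polyMleq _ _) _.
have : (size ((t j - t k)^-1 *: ('X - (t k)%:P)) <= 2)%N.
  by apply: leq_trans (size_scale_leq _ _) _; rewrite size_XsubC.
move=> h; rewrite -subn1 leq_subLR; apply: leq_trans (leq_add h IH) _.
by rewrite /= addnC addn2 add1n.
Qed.

Lemma poly_eq_nodes (p q : {poly R}) : (size p <= #|I|)%N -> (size q <= #|I|)%N ->
  (forall j, p.[t j] = q.[t j]) -> p = q.
Proof.
move=> sp sq pq; apply/eqP; rewrite -subr_eq0; apply/eqP.
apply: (@roots_geq_poly_eq0 _ _ [seq t j | j <- enum I]).
- by apply/allP => _ /mapP[j _ ->]; apply/rootP; rewrite !hornerE pq subrr.
- by rewrite map_inj_uniq // enum_uniq.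
- rewrite size_map -cardE; apply: leq_trans (size_polyD _ _) _.
  by rewrite size_polyN geq_max sp.
Qed.

Lemma lagrange_interp (p : {poly R}) : (size p <= #|I|)%N ->
  \sum_j p.[t j] *: lagrange_basis t j = p.
Proof.
move=> sp; apply: poly_eq_nodes => //.
  apply: leq_trans (size_sum _ _ _) _; apply/bigmax_leqP => j _.
  exact: leq_trans (size_scale_leq _ _) (size_lagrange_basis j).
move=> k; rewrite horner_sum (bigD1 k) //= big1 => [|j jk].
  by rewrite hornerZ lagrange_basis_node eqxx mulr1 addr0.
by rewrite hornerZ lagrange_basis_node (negbTE jk) mulr0.
Qed.

End Lagrange.

(** * The Runge-Kutta matrix of the reference element *)

Section ReferenceElement.
Context {R : realType} {r : nat}.
Variable tau : 'I_r.+1 -> R.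
Hypothesis tau_inj : injective tau.
Hypothesis tau0 : tau ord0 = 0.

(** Every factor of a basis polynomial is a quotient of differences of nodes, so h cancels. This is
    why D does not depend on the step size and M is proportional to it. *)
Lemma lagrange_basis_affine (I : finType) (t s : I -> R) (a h : R) (j : I) : h != 0 ->
  (forall i, s i = a + h * t i) ->
  lagrange_basis s j \Po affine_poly a h = lagrange_basis t j.
Proof.
move=> h0 st; rewrite /lagrange_basis rmorph_prod; apply: eq_bigr => k _ /=.
rewrite comp_polyZ comp_polyB comp_polyX comp_polyC !st /affine_poly.
have -> : a + h * t j - (a + h * t k) = h * (t j - t k) by ring.
have -> : a%:P + h *: 'X - (a + h * t k)%:P = h *: ('X - (t k)%:P).
  by rewrite polyCD polyCM scalerBr -!mul_polyC; ring.
by rewrite scalerA invfM mulrAC mulVf // mul1r.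
Qed.

Local Notation phi_ref := (phi tau 0 1).
Local Notation psi_ref := (psi tau 0 1).

Lemma node_ref j : node tau 0 1 j = tau j.
Proof. by rewrite /node add0r mul1r. Qed.

Lemma node_inj a h : h != 0 -> injective (node tau a h).
Proof. by move=> h0 i j /addrI /(mulfI h0) /tau_inj. Qed.

Lemma phi_affine a h j : h != 0 -> phi tau a h j \Po affine_poly a h = phi_ref j.
Proof. by move=> h0; apply: lagrange_basis_affine => // i; rewrite node_ref. Qed.

Lemma psi_affine a h i : h != 0 -> psi tau a h i \Po affine_poly a h = psi_ref i.
Proof. by move=> h0; apply: lagrange_basis_affine => // k; rewrite node_ref. Qed.

Lemma Dmx_coef a h i j : 0 < h ->
  Dmx tau a h i j = poly_int 0 1 ((phi_ref j)^`() * psi_ref i).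
Proof.
move=> h0; rewrite mxE.
under eq_Rintegral do rewrite -hornerM.
rewrite Rintegral_poly ?ltrDl // poly_int_affine rmorphM /= psi_affine ?gt_eqF //.
by rewrite -(@phi_affine a h j) ?gt_eqF // deriv_affine -scalerAl linearZ.
Qed.

Lemma Mmx_coef a h i j : 0 < h ->
  Mmx tau a h i j = h * poly_int 0 1 (phi_ref j * psi_ref i).
Proof.
move=> h0; rewrite mxE.
under eq_Rintegral do rewrite -hornerM.
by rewrite Rintegral_poly ?ltrDl // poly_int_affine rmorphM /= psi_affine ?gt_eqF // phi_affine ?gt_eqF.
Qed.

(* Locked so that [mxE] does not unfold the integrals. *)
Definition Dref := locked (Dmx tau 0 1).
Definition Mref := locked (Mmx tau 0 1).

Lemma Dmx_ref a h : 0 < h -> Dmx tau a h = Dref.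
Proof. by move=> h0; apply/matrixP => i j; rewrite /Dref -lock !Dmx_coef. Qed.

Lemma Mmx_ref a h : 0 < h -> Mmx tau a h = h *: Mref.
Proof. by move=> h0; apply/matrixP => i j; rewrite [RHS]mxE /Mref -lock !Mmx_coef // mul1r. Qed.

Lemma Dref_coef i j : Dref i j = poly_int 0 1 ((phi_ref j)^`() * psi_ref i).
Proof. by rewrite /Dref -lock Dmx_coef. Qed.

Lemma Mref_coef i j : Mref i j = poly_int 0 1 (phi_ref j * psi_ref i).
Proof. by rewrite /Mref -lock Mmx_coef ?mul1r. Qed.

Lemma phi_interp (a h : R) (p : {poly R}) : h != 0 -> (size p <= r.+1)%N ->
  \sum_j p.[node tau a h j] *: phi tau a h j = p.
Proof.
by move=> h0 sp; apply: lagrange_interp; [exact: node_inj|rewrite card_ord].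
Qed.

Lemma psi_interp (a h : R) (p : {poly R}) : h != 0 -> (size p <= r)%N ->
  \sum_i p.[node tau a h (lift ord0 i)] *: psi tau a h i = p.
Proof.
move=> h0 sp; apply: lagrange_interp; last by rewrite card_ord.
by move=> i j /(node_inj h0)/lift_inj.
Qed.

Lemma phi_node a h j k : h != 0 -> (phi tau a h j).[node tau a h k] = (j == k)%:R.
Proof. by move=> h0; apply: lagrange_basis_node; exact: node_inj. Qed.

Lemma size_phi a h j : (size (phi tau a h j) <= r.+1)%N.
Proof. by have := size_lagrange_basis (node tau a h) j; rewrite card_ord. Qed.

Lemma size_deriv_leq k (p : {poly R}) : (size p <= k.+1)%N -> (size p^`() <= k)%N.
Proof.
move=> sp; apply: leq_trans (size_poly _ _) _.
by rewrite -ltnS; case: (size p) sp.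
Qed.

Lemma sum_Dref i (p : {poly R}) : (size p <= r.+1)%N ->
  \sum_j Dref i j * p.[tau j] = poly_int 0 1 (p^`() * psi_ref i).
Proof.
move=> sp; rewrite -[in RHS](@phi_interp 0 1 p) ?oner_eq0 //.
rewrite raddf_sum mulr_suml raddf_sum; apply: eq_bigr => j _.
by rewrite Dref_coef /= derivZ -scalerAl node_ref linearZ mulrC.
Qed.

Lemma sum_Mref i (p : {poly R}) : (size p <= r.+1)%N ->
  \sum_j Mref i j * p.[tau j] = poly_int 0 1 (p * psi_ref i).
Proof.
move=> sp; rewrite -[in RHS](@phi_interp 0 1 p) ?oner_eq0 //.
rewrite mulr_suml raddf_sum; apply: eq_bigr => j _.
by rewrite Mref_coef /= -scalerAl node_ref linearZ mulrC.
Qed.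

Definition Dsub : 'M[R]_r := \matrix_(i, k) Dref i (lift ord0 k).
(** The Butcher matrix of the equivalent Runge-Kutta method. It has a column for node 0 because f is
    also evaluated at the start value. *)
Definition RKmx : 'M[R]_(r, r.+1) := invmx Dsub *m Mref.

(** Constants have zero derivative, so each row of [Dref] sums to 0 and column 0 can be
    eliminated. *)
Lemma sum_Dref_diff i (c : 'I_r.+1 -> R) :
  \sum_j Dref i j * c j = \sum_k Dsub i k * (c (lift ord0 k) - c ord0).
Proof.
have : \sum_j Dref i j * (1%:P : {poly R}).[tau j] = 0.
  by rewrite sum_Dref ?derivC ?mul0r ?linear0 // size_polyC oner_eq0.
rewrite !big_ord_recl /= hornerC mulr1 => /eqP; rewrite addr_eq0 => /eqP ->.
rewrite mulNr mulr_suml addrC -sumrB; apply: eq_bigr => k _.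
by rewrite hornerC mxE; ring.
Qed.

(** A kernel vector is the list of nodal values of some p of degree at most r with p = 0 at node 0
    and p' orthogonal to every psi_i. The psi_i span the polynomials of degree at most r - 1, among
    them p' itself, so p' = 0 and p vanishes. *)
Lemma Dsub_unit : Dsub \in unitmx.
Proof.
rewrite -unitmx_tr -row_free_unit -kermx_eq0; apply/rowV0P => v /sub_kermxP vD.
pose p := \sum_k v ord0 k *: phi_ref (lift ord0 k).
have sp : (size p <= r.+1)%N.
  apply: leq_trans (size_sum _ _ _) _; apply/bigmax_leqP => j _.
  by apply: leq_trans (size_scale_leq _ _) _; apply: size_phi.
have pl k : p.[tau (lift ord0 k)] = v ord0 k.
  rewrite horner_sum (bigD1 k) //= big1 => [|j jk].
    by rewrite hornerZ -node_ref phi_node ?oner_eq0 // eqxx mulr1 addr0.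
  by rewrite hornerZ -node_ref phi_node ?oner_eq0 // (inj_eq lift_inj) (negbTE jk) mulr0.
have p0 : p.[tau ord0] = 0.
  rewrite horner_sum big1 // => j _.
  by rewrite hornerZ -node_ref phi_node ?oner_eq0 // mulr0.
have orth i : poly_int 0 1 (p^`() * psi_ref i) = 0.
  rewrite -sum_Dref // sum_Dref_diff p0.
  transitivity ((v *m Dsub^T) ord0 i); last by rewrite vD mxE.
  rewrite [RHS]mxE; apply: eq_bigr => k _.
  by rewrite pl subr0 [Dsub^T _ _]mxE mulrC.
have dp0 : p^`() = 0.
  apply: poly_int_sqr_eq0; rewrite -{2}(@psi_interp 0 1 p^`()) ?oner_eq0 //; last first.
    exact: size_deriv_leq.
  rewrite mulr_sumr raddf_sum big1 // => i _.
  by rewrite /= -scalerAr linearZ /= orth mulr0.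
have /eqP := primitive_deriv p; rewrite dp0 linear0 eq_sym subr_eq0 => /eqP pc.
have pc0 : p = 0 by rewrite pc; move: p0; rewrite {1}pc hornerC => ->.
by apply/rowP => k; rewrite -pl pc0 horner0 mxE.
Qed.

(** [Dref] applied to the values of p and [Mref] applied to the values of p' both give the moments
    of p' against the psi_i. Equating them and inverting [Dsub] gives a rule exact up to degree r at
    each stage. *)
Lemma RK_rule k (p : {poly R}) : (size p <= r.+1)%N ->
  p.[tau (lift ord0 k)] - p.[0] = \sum_j RKmx k j * p^`().[tau j].
Proof.
move=> sp.
pose d : 'cV[R]_r := \col_k (p.[tau (lift ord0 k)] - p.[tau ord0]).
pose q : 'cV[R]_r.+1 := \col_j p^`().[tau j].
have Dd : Dsub *m d = Mref *m q.
  apply/colP => i; rewrite !mxE.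
  transitivity (poly_int 0 1 (p^`() * psi_ref i)).
    by rewrite -sum_Dref // sum_Dref_diff; apply: eq_bigr => l _; rewrite [d _ _]mxE.
  rewrite -sum_Mref; last exact/leqW/size_deriv_leq.
  by apply: eq_bigr => j _; rewrite [q _ _]mxE.
have : d k ord0 = (RKmx *m q) k ord0.
  by rewrite /RKmx -mulmxA -Dd mulKmx // Dsub_unit.
by rewrite !mxE tau0 => ->; apply: eq_bigr => j _; rewrite [q _ _]mxE.
Qed.

Lemma sum_psi : (0 < r)%N -> \sum_i psi_ref i = 1.
Proof.
move=> r0; rewrite -[RHS](@psi_interp 0 1) ?oner_eq0 ?size_poly1 //.
by apply: eq_bigr => i _; rewrite hornerC scale1r.
Qed.

(** The rows of [Dsub] add up to the integrals of the phi_l', that is to phi_l(1) - phi_l(0), the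
    unit vector of the last node. So the last row of [RKmx] is the sum of the rows of [Mref], the
    interpolatory weights of the r+1 nodes. They are exact for p' of degree r, one more than at a
    general stage. *)
Lemma RK_last k (p : {poly R}) : (lift ord0 k = ord_max) -> tau ord_max = 1 ->
  (size p <= r.+2)%N ->
  p.[1] - p.[0] = \sum_j RKmx k j * p^`().[tau j].
Proof.
move=> k_max tau1 sp; have r0 : (0 < r)%N := leq_ltn_trans (leq0n k) (ltn_ord k).
have sdp : (size p^`() <= r.+1)%N.
  exact: size_deriv_leq.
rewrite -poly_int_deriv.
have e1 : (const_mx 1 : 'rV[R]_r) *m Dsub = delta_mx ord0 k.
  apply/rowP => l; rewrite !mxE.
  transitivity (poly_int 0 1 ((phi_ref (lift ord0 l))^`())).
    rewrite -[in RHS](mulr1 (_^`())) -sum_psi // mulr_sumr raddf_sum.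
    by apply: eq_bigr => i _; rewrite /= !mxE mul1r Dref_coef.
  have p1 j : (phi_ref j).[1] = (j == ord_max)%:R.
    by rewrite -(phi_node 0 j ord_max (oner_neq0 _)) node_ref tau1.
  have p0 j : (phi_ref j).[0] = (j == ord0)%:R.
    by rewrite -(phi_node 0 j ord0 (oner_neq0 _)) node_ref tau0.
  by rewrite poly_int_deriv p1 p0 -k_max (inj_eq lift_inj) subr0 eqxx.
have rowA : row k RKmx = (const_mx 1 : 'rV[R]_r) *m Mref.
  by rewrite rowE -e1 /RKmx mulmxA mulmxK // Dsub_unit.
transitivity (\sum_i \sum_j Mref i j * p^`().[tau j]).
  rewrite -[in LHS](mulr1 (p^`())) -sum_psi // mulr_sumr raddf_sum.
  by apply: eq_bigr => i _; rewrite sum_Mref.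
rewrite exchange_big /=; apply: eq_bigr => j _.
have := congr1 (fun M : 'rV_r.+1 => M ord0 j) rowA; rewrite !mxE => ->.
by rewrite mulr_suml; apply: eq_bigr => i _; rewrite mxE mul1r.
Qed.

End ReferenceElement.

(** * Norms, limits and derivatives *)

Section MaxNorm.
Context {R : realType}.

Lemma mx_norm_le m n (M : 'M[R]_(m, n)) c : 0 <= c ->
  (forall i j, `|M i j| <= c) -> `|M| <= c.
Proof.
move=> c0 Mc; rewrite [leLHS]/Num.Def.normr /= mx_normrE.
by apply: bigmax_le => // -[i j] _; exact: Mc.
Qed.

Lemma mx_norm_coef m n (M : 'M[R]_(m, n)) i j : `|M i j| <= `|M|.
Proof.
rewrite [leRHS]/Num.Def.normr /= mx_normrE.
exact: (le_bigmax _ (fun ij => `|M ij.1 ij.2|) (i, j)).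
Qed.

Lemma mx_norm_mul m n p (A : 'M[R]_(m, n)) (B : 'M[R]_(n, p)) :
  `|A *m B| <= n%:R * `|A| * `|B|.
Proof.
apply: mx_norm_le => [|i j]; first by rewrite !mulr_ge0.
rewrite mxE; apply: le_trans (ler_norm_sum _ _ _) _.
have -> : n%:R * `|A| * `|B| = \sum_(k < n) `|A| * `|B|.
  by rewrite sumr_const card_ord -mulrA mulr_natl.
by apply: ler_sum => k _; rewrite normrM ler_pM // mx_norm_coef.
Qed.

Lemma norm2_le n (x : 'cV[R]_n) : norm2 x <= n%:R * `|x|.
Proof.
rewrite /norm2 -(ler_sqr (x := Num.sqrt _)) ?nnegrE ?sqrtr_ge0 ?mulr_ge0 //.
rewrite sqr_sqrtr ?sumr_ge0 // => [|i _]; last exact: sqr_ge0.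
apply: (@le_trans _ _ (\sum_(i < n) `|x| ^+ 2)).
  by apply: ler_sum => i _; rewrite -real_normK ?num_real // lerXn2r ?nnegrE // mx_norm_coef.
rewrite sumr_const card_ord exprMn -[leLHS]mulr_natl ler_wpM2r ?sqr_ge0 //.
by rewrite -natrX ler_nat; case: n {x} => // n; rewrite expnS expn1 leq_pmulr.
Qed.

Lemma norm2_coef n (x : 'cV[R]_n) i : `|x i ord0| <= norm2 x.
Proof.
rewrite /norm2 -sqrtr_sqr; apply: ler_wsqrtr.
by rewrite (bigD1 i) //= lerDl sumr_ge0 // => j _; exact: sqr_ge0.
Qed.

End MaxNorm.

Section EpsilonDelta.
Context {R : realType}.

Lemma within_cvgP {V W : normedModType R} (f : V -> W) (A : set V) t l :
  (f @ within A (nbhs t) --> l) <->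
  (forall e : R, 0 < e -> exists2 d : R, 0 < d &
     forall s, A s -> `|s - t| < d -> `|f s - l| <= e).
Proof.
split=> [/cvgrPdist_le fl e e0|fl].
  have /nbhs_normP [d /= d0 dP] := fl e e0.
  by exists d => // s As sd; rewrite distrC; apply: dP => //=; rewrite distrC.
apply/cvgrPdist_le => e e0; have [d d0 dP] := fl e e0.
apply/nbhs_normP; exists d => //= s sd As.
by rewrite distrC; apply: dP => //; rewrite distrC.
Qed.

Lemma within_continuousP {V W : normedModType R} (f : V -> W) (A : set V) :
  {within A, continuous f} <->
  (forall t, A t -> forall e : R, 0 < e -> exists2 d : R, 0 < d &
     forall s, A s -> `|s - t| < d -> `|f s - f t| <= e).
Proof.
split=> [/subspace_continuousP fc t At|fc].
  by apply/within_cvgP; exact: fc.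
by apply/subspace_continuousP => t At; apply/within_cvgP; exact: fc.
Qed.

Lemma diff_quotientP {V : normedModType R} (f : R -> V) (A : set R) (t : R) (l : V) :
  (diff_quotient f t @ within A t^' --> l) <->
  (forall e : R, 0 < e -> exists2 d : R, 0 < d &
     forall s, A s -> s != t -> `|s - t| < d -> `|diff_quotient f t s - l| <= e).
Proof.
split=> [/cvgrPdist_le fl e e0|fl].
  have /nbhs_normP [d /= d0 dP] := fl e e0.
  by exists d => // s As st sd; rewrite distrC; apply: dP => //=; rewrite distrC.
apply/cvgrPdist_le => e e0; have [d d0 dP] := fl e e0.
apply/nbhs_normP; exists d => //= s sd st As.
by rewrite distrC; apply: dP => //; rewrite distrC.
Qed.

Lemma is_deriveP {V : normedModType R} (f : R -> V) (t : R) (l : V) :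
  (forall e : R, 0 < e -> exists2 d : R, 0 < d &
     forall s, s != t -> `|s - t| < d -> `|diff_quotient f t s - l| <= e) ->
  is_derive t 1 f l.
Proof.
move=> fl.
have cf : h^-1 *: ((f \o shift t) (h *: 1) - f t) @[h --> 0^'] --> l.
  apply/cvgrPdist_le => e e0; have [d d0 dP] := fl e e0.
  apply/nbhs_normP; exists d => //= h; rewrite /ball_ /= sub0r normrN => hd h0.
  have -> : h^-1 *: (f (h *: 1 + t) - f t) = diff_quotient f t (h + t).
    by rewrite /diff_quotient addrK [h *: 1]mulr1.
  rewrite distrC; apply: dP; rewrite ?addrK //.
  by apply: contraNneq h0 => /(congr1 (fun z => z - t)); rewrite addrK subrr => ->.
by apply: DeriveDef; [exact: cvgP cf|exact: cvg_lim cf].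
Qed.

Lemma is_derive_quotient {V : normedModType R} (f : R -> V) (t : R) (l : V) :
  is_derive t 1 f l ->
  (forall e : R, 0 < e -> exists2 d : R, 0 < d &
     forall s, s != t -> `|s - t| < d -> `|diff_quotient f t s - l| <= e).
Proof.
move=> [df dl] e e0.
have : h^-1 *: ((f \o shift t) (h *: 1) - f t) @[h --> 0^'] --> l.
  by rewrite -dl; exact: df.
move=> /cvgrPdist_le/(_ e e0)/nbhs_normP[d /= d0 dP]; exists d => // s st sd.
have -> : diff_quotient f t s = (s - t)^-1 *: (f ((s - t) *: 1 + t) - f t).
  by rewrite /diff_quotient [_ *: 1]mulr1 subrK.
by rewrite distrC; apply: dP; rewrite /= ?sub0r ?normrN ?subr_eq0.
Qed.

(** Close to an interior point the restriction to [a, b] is void, so the relative derivative is the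
    ordinary one. *)
Lemma diff_quotient_is_derive {V : normedModType R} (f : R -> V) (a b t : R) (l : V) :
  a < t < b -> diff_quotient f t @ within `[a, b] t^' --> l -> is_derive t 1 f l.
Proof.
move=> /andP[at_ tb] /diff_quotientP fl; apply: is_deriveP => e e0.
have [d d0 dP] := fl e e0.
exists (Num.min d (Num.min (t - a) (b - t))).
  by rewrite !lt_min d0 !subr_gt0 at_ tb.
move=> s st; rewrite !lt_min => /and3P[sd]; rewrite !ltr_norml => /andP[sa sa'] /andP[sb sb'].
by apply: dP => //=; rewrite in_itv /=; lra.
Qed.

Lemma diff_quotient_continuous {V : normedModType R} (f : R -> V) (A : set R) (t : R) (l : V) :
  diff_quotient f t @ within A t^' --> l ->
  forall e : R, 0 < e -> exists2 d : R, 0 < d &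
     forall s, A s -> `|s - t| < d -> `|f s - f t| <= e.
Proof.
move=> /diff_quotientP fl e e0; have [d d0 dP] := fl 1 ltr01.
have K0 : 0 < `|l| + 1 by rewrite ltr_wpDl.
exists (Num.min d (e / (`|l| + 1))); first by rewrite lt_min d0 divr_gt0.
move=> s As; rewrite lt_min => /andP[sd se].
have [->|st] := eqVneq s t; first by rewrite subrr normr0 ltW.
have := dP s As st sd; rewrite /diff_quotient => h.
have -> : f s - f t = (s - t) *: ((s - t)^-1 *: (f s - f t)).
  by rewrite scalerA divff ?subr_eq0 // scale1r.
rewrite normrZ; apply: (@le_trans _ _ (`|s - t| * (`|l| + 1))).
  rewrite ler_wpM2l //; apply: le_trans (lerD (lexx `|l|) h).
  by apply: le_trans (ler_normD _ _); rewrite [X in _ <= `|X|]addrC subrK.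
by rewrite -ler_pdivlMr // ltW.
Qed.

End EpsilonDelta.

(** * Mean value inequalities *)

Section MeanValue.
Context {R : realType}.

(** The number c is a reference slope: c = 0 gives a Lipschitz bound, and c equal to a derivative at
    a base point gives the remainder of a linearization. *)
Lemma mean_value_ineq (u du : R -> R) (a b c e : R) : a <= b ->
  {within `[a, b], continuous u} ->
  (forall t, a < t < b -> is_derive t 1 u (du t)) ->
  (forall t, a < t < b -> `|du t - c| <= e) ->
  `|u b - u a - (b - a) * c| <= e * (b - a).
Proof.
rewrite le_eqVlt => /predU1P[-> _ _ _|ab uc ud due].
  by rewrite !subrr mul0r mulr0 subrr normr0.
have [t tab ->] := MVT ab (fun t tab => ud t tab) uc.
have -> : du t * (b - a) - (b - a) * c = (du t - c) * (b - a) by ring.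
have ba0 : 0 <= b - a by rewrite subr_ge0 ltW.
by rewrite normrM (ger0_norm ba0) ler_wpM2r // due.
Qed.

Lemma is_derive_continuous (u du : R -> R) (a b : R) :
  (forall t, a <= t <= b -> is_derive t 1 u (du t)) ->
  {within `[a, b], continuous u}.
Proof.
move=> ud; apply: derivable_within_continuous => t; rewrite in_itv /= => tab.
by have [] := ud t tab.
Qed.

Lemma mean_value_ineq_unord (u du : R -> R) (a b c e : R) :
  (forall t, Num.min a b <= t <= Num.max a b -> is_derive t 1 u (du t)) ->
  (forall t, Num.min a b <= t <= Num.max a b -> `|du t - c| <= e) ->
  `|u b - u a - (b - a) * c| <= e * `|b - a|.
Proof.
have H (x y : R) : x <= y ->
    (forall t, x <= t <= y -> is_derive t 1 u (du t)) ->
    (forall t, x <= t <= y -> `|du t - c| <= e) ->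
    `|u y - u x - (y - x) * c| <= e * `|y - x|.
  move=> xy ud due; rewrite (ger0_norm (x := y - x)) ?subr_ge0 //.
  apply: (mean_value_ineq xy (is_derive_continuous ud)) => t /andP[xt ty].
    by apply: ud; rewrite !ltW.
  by apply: due; rewrite !ltW.
have [ab|/ltW ba] := leP a b => ud due; first exact: H.
have -> : u b - u a - (b - a) * c = - (u a - u b - (a - b) * c) by ring.
by rewrite normrN (distrC b a); exact: H.
Qed.

Lemma bound_closed (V : normedModType R) (u : R -> V) (a b K : R) : a < b ->
  {within `[a, b], continuous u} ->
  (forall t, a < t < b -> `|u t| <= K) -> forall t, a <= t <= b -> `|u t| <= K.
Proof.
move=> ab /within_continuousP uc uK t /andP[at_ tb].
apply/ler_addgt0Pr => e e0.
have /uc/(_ e e0)[d d0 dP] : `[a, b]%classic t by rewrite /= in_itv /= at_.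
have d20 : 0 < d / 2 by rewrite divr_gt0.
(* [s] is [t] moved towards the midpoint by at most d / 2 and not beyond it, so it lies in the open
   interval even if [t] is an end point. *)
pose s := if t < (a + b) / 2 then Num.min (t + d / 2) ((a + b) / 2)
          else Num.max (t - d / 2) ((a + b) / 2).
have [sab sd] : (a < s < b) /\ `|s - t| < d.
  rewrite ltr_norml /s /Order.min /Order.max.
  have [tm|tm] := ltP t ((a + b) / 2).
    by have [?|?] := ltP (t + d / 2) ((a + b) / 2); split; lra.
  by have [?|?] := ltP (t - d / 2) ((a + b) / 2); split; lra.
have -> : u t = u s - (u s - u t) by rewrite opprB addrC subrK.
apply: le_trans (ler_normB _ _) _; apply: lerD; first exact: uK.
by apply: dP => //=; rewrite in_itv /=; case/andP: sab => /ltW -> /ltW ->.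
Qed.

End MeanValue.

Section Coordinates.
Context {R : realType} {n : nat}.
Implicit Types y z w : 'cV[R]_n.

Definition hybrid y z (k : nat) : 'cV[R]_n :=
  \col_i if (i < k)%N then z i ord0 else y i ord0.

Lemma hybridS y z (i : 'I_n) :
  hybrid y z i.+1 = hybrid y z i + (z i ord0 - y i ord0) *: delta_mx i ord0.
Proof.
apply/colP => j; rewrite !mxE eqxx andbT ltnS leq_eqVlt.
rewrite -val_eqE; case: eqP => [ji|_] /=; last by rewrite mulr0 addr0.
by rewrite (val_inj ji) ltnn mulr1 addrC subrK.
Qed.

(* The path from [y] to [z] changes one coordinate at a time. *)
Lemma coordinate_mean_value (G : 'cV[R]_n -> R) (D : 'I_n -> 'cV[R]_n -> R)
    (c : 'I_n -> R) (e : R) y z :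
  (forall i w (s : R), is_derive s 1 (fun s => G (w + s *: delta_mx i ord0))
                 (D i (w + s *: delta_mx i ord0))) ->
  (forall i w, (forall j, Num.min (y j ord0) (z j ord0) <= w j ord0
                            <= Num.max (y j ord0) (z j ord0)) ->
     `|D i w - c i| <= e) ->
  `|G z - G y - \sum_i c i * (z i ord0 - y i ord0)|
    <= e * \sum_i `|z i ord0 - y i ord0|.
Proof.
move=> GD Dc; have hy0 : hybrid y z 0 = y by apply/colP => i; rewrite mxE ltn0.
have hyn : hybrid y z n = z by apply/colP => i; rewrite mxE ltn_ord.
have -> : G z - G y = \sum_(i < n) (G (hybrid y z i.+1) - G (hybrid y z i)).
  rewrite -(big_mkord xpredT (fun i => G (hybrid y z i.+1) - G (hybrid y z i))).
  by rewrite telescope_sumr // hyn hy0.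
rewrite -sumrB mulr_sumr; apply: le_trans (ler_norm_sum _ _ _) _.
apply: ler_sum => i _; rewrite hybridS; set w := hybrid y z i.
pose u (s : R) := G (w + s *: delta_mx i ord0).
have -> : G w = u 0 by rewrite /u scale0r addr0.
rewrite -/(u (z i ord0 - y i ord0)) mulrC.
have := @mean_value_ineq_unord R u (fun s => D i (w + s *: delta_mx i ord0))
  0 (z i ord0 - y i ord0) (c i) e.
rewrite subr0; apply => s sb.
apply: Dc => j; rewrite !mxE eqxx andbT.
case: eqVneq => [->|ji]; last first.
  rewrite mulr0 addr0; case: ifP => _; rewrite ?ge_min ?le_max ?lexx ?orbT //.
rewrite ltnn mulr1; move: sb; rewrite /Order.min /Order.max.
have [?|?] := ltP 0 (z i ord0 - y i ord0); have [?|?] := ltP (y i ord0) (z i ord0); lra.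
Qed.

End Coordinates.

(** * Functions of class C^k on the cylinder *)

Section Cylinder.
Context {R : realType} {n p : nat}.
Variables (T : R) (F : 'cV[R]_n -> R -> 'cV[R]_p).

Lemma box_compact (M : R) : compact [set z : 'cV[R]_n * R | `|z.1| <= M /\ z.2 \in `[0, T]].
Proof.
have -> : [set z : 'cV[R]_n * R | `|z.1| <= M /\ z.2 \in `[0, T]] =
   [set y : 'cV[R]_n | `|y| <= M] `*` `[0, T]%classic by [].
apply: compact_setX; last exact: segment_compact.
have [M0|M0] := ltP M 0.
  rewrite (_ : mkset _ = set0); first exact: compact0.
  by rewrite predeqE => y; split=> //= yM; have := le_lt_trans (le_trans (normr_ge0 y) yM) M0; rewrite ltxx.
(* The max-norm ball is the transpose of a product of segments, for which [rV_compact] applies. *)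
have -> : [set y : 'cV[R]_n | `|y| <= M] =
    trmx @` [set v : 'rV[R]_n | forall i, `[(- M), M]%classic (v ord0 i)].
  rewrite predeqE => y; split=> /= [yM|[v vM <-]].
    exists y^T; rewrite ?trmxK // => i; rewrite mxE in_itv /= -ler_norml.
    exact: le_trans (mx_norm_coef _ _ _) yM.
  apply: mx_norm_le => // i j; rewrite mxE ord1.
  by have := vM i; rewrite in_itv /= ler_norml.
apply: continuous_compact; last first.
  by apply: (@rV_compact R n (fun=> `[- M, M]%classic)) => _; exact: segment_compact.
apply/within_continuousP => v _ e e0; exists e => // w _ wv.
apply: mx_norm_le => [|i j]; first exact: ltW.
rewrite !mxE; apply: le_trans (ltW wv).
by have := mx_norm_coef (w - v) j i; rewrite !mxE.
Qed.

Lemma Ck_cylinder_cont k : Ck_cylinder T k F ->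
  {within [set z : 'cV[R]_n * R | z.2 \in `[0, T]],
    continuous (fun z : 'cV[R]_n * R => F z.1 z.2)}.
Proof. by case: k => [|k] []. Qed.

Lemma Ck_cylinder_deriv k : Ck_cylinder T k.+1 F ->
  [/\ forall (y : 'cV[R]_n) (t : R), 0 <= t <= T ->
           (forall i : 'I_n, derivable (F^~ t) y (delta_mx i ord0)) /\
           derivable_on `[0, T] (F y) t,
         forall i : 'I_n,
           Ck_cylinder T k (fun y t => derive (F^~ t) y (delta_mx i ord0)) &
         Ck_cylinder T k (fun y t => derive_on `[0, T] (F y) t)].
Proof. by move=> [_ [H1 H2 H3]]; split => // y t tT; apply: H1; rewrite in_itv. Qed.

Hypothesis Fc : {within [set z : 'cV[R]_n * R | z.2 \in `[0, T]],
    continuous (fun z : 'cV[R]_n * R => F z.1 z.2)}.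

Lemma cylinder_bounded (M : R) : exists2 C : R, 0 <= C &
  forall y t, `|y| <= M -> 0 <= t <= T -> `|F y t| <= C.
Proof.
have /compact_bounded[C [_ CP]] : compact ((fun z : 'cV[R]_n * R => F z.1 z.2) @`
    [set z : 'cV[R]_n * R | `|z.1| <= M /\ z.2 \in `[0, T]]).
  apply: (continuous_compact _ (@box_compact M)).
  by apply: continuous_subspaceW Fc => z [].
exists (`|C| + 1) => [|y t yM tT]; first by rewrite addr_ge0.
apply: CP => /=; first by rewrite ltr_pwDr // ler_norm.
by exists (y, t).
Qed.

Lemma cylinder_continuous (y : 'cV[R]_n) (t e : R) : 0 <= t <= T -> 0 < e ->
  exists2 d : R, 0 < d & forall z s, `|z - y| < d -> `|s - t| < d -> 0 <= s <= T ->
    `|F z s - F y t| <= e.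
Proof.
move=> tT e0; move/within_continuousP : Fc => /(_ (y, t)) /=; rewrite in_itv.
move=> /(_ tT e e0)[d d0 dP]; exists d => // z s zd sd sT.
apply: (dP (z, s)); rewrite /= ?in_itv //.
by rewrite prod_normE /= gt_max zd.
Qed.

Lemma cylinder_within_continuous (u : R -> 'cV[R]_n) (v : R -> R) (a b : R) :
  {within `[a, b], continuous u} -> {within `[a, b], continuous v} ->
  (forall s, a <= s <= b -> 0 <= v s <= T) ->
  {within `[a, b], continuous (fun s => F (u s) (v s))}.
Proof.
move=> /within_continuousP uc /within_continuousP vc vT; apply/within_continuousP => t tab e e0.
have {}vT s : `[a, b]%classic s -> 0 <= v s <= T by rewrite /= in_itv => /vT.
have [d d0 dP] := cylinder_continuous (u t) (vT _ tab) e0.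
have d20 : 0 < d / 2 by rewrite divr_gt0.
have [d1 d10 d1P] := uc t tab (d / 2) d20; have [d2 d20' d2P] := vc t tab (d / 2) d20.
exists (Num.min d1 d2); first by rewrite lt_min d10.
move=> s sab; rewrite lt_min => /andP[sd1 sd2]; apply: dP; last exact: vT.
  by apply: le_lt_trans (d1P _ sab sd1) _; lra.
by apply: le_lt_trans (d2P _ sab sd2) _; lra.
Qed.

End Cylinder.

Section PartialDerivatives.
Context {R : realType} {n p : nat}.
Variables (T : R) (F : 'cV[R]_n -> R -> 'cV[R]_p).

Lemma is_derive_coef (u : R -> 'cV[R]_p) (t : R) (l : 'cV[R]_p) (q : 'I_p) :
  is_derive t 1 u l -> is_derive t 1 (fun s => u s q ord0) (l q ord0).
Proof.
move=> /is_derive_quotient ul; apply: is_deriveP => e e0.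
have [d d0 dP] := ul e e0; exists d => // s st sd.
apply: le_trans (dP s st sd); apply: le_trans (mx_norm_coef _ q ord0).
by rewrite /diff_quotient !mxE.
Qed.

Lemma is_derive_line (V : normedModType R) (f : V -> 'cV[R]_p) w v (s : R) (q : 'I_p) :
  derivable f (w + s *: v) v ->
  is_derive s 1 (fun s => f (w + s *: v) q ord0) ('D_v f (w + s *: v) q ord0).
Proof.
move=> df; apply: is_deriveP => e e0.
have /cvgrPdist_le/(_ e e0)/nbhs_normP[d /= d0 dP] := df.
exists d => // t ts td.
have -> : diff_quotient (fun s => f (w + s *: v) q ord0) s t
   - 'D_v f (w + s *: v) q ord0 =
  ((t - s)^-1 *: (f ((t - s) *: v + (w + s *: v)) - f (w + s *: v))
      - 'D_v f (w + s *: v)) q ord0.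
  by rewrite !mxE /diff_quotient addrCA -scalerDl subrK.
apply: le_trans (mx_norm_coef _ _ _) _; rewrite distrC.
by apply: dP; rewrite /= ?subr_eq0 // sub0r normrN.
Qed.

Lemma coef_dist_le (y z : 'cV[R]_n) :
  \sum_i `|z i ord0 - y i ord0| <= n%:R * `|z - y|.
Proof.
apply: (@le_trans _ _ (\sum_(i < n) `|z - y|)).
  by apply: ler_sum => i _; have := mx_norm_coef (z - y) i ord0; rewrite !mxE.
by rewrite sumr_const card_ord mulr_natl.
Qed.

(** On the coordinate path from y to z each coordinate stays between those of y and z, so the path
    does not leave the max-norm ball, and the partial derivatives are bounded there by
    compactness. *)
Lemma cylinder_lipschitz (M : R) : Ck_cylinder T 1 F ->
  exists2 L : R, 0 <= L & forall y z t, `|y| <= M -> `|z| <= M -> 0 <= t <= T ->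
    `|F z t - F y t| <= L * `|z - y|.
Proof.
move=> /Ck_cylinder_deriv[Fd Fpart _].
have /choice[C CP] : forall i, exists C : R, 0 <= C /\
    forall y t, `|y| <= M -> 0 <= t <= T -> `|'D_(delta_mx i ord0) (F^~ t) y| <= C.
  move=> i; have [C C0 CP] := cylinder_bounded (Ck_cylinder_cont (Fpart i)) M.
  by exists C.
have C0 i : 0 <= C i := (CP i).1.
exists ((\sum_i C i) * n%:R); first by rewrite mulr_ge0 // sumr_ge0.
move=> y z t yM zM tT; apply: mx_norm_le => [|q j]; first by rewrite !mulr_ge0 // sumr_ge0.
rewrite ord1 !mxE -mulrA.
have := @coordinate_mean_value R n (fun y => F y t q ord0)
  (fun i w => 'D_(delta_mx i ord0) (F^~ t) w q ord0) (fun=> 0) (\sum_i C i) y z.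
set S := \sum_i C i; rewrite big1 => [|i _]; last by rewrite mul0r.
rewrite subr0 => H; apply: le_trans (H _ _) _.
- move=> i w s; apply: is_derive_line; exact: (Fd _ _ tT).1.
- move=> i w wb; rewrite subr0; apply: le_trans (mx_norm_coef _ _ _) _.
  apply: (@le_trans _ _ (C i)); last by rewrite /S (bigD1 i) //= lerDl sumr_ge0.
  apply: (CP i).2 => //; apply: mx_norm_le => [|k k']; first exact: le_trans yM.
  rewrite ord1 ler_norml.
  have := le_trans (mx_norm_coef y k ord0) yM; have := le_trans (mx_norm_coef z k ord0) zM.
  rewrite !ler_norml; have := wb k; rewrite /Order.min /Order.max.
  by have [?|?] := ltP (y k ord0) (z k ord0); lra.
- by rewrite ler_wpM2l ?sumr_ge0 // coef_dist_le.
Qed.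

(** Only partial derivatives are given, so total differentiability is derived along the way. The
    increment splits into a change of the state at the fixed time s, treated along the coordinate
    path with continuity of the partials, and a change of time at the fixed state x(t). *)
Lemma cylinder_chain_rule (x : R -> 'cV[R]_n) (dx : 'cV[R]_n) (t : R) (q : 'I_p) :
  Ck_cylinder T 1 F -> 0 < t < T -> is_derive t 1 x dx ->
  is_derive t 1 (fun t => F (x t) t q ord0)
    (\sum_i 'D_(delta_mx i ord0) (F^~ t) (x t) q ord0 * dx i ord0
       + derive_on `[0, T] (F (x t)) t q ord0).
Proof.
move=> /Ck_cylinder_deriv[Fd Fpart Ftime] /andP[t0 tT] xdx; apply: is_deriveP => e e0.
have tT' : 0 <= t <= T by rewrite !ltW.
pose c i := 'D_(delta_mx i ord0) (F^~ t) (x t) q ord0.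
pose ct := derive_on `[0, T] (F (x t)) t q ord0.
have Ft : is_derive t 1 (fun s => F (x t) s q ord0) ct.
  apply: is_derive_coef; apply: (@diff_quotient_is_derive _ _ _ 0 T); first by rewrite t0.
  exact: (Fd _ _ tT').2.
pose S := \sum_i `|c i|; have S0 : 0 <= S by rewrite sumr_ge0.
(* Three errors of size e / 3 are aimed at. [e1] bounds the oscillation of the partials, which gets
   multiplied by n (|dx| + 1). [e2] bounds the error of the difference quotient of x, which gets
   multiplied by [S]; the cap 1 gives |x s - x t| <= (|dx| + 1) |s - t|. The summands 3 keep the
   denominators positive. *)
pose e1 := e / (3 * n%:R * (`|dx| + 1) + 3); pose e2 := Num.min 1 (e / (3 * S + 3)).
have n0 : 0 <= n%:R :> R by [].
have dx0 := normr_ge0 dx.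
have q1 : 0 < 3 * n%:R * (`|dx| + 1) + 3 by rewrite ltr_wpDl // !mulr_ge0 // addr_ge0.
have e10 : 0 < e1 by rewrite divr_gt0.
have e20 : 0 < e2 by rewrite lt_min ltr01 divr_gt0 //; lra.
have [d1 d10 d1P] : exists2 d : R, 0 < d & forall i w s, `|w - x t| < d -> `|s - t| < d ->
    0 <= s <= T -> `|'D_(delta_mx i ord0) (F^~ s) w q ord0 - c i| <= e1.
  have /choice[d dP] : forall i, exists d : R, 0 < d /\
    forall z s, `|z - x t| < d -> `|s - t| < d -> 0 <= s <= T ->
      `|'D_(delta_mx i ord0) (F^~ s) z - 'D_(delta_mx i ord0) (F^~ t) (x t)| <= e1.
    move=> i; have [d] := cylinder_continuous (Ck_cylinder_cont (Fpart i)) (x t) tT' e10.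
    by exists d.
  exists (\big[Num.min/1]_i d i).
    by apply/bigmin_gtP; split=> // i _; have [] := dP i.
  move=> i w s wd sd sT; apply: le_trans ((dP i).2 w s _ _ sT).
  - by have := mx_norm_coef ('D_(delta_mx i ord0) (F^~ s) w - 'D_(delta_mx i ord0) (F^~ t) (x t)) q ord0; rewrite !mxE.
  - exact: lt_le_trans wd (bigmin_le _ _ _).
  - exact: lt_le_trans sd (bigmin_le _ _ _).
have e30 : 0 < e / 3 by rewrite divr_gt0.
have [d2 d20 d2P] := is_derive_quotient Ft e30.
have [d3 d30 d3P] := is_derive_quotient xdx e20.
exists (Num.min (Num.min d1 (Num.min t (T - t))) (Num.min (Num.min d2 d3) (d1 / (`|dx| + 1)))).
  rewrite !lt_min d10 t0 d20 d30 subr_gt0 tT divr_gt0 //; lra.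
move=> s st; rewrite !lt_min => /andP[/and3P[sd1 sdt sdT] /andP[/andP[sd2 sd3] sd4]].
have sT : 0 <= s <= T by move: sdt sdT; rewrite !ltr_norml => /andP[? ?] /andP[? ?]; lra.
have xq := d3P s st sd3.
have st0 : s - t != 0 by rewrite subr_eq0.
have xs : `|x s - x t| <= (`|dx| + 1) * `|s - t|.
  have -> : x s - x t = (s - t) *: diff_quotient x t s.
    by rewrite /diff_quotient scalerA divff // scale1r.
  rewrite normrZ mulrC ler_wpM2r //.
  have -> : diff_quotient x t s = dx + (diff_quotient x t s - dx) by rewrite addrC subrK.
  apply: le_trans (ler_normD _ _) _; rewrite lerD2l; apply: le_trans xq _.
  by rewrite /e2 ge_min lexx.
have xd1 : `|x s - x t| < d1.
  by apply: le_lt_trans xs _; rewrite -ltr_pdivlMl ?ltr_pwDr // mulrC.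
pose A := F (x s) s q ord0 - F (x t) s q ord0 - \sum_i c i * (x s i ord0 - x t i ord0).
have A_le : `|A| <= e1 * (n%:R * `|x s - x t|).
  apply: (@le_trans _ _ (e1 * \sum_i `|x s i ord0 - x t i ord0|)); last first.
    by rewrite (ler_wpM2l (ltW e10)) // coef_dist_le.
  apply: (coordinate_mean_value (G := fun y => F y s q ord0)
    (D := fun i w => 'D_(delta_mx i ord0) (F^~ s) w q ord0)).
    by move=> i w s'; apply: is_derive_line; exact: (Fd _ _ sT).1.
  move=> i w wb; apply: d1P => //; apply: le_lt_trans xd1.
  apply: mx_norm_le => // k k'; rewrite ord1 !mxE.
  apply: (@le_trans _ _ `|x s k ord0 - x t k ord0|); last first.
    by have := mx_norm_coef (x s - x t) k ord0; rewrite !mxE.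
  have := wb k; rewrite /Order.min /Order.max ler_norml.
  have [?|?] := ltP (x t k ord0) (x s k ord0).
    by rewrite ger0_norm; lra.
  by rewrite ler0_norm; lra.
pose dF := diff_quotient (fun s => F (x t) s q ord0) t s.
pose B := \sum_i c i * ((diff_quotient x t s - dx) i ord0).
have -> : diff_quotient (fun t => F (x t) t q ord0) t s
   - (\sum_i c i * dx i ord0 + ct) = (s - t)^-1 * A + (dF - ct) + B.
  have -> : B = (s - t)^-1 * (\sum_i c i * (x s i ord0 - x t i ord0)) - \sum_i c i * dx i ord0.
    rewrite mulr_sumr -sumrB; apply: eq_bigr => i _.
    by rewrite /diff_quotient !mxE; ring.
  by rewrite /A /dF /diff_quotient /GRing.scale /=; ring.
have h1 : `|(s - t)^-1 * A| <= e / 3.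
  rewrite normrM normfV -ler_pdivlMl ?invr_gt0 ?normr_gt0 // invrK.
  apply: le_trans A_le _.
  apply: (@le_trans _ _ (e1 * (n%:R * ((`|dx| + 1) * `|s - t|)))).
    by rewrite (ler_wpM2l (ltW e10)) // ler_wpM2l.
  have -> : e1 * (n%:R * ((`|dx| + 1) * `|s - t|)) = (e1 * (n%:R * (`|dx| + 1))) * `|s - t| by ring.
  rewrite [leRHS]mulrC ler_wpM2r // /e1 mulrAC ler_pdivrMr //.
  rewrite -subr_ge0 [leRHS](_ : _ = e) ?ltW //.
  by field.
have h2 : `|dF - ct| <= e / 3 by exact: d2P.
have h3 : `|B| <= e / 3.
  apply: (@le_trans _ _ (S * e2)).
    rewrite /S mulr_suml; apply: le_trans (ler_norm_sum _ _ _) _.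
    apply: ler_sum => i _; rewrite normrM ler_wpM2l //.
    exact: le_trans (mx_norm_coef _ _ _) xq.
  apply: (@le_trans _ _ (S * (e / (3 * S + 3)))).
    by rewrite ler_wpM2l // /e2 ge_min lexx orbT.
  rewrite mulrA ler_pdivrMr; last lra.
  by rewrite -subr_ge0 [leRHS](_ : _ = e) ?ltW //; field.
have -> : e = e / 3 + e / 3 + e / 3 by field.
apply: le_trans (ler_normD _ _) _; rewrite lerD //.
by apply: le_trans (ler_normD _ _) _; rewrite lerD.
Qed.

End PartialDerivatives.

(** * Bounded derivatives and Taylor approximation *)

Section CylinderC1.
Context {R : realType}.

Lemma Ck_cylinder_C1 n p (T : R) k (F : 'cV[R]_n -> R -> 'cV[R]_p) :
  Ck_cylinder T k.+1 F -> Ck_cylinder T 1 F.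
Proof.
move=> FC; have [Fd Fpart Ftime] := Ck_cylinder_deriv FC.
split; first exact: Ck_cylinder_cont FC.
split => [y t tT|i|]; first exact: Fd.
- split=> //; exact: Ck_cylinder_cont (Fpart i).
- split=> //; exact: Ck_cylinder_cont Ftime.
Qed.

End CylinderC1.

Section DerivBounded.
Context {R : realType}.
Implicit Types (u v : R -> R) (a b K : R).

(** The successive derivatives are existentially quantified, so that sums, products and compositions
    need no formula for higher derivatives. Nothing is said at the end points, just as in
    [Ck_bounded]. *)
Fixpoint deriv_bounded (k : nat) a b K u : Prop :=
  (forall t, a < t < b -> `|u t| <= K) /\
  (if k is k'.+1 then
     exists2 u', forall t, a < t < b -> is_derive t 1 u (u' t) &
       deriv_bounded k' a b K u'
   else True).

Lemma deriv_bounded0 k a b K u : deriv_bounded k a b K u ->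
  forall t, a < t < b -> `|u t| <= K.
Proof. by case: k => [|k] []. Qed.

Lemma deriv_bounded_weaken k k' a a' b b' K K' u :
  (k' <= k)%N -> a <= a' -> b' <= b -> K <= K' ->
  deriv_bounded k a b K u -> deriv_bounded k' a' b' K' u.
Proof.
move=> + aa' bb' KK'; elim: k' k u => [|k' IH] [|k] u //= kk'.
- move=> [uK _]; split=> // t /andP[? ?].
  by apply: le_trans KK'; apply: uK; apply/andP; split; lra.
- move=> [uK _]; split=> // t /andP[? ?].
  by apply: le_trans KK'; apply: uK; apply/andP; split; lra.
- move=> [uK [u' du u'K]]; split.
    move=> t /andP[? ?].
    by apply: le_trans KK'; apply: uK; apply/andP; split; lra.
  exists u'; last exact: (IH k).
  by move=> t /andP[? ?]; apply: du; apply/andP; split; lra.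
Qed.

Definition bounded_derivs k a b u := exists K, deriv_bounded k a b K u.

Lemma bounded_derivs_pred k a b u :
  bounded_derivs k.+1 a b u -> bounded_derivs k a b u.
Proof.
by move=> [K uK]; exists K; apply: deriv_bounded_weaken uK.
Qed.

Lemma bounded_derivsS k a b u u' K :
  (forall t, a < t < b -> `|u t| <= K) ->
  (forall t, a < t < b -> is_derive t 1 u (u' t)) ->
  bounded_derivs k a b u' -> bounded_derivs k.+1 a b u.
Proof.
move=> uK du [K' u'K]; exists (Num.max K K'); split.
  by move=> t tab; apply: le_trans (uK t tab) _; rewrite le_max lexx.
by exists u' => //; apply: deriv_bounded_weaken u'K; rewrite // le_max lexx orbT.
Qed.

Lemma bounded_derivs_add k a b u v :
  bounded_derivs k a b u -> bounded_derivs k a b v ->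
  bounded_derivs k a b (fun t => u t + v t).
Proof.
elim: k u v => [|k IH] u v.
  move=> [K [uK _]] [K' [vK _]]; exists (K + K'); split => // t tab.
  by apply: le_trans (ler_normD _ _) _; rewrite lerD ?uK ?vK.
move=> [K [uK [u' du u'K]]] [K' [vK [v' dv v'K]]].
apply: (@bounded_derivsS k a b _ (fun t => u' t + v' t) (K + K')).
- by move=> t tab; apply: le_trans (ler_normD _ _) _; rewrite lerD ?uK ?vK.
- by move=> t tab; have ? := du t tab; have ? := dv t tab; exact: is_deriveD.
- by apply: IH; [exists K|exists K'].
Qed.

Lemma bounded_derivs_mul k a b u v :
  bounded_derivs k a b u -> bounded_derivs k a b v ->
  bounded_derivs k a b (fun t => u t * v t).
Proof.
have prod_le x y K K' : `|x| <= K -> `|y| <= K' -> `|x * y| <= K * K' :> R.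
  by move=> xK yK; rewrite normrM ler_pM.
elim: k u v => [|k IH] u v.
  move=> [K [uK _]] [K' [vK _]]; exists (K * K'); split => // t tab.
  by apply: prod_le; [exact: uK|exact: vK].
move=> su sv; move: (su) (sv) => [K [uK [u' du u'K]]] [K' [vK [v' dv v'K]]].
apply: (@bounded_derivsS k a b _ (fun t => u t * v' t + v t * u' t) (K * K')).
- by move=> t tab; apply: prod_le; [exact: uK|exact: vK].
- by move=> t tab; have ? := du t tab; have ? := dv t tab; exact: is_deriveM.
- apply: bounded_derivs_add; apply: IH; try exact: bounded_derivs_pred.
    by exists K'.
  by exists K.
Qed.

Lemma bounded_derivs_cst k a b c : bounded_derivs k a b (fun=> c).
Proof.
elim: k c => [|k IH] c; first by exists `|c|.
apply: (@bounded_derivsS k a b _ (fun=> 0) `|c|).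
- by [].
- exact: IH.
Qed.

Lemma bounded_derivs_sum k a b (I : Type) (s : seq I) (u : I -> R -> R) :
  (forall i, bounded_derivs k a b (u i)) ->
  bounded_derivs k a b (fun t => \sum_(i <- s) u i t).
Proof.
move=> su; elim: s => [|i s IH].
  under eq_fun do rewrite big_nil; exact: bounded_derivs_cst.
under eq_fun do rewrite big_cons; exact: bounded_derivs_add.
Qed.

Lemma bounded_derivs_mulmx k a b m n (A : 'M[R]_(m, n)) (u : R -> 'cV[R]_n) :
  (forall i, bounded_derivs k a b (fun t => u t i ord0)) ->
  forall i, bounded_derivs k a b (fun t => (A *m u t) i ord0).
Proof.
move=> su i; under eq_fun do rewrite mxE.
by apply: bounded_derivs_sum => j; apply: bounded_derivs_mul => //; exact: bounded_derivs_cst.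
Qed.

Lemma Ck_bounded_derivs k T d (v : R -> 'cV[R]_d) j i : (j <= k)%N ->
  Ck_bounded k T v -> bounded_derivs (k - j) 0 T (fun t => derive1n j v t i ord0).
Proof.
move=> + [vd vc vb]; move: {2}(k - j)%N (erefl (k - j)%N) => l.
elim: l j => [|l IH] j kj jk.
  have [K KP] := vb j jk; rewrite kj; exists K; split=> // t t0T.
  by apply: le_trans (norm2_coef _ _) _; apply: KP; rewrite in_itv.
have jk' : (j < k)%N by rewrite -subn_gt0 kj.
have [K KP] := vb j jk; rewrite kj.
apply: (@bounded_derivsS _ _ _ _ (fun t => derive1n j.+1 v t i ord0) K).
- by move=> t t0T; apply: le_trans (norm2_coef _ _) _; apply: KP; rewrite in_itv.
- move=> t t0T; apply: is_derive_coef; apply: DeriveDef.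
    by apply: vd => //; rewrite in_itv.
  by rewrite /derive1n /= derive1E.
- have <- : (k - j.+1 = l)%N by rewrite subnS kj.
  by apply: IH => //; rewrite subnS kj.
Qed.

(** Induction on k by the chain rule: the partials of F are of one class less and the factor [dx] is
    asked for k - 1 derivatives only. So the composite gets one derivative more than [dx]. *)
Lemma bounded_derivs_comp k T n p (F : 'cV[R]_n -> R -> 'cV[R]_p)
    (x dx : R -> 'cV[R]_n) (M : R) (q : 'I_p) :
  Ck_cylinder T k F ->
  (forall t, 0 < t < T -> `|x t| <= M) ->
  (forall t, 0 < t < T -> is_derive t 1 x (dx t)) ->
  (forall i, bounded_derivs k.-1 0 T (fun t => dx t i ord0)) ->
  bounded_derivs k 0 T (fun t => F (x t) t q ord0).
Proof.
move=> + xM xdx; elim: k F => [|k IH] F FC dxK.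
  have [C C0 CP] := cylinder_bounded (Ck_cylinder_cont FC) M.
  exists C; split => // t t0T; apply: le_trans (mx_norm_coef _ _ _) _.
  by apply: CP; [exact: xM|rewrite !ltW //; case/andP: t0T].
have [C C0 CP] := cylinder_bounded (Ck_cylinder_cont FC) M.
have [Fd Fpart Ftime] := Ck_cylinder_deriv FC.
have FC1 := Ck_cylinder_C1 FC.
apply: (bounded_derivsS (K := C) (u' := fun t =>
  \sum_i 'D_(delta_mx i ord0) (F^~ t) (x t) q ord0 * dx t i ord0
       + derive_on `[0, T] (F (x t)) t q ord0)).
- move=> t t0T; apply: le_trans (mx_norm_coef _ _ _) _.
  by apply: CP; [exact: xM|rewrite !ltW //; case/andP: t0T].
- by move=> t t0T; apply: cylinder_chain_rule => //; exact: xdx.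
- have dxK' : forall i, bounded_derivs k.-1 0 T (fun t => dx t i ord0).
    by move=> i; case: k dxK {IH FC Fd Fpart Ftime} => // k dxK; exact: bounded_derivs_pred.
  apply: bounded_derivs_add.
    apply: bounded_derivs_sum => i; apply: bounded_derivs_mul; last exact: dxK.
    exact: IH (Fpart i) dxK'.
  exact: IH Ftime dxK'.
Qed.

End DerivBounded.

(** * Polynomial approximation by repeated integration *)

Section Taylor.
Context {R : realType}.

(** The constant of integration makes p agree with u at the midpoint, a point where u is known to be
    differentiable. The error then grows from 0 with slope at most e. *)
Lemma poly_approx_primitive (u u' : R -> R) (a b e : R) (q : {poly R}) : a < b ->
  (forall t, a < t < b -> is_derive t 1 u (u' t)) ->
  (forall t, a < t < b -> `|u' t - q.[t]| <= e) ->
  exists p : {poly R}, [/\ (size p <= (size q).+1)%N, p^`() = q &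
    forall t, a < t < b -> `|u t - p.[t]| <= e * (b - a)].
Proof.
move=> ab du uq; pose c := (a + b) / 2.
have cab : a < c < b by rewrite /c; lra.
exists (primitive q + (u c - (primitive q).[c])%:P); split.
- apply: leq_trans (size_polyD _ _) _; rewrite geq_max size_primitive.
  by apply: leq_trans (size_polyC_leq1 _) _.
- by rewrite derivD derivC addr0 deriv_primitive.
move=> t tab; pose w s := u s - (primitive q).[s].
have := @mean_value_ineq_unord R w (fun s => u' s - q.[s]) c t 0 e.
have sab s : Num.min c t <= s <= Num.max c t -> a < s < b.
  rewrite /Order.min /Order.max; case/andP: cab tab => ? ? /andP[? ?].
  by have [?|?] := ltP c t; lra.
move=> H; have {}H : `|w t - w c - (t - c) * 0| <= e * `|t - c|.
  apply: H => s /sab sab'.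
    have ? := du s sab'; have := is_derive_poly (primitive q) s.
    by rewrite deriv_primitive => ?; exact: is_deriveB.
  by rewrite subr0; exact: uq.
have -> : u t - (primitive q + (u c - (primitive q).[c])%:P).[t] = w t - w c - (t - c) * 0.
  by rewrite hornerD hornerC /w; ring.
apply: le_trans H _; apply: ler_wpM2l.
  by apply: le_trans (normr_ge0 _) (uq c cab).
by move: cab tab; rewrite ler_norml => /andP[? ?] /andP[? ?]; lra.
Qed.

Lemma taylor_poly k (u : R -> R) (a b K : R) : a < b ->
  deriv_bounded k a b K u ->
  exists2 p : {poly R}, (size p <= k)%N &
    forall t, a < t < b -> `|u t - p.[t]| <= K * (b - a) ^+ k.
Proof.
move=> ab; elim: k u => [|k IH] u /=.
  move=> [uK _]; exists 0; first by rewrite size_poly0.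
  by move=> t tab; rewrite horner0 subr0 expr0 mulr1; exact: uK.
move=> [uK [u' du /IH[q sq uq]]].
have [p [sp dp up]] := poly_approx_primitive ab du uq.
exists p; first exact: leq_trans sp _.
by move=> t tab; rewrite exprSr mulrA; exact: up.
Qed.

(** One polynomial approximates u and, differentiated, also u'. This lets the exactness of the
    Runge-Kutta rule be applied to p and p' together. *)
Lemma taylor_poly_deriv k (u u' : R -> R) (a b K : R) : a < b ->
  (forall t, a < t < b -> is_derive t 1 u (u' t)) ->
  deriv_bounded k a b K u' ->
  exists p : {poly R}, [/\ (size p <= k.+1)%N,
    forall t, a < t < b -> `|u t - p.[t]| <= K * (b - a) ^+ k.+1 &
    forall t, a < t < b -> `|u' t - p^`().[t]| <= K * (b - a) ^+ k].
Proof.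
move=> ab du u'K; have [q sq uq] := taylor_poly ab u'K.
have [p [sp dp up]] := poly_approx_primitive ab du uq.
exists p; split; first exact: leq_trans sp _.
  by move=> t tab; rewrite exprSr mulrA; exact: up.
by rewrite dp.
Qed.

End Taylor.

(** * Elimination of the constraint *)

Section Constraint.
Context {R : realType} {m n : nat}.
Variable B : 'M[R]_(m, n).
Hypothesis B_free : row_free B.

Definition gram_inv : 'M[R]_m := invmx (B *m B^T).
(** The Moore-Penrose inverse of B when B has full row rank; [proj_ker] is then the orthogonal
    projection onto the kernel of B. *)
Definition pinv_constraint : 'M[R]_(n, m) := B^T *m gram_inv.
Definition proj_ker : 'M[R]_n := 1%:M - pinv_constraint *m B.

(** If v B B^T = 0, then w = v B satisfies w w^T = 0, a vanishing sum of squares; so v B = 0, and v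
    = 0 by full row rank. *)
Lemma gram_unit : B *m B^T \in unitmx.
Proof.
rewrite -row_free_unit -kermx_eq0; apply/rowV0P => v /sub_kermxP vBB.
pose w := v *m B.
have w0 : w *m w^T = 0 by rewrite /w trmx_mul !mulmxA -(mulmxA v) vBB mul0mx.
have {}w0 : w = 0.
  apply/rowP => i; rewrite [RHS]mxE; apply/eqP.
  have : (w *m w^T) ord0 ord0 = 0 by rewrite w0 mxE.
  rewrite mxE => /psumr_eq0P H.
  have /H/(_ i isT)/eqP : forall j, true -> 0 <= w ord0 j * w^T j ord0.
    by move=> j _; rewrite [w^T _ _]mxE -expr2 sqr_ge0.
  by rewrite [w^T _ _]mxE mulf_eq0 orbb.
by apply: (row_free_inj B_free); rewrite mul0mx.
Qed.

Lemma mul_pinv_constraint : B *m pinv_constraint = 1%:M.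
Proof. by rewrite /pinv_constraint mulmxA mulmxV // gram_unit. Qed.

Lemma gram_invK : gram_inv *m B *m B^T = 1%:M.
Proof. by rewrite -mulmxA mulVmx // gram_unit. Qed.

Lemma mul_proj_ker : B *m proj_ker = 0.
Proof. by rewrite mulmxBr mulmx1 mulmxA mul_pinv_constraint mul1mx subrr. Qed.

Lemma proj_ker_tr : proj_ker *m B^T = 0.
Proof.
by rewrite mulmxBl mul1mx /pinv_constraint -!mulmxA (mulmxA gram_inv) gram_invK mulmx1 subrr.
Qed.

Lemma proj_ker_split (v : 'cV[R]_n) : v = proj_ker *m v + pinv_constraint *m (B *m v).
Proof. by rewrite mulmxBl mul1mx !mulmxA subrK. Qed.

End Constraint.

(** * Equivalence of the scheme with a projected Runge-Kutta method *)

Section SchemeAsRungeKutta.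
Context {R : realType} {n m r : nat}.
Variables (f : 'cV[R]_n -> R -> 'cV[R]_n) (B : 'M[R]_(m, n)).
Variables (g : R -> 'cV[R]_m) (tau : 'I_r.+1 -> R).
Hypothesis B_free : row_free B.
Hypothesis tau_inj : injective tau.

Local Notation P := (proj_ker B).
Local Notation D := (Dref tau).
Local Notation M := (Mref tau).
Local Notation A := (RKmx tau).

Lemma sum_Dref_diff_vec i (y : 'I_r.+1 -> 'cV[R]_n) :
  \sum_j D i j *: y j = \sum_k Dsub tau i k *: (y (lift ord0 k) - y ord0).
Proof.
apply/colP => c; rewrite !summxE.
transitivity (\sum_j D i j * y j c ord0); first by apply: eq_bigr => j _; rewrite [LHS]mxE.
rewrite (sum_Dref_diff tau_inj).
by apply: eq_bigr => k _; rewrite [RHS]mxE [X in _ = _ * X]mxE [X in _ = _ * (_ + X)]mxE.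
Qed.

Lemma Dsub_solve (z : 'I_r -> 'cV[R]_n) (w : 'I_r.+1 -> 'cV[R]_n) :
  (forall i, \sum_k Dsub tau i k *: z k = \sum_j M i j *: w j) <->
  (forall k, z k = \sum_j A k j *: w j).
Proof.
pose Z : 'M[R]_(r, n) := \matrix_(k, c) z k c ord0.
pose W : 'M[R]_(r.+1, n) := \matrix_(j, c) w j c ord0.
have sumZ (r' s : nat) (Q : 'M[R]_(r', s)) (v : 'I_s -> 'cV[R]_n) i c :
    (\sum_j Q i j *: v j) c ord0 = (Q *m \matrix_(j, c) v j c ord0) i c.
  by rewrite summxE [RHS]mxE; apply: eq_bigr => j _; rewrite [LHS]mxE [in RHS]mxE.
have solve : (Dsub tau *m Z = M *m W) <-> (Z = A *m W).
  rewrite /RKmx -mulmxA; split=> [<-|->]; first by rewrite mulKmx // Dsub_unit.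
  by rewrite mulKVmx // Dsub_unit.
split=> H.
  have /solve ZW : Dsub tau *m Z = M *m W.
    by apply/matrixP => i c; rewrite -!sumZ H.
  by move=> k; apply/colP => c; rewrite sumZ -ZW mxE.
have /solve ZW : Z = A *m W.
  by apply/matrixP => k c; rewrite -sumZ -H mxE.
by move=> i; apply/colP => c; rewrite !sumZ ZW.
Qed.

(** P annihilates B^T mu, which leaves a system for P y that [Dsub] solves; the constraint fixes the
    complementary component of y. As [gram_inv B *m B] is a left inverse of B^T, the multipliers are
    read off from the residual. The factor s may be 0, which covers the start of a branch. *)
Lemma cG_systemP (s : R) (t : 'I_r.+1 -> R) (y : 'I_r.+1 -> 'cV[R]_n) (mu : 'I_r -> 'cV[R]_m) :
  B *m y ord0 = g (t ord0) ->
  cG_system f B g D (s *: M) t y mu <->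
  (forall k, y (lift ord0 k) = y ord0
      + pinv_constraint B *m (g (t (lift ord0 k)) - g (t ord0))
      + s *: \sum_j A k j *: (P *m f (y j) (t j))) /\
  (forall i, mu i = gram_inv B *m B *m
      (s *: \sum_j M i j *: f (y j) (t j) - \sum_j D i j *: y j)).
Proof.
move=> By0.
have sumsM i : \sum_j (s *: M) i j *: f (y j) (t j) = s *: \sum_j M i j *: f (y j) (t j).
  by rewrite scaler_sumr; apply: eq_bigr => j _; rewrite mxE scalerA.
have PB v : P *m (B^T *m v) = 0 by rewrite mulmxA proj_ker_tr // mul0mx.
have Psum s' (Q : 'M[R]_(r, s')) i (v : 'I_s' -> 'cV[R]_n) :
    P *m (\sum_j Q i j *: v j) = \sum_j Q i j *: (P *m v j).
  by rewrite mulmx_sumr; apply: eq_bigr => j _; rewrite scalemxAr.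
have RK_scale k : s *: \sum_j A k j *: (P *m f (y j) (t j)) =
    \sum_j A k j *: (P *m (s *: f (y j) (t j))).
  by rewrite scaler_sumr; apply: eq_bigr => j _; rewrite -scalemxAr !scalerA mulrC.
have M_scale i : \sum_j M i j *: (P *m (s *: f (y j) (t j))) =
    P *m (s *: \sum_j M i j *: f (y j) (t j)).
  rewrite -scalemxAr Psum scaler_sumr.
  by apply: eq_bigr => j _; rewrite -scalemxAr !scalerA mulrC.
split=> [[eqD eqB]|[eqy eqmu]].
- have {}eqD i : B^T *m mu i = s *: \sum_j M i j *: f (y j) (t j) - \sum_j D i j *: y j.
    have := eqD i; rewrite sumsM addrC => /eqP; rewrite addr_eq0 => /eqP ->.
    by rewrite opprB.
  split=> [k|i]; last by rewrite -eqD mulmxA gram_invK // mul1mx.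
  have : forall i, \sum_k Dsub tau i k *: (P *m (y (lift ord0 k) - y ord0)) =
      \sum_j M i j *: (P *m (s *: f (y j) (t j))).
    move=> i; rewrite -Psum -sum_Dref_diff_vec M_scale.
    by have := PB _ (mu i); rewrite eqD mulmxBr => /eqP; rewrite subr_eq0 => /eqP ->.
  move=> /Dsub_solve/(_ k); rewrite RK_scale => <-.
  have := proj_ker_split B (y (lift ord0 k) - y ord0).
  rewrite (mulmxBr B) By0.
  have /eqP := eqB k; rewrite subr_eq0 => /eqP -> yk.
  by rewrite -addrA [X in _ + X]addrC -yk addrC subrK.
have Py k : y (lift ord0 k) - y ord0 =
    pinv_constraint B *m (g (t (lift ord0 k)) - g (t ord0))
      + \sum_j A k j *: (P *m (s *: f (y j) (t j))).
  by rewrite eqy RK_scale -(addrA (y ord0)) [LHS]addrC addKr.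
have BP v : B *m (P *m v) = 0 by rewrite mulmxA mul_proj_ker // mul0mx.
have By k : B *m (y (lift ord0 k) - y ord0) = g (t (lift ord0 k)) - g (t ord0).
  rewrite Py mulmxDr mulmxA mul_pinv_constraint // mul1mx mulmx_sumr big1 ?addr0 // => j _.
  by rewrite -scalemxAr BP scaler0.
split=> [i|k]; last first.
  by have := By k; rewrite mulmxBr By0 => /addIr ->; rewrite subrr.
rewrite sumsM eqmu.
(* The residual has no component in the kernel of B, so it lies in the range of B^T and is balanced
   by the prescribed multipliers. *)
have PD : P *m (\sum_j D i j *: y j) = P *m (s *: \sum_j M i j *: f (y j) (t j)).
  rewrite sum_Dref_diff_vec Psum -M_scale.
  move: i; apply/Dsub_solve => k.
  by have := proj_ker_split B (y (lift ord0 k) - y ord0); rewrite By Py addrC => /addIr <-.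
set a := \sum_j D i j *: y j; set b := s *: _.
have -> : a - b = - (b - a) by rewrite opprB.
have := proj_ker_split B (b - a); rewrite mulmxBr -PD subrr add0r /pinv_constraint => {1}->.
by rewrite !mulmxA addrC subrr.
Qed.

End SchemeAsRungeKutta.

(** * Solution of one step *)

HB.instance Definition _ (R : realType) (n r : nat) := Complete.on 'M[R]_(n, r).

Section FixedPoint.
Context {R : realType} {X : completeNormedModType R}.

Lemma contraction_fixed_point (Phi : X -> X) (q : R) : 0 <= q < 1 ->
  (forall y z, `|Phi y - Phi z| <= q * `|y - z|) -> exists p, Phi p = p.
Proof.
move=> /andP[q0 q1] Phiq.
have Phi_fun : set_fun [set: X] [set: X] Phi by [].
pose Psi : {fun [set: X] >-> [set: X]} := HB.pack Phi (isFun.Build _ _ _ _ Phi Phi_fun).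
have [||p _ pP] := @banach_fixed_point R X setT Psi _ closedT.
- exists (NngNum q0); split=> // -[y z] _ /=; exact: Phiq.
- by exists 0.
- by exists p.
Qed.

End FixedPoint.

Section WithinContinuous.
Context {R : realType}.
Variables (A : set R).

Lemma within_continuous_mulmx m n (B : 'M[R]_(m, n)) (u : R -> 'cV[R]_n) :
  {within A, continuous u} -> {within A, continuous (fun s => B *m u s)}.
Proof.
move=> /within_continuousP uc; apply/within_continuousP => t At e e0.
have K0 : 0 < n%:R * `|B| + 1 by rewrite ltr_wpDl // mulr_ge0.
have [d d0 dP] := uc t At (e / (n%:R * `|B| + 1)) (divr_gt0 e0 K0).
exists d => // s As sd; rewrite -mulmxBr; apply: le_trans (mx_norm_mul _ _) _.
apply: (@le_trans _ _ ((n%:R * `|B| + 1) * (e / (n%:R * `|B| + 1)))).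
  by rewrite ler_pM // ?mulr_ge0 ?lerDl // dP.
by rewrite mulrC divfK // gt_eqF.
Qed.

Lemma within_continuous_sum (V : normedModType R) (I : Type) (s : seq I) (u : I -> R -> V) :
  (forall i, {within A, continuous (u i)}) ->
  {within A, continuous (fun t => \sum_(i <- s) u i t)}.
Proof.
move=> uc; elim: s => [|i s IH].
  under eq_fun do rewrite big_nil; by move=> x; exact: cvg_cst.
under eq_fun do rewrite big_cons; by move=> x; apply: cvgD; [exact: uc|exact: IH].
Qed.

End WithinContinuous.

Section Clamp.
Context {R : realType} {n : nat}.

(** For M >= 0 a retraction onto the max-norm ball. Acting coordinatewise it is 1-Lipschitz in the
    max norm, so the truncated f keeps its Lipschitz constant. *)
Definition clamp (M : R) (y : 'cV[R]_n) : 'cV[R]_n :=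
  \col_i Num.max (- M) (Num.min M (y i ord0)).

Lemma clamp_le M y : 0 <= M -> `|clamp M y| <= M.
Proof.
move=> M0; apply: mx_norm_le => // i j; rewrite mxE ler_norml /Order.min /Order.max.
by have [?|?] := ltP M (y i ord0); case: ltP => ?; lra.
Qed.

Lemma clamp_lipschitz M y z : `|clamp M y - clamp M z| <= `|y - z|.
Proof.
apply: mx_norm_le => // i j; rewrite !mxE.
apply: (@le_trans _ _ `|y i ord0 - z i ord0|); last first.
  by have := mx_norm_coef (y - z) i ord0; rewrite !mxE.
move: (y i ord0) (z i ord0) => a b; rewrite ler_norml /Order.min /Order.max.
have h1 := ler_norm (a - b); have h2 := ler_norm (b - a); rewrite (distrC b a) in h2.
have [?|?] := ltP M a; have [?|?] := ltP M b.
- by case: ltP => ?; lra.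
- by have [?|?] := ltP (- M) M; have [?|?] := ltP (- M) b; lra.
- by have [?|?] := ltP (- M) M; have [?|?] := ltP (- M) a; lra.
- by have [?|?] := ltP (- M) a; have [?|?] := ltP (- M) b; lra.
Qed.

Lemma clamp_id M y : `|y| <= M -> clamp M y = y.
Proof.
move=> yM; apply/colP => i; rewrite mxE.
have := le_trans (mx_norm_coef y i ord0) yM; rewrite ler_norml /Order.min /Order.max.
by have [?|?] := ltP M (y i ord0); case: ltP => ?; lra.
Qed.

End Clamp.

Section LocalStep.
Context {R : realType} {n m r : nat}.
Variables (f : 'cV[R]_n -> R -> 'cV[R]_n) (B : 'M[R]_(m, n)).
Variables (g : R -> 'cV[R]_m) (tau : 'I_r.+1 -> R) (T rho Fb L Lg : R).
Hypothesis B_free : row_free B.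
Hypothesis tau_inj : injective tau.
Hypothesis tau01 : forall j, 0 <= tau j <= 1.
Hypothesis tau0 : tau ord0 = 0.
Hypothesis rho_ge0 : 0 <= rho.
Hypothesis Fb_ge0 : 0 <= Fb.
Hypothesis L_ge0 : 0 <= L.
Hypothesis Lg_ge0 : 0 <= Lg.
Hypothesis f_cont : {within [set z : 'cV[R]_n * R | z.2 \in `[0, T]],
    continuous (fun z : 'cV[R]_n * R => f z.1 z.2)}.
Hypothesis f_bound : forall (y : 'cV[R]_n) (t : R), `|y| <= rho -> 0 <= t <= T -> `|f y t| <= Fb.
Hypothesis f_lip : forall (y z : 'cV[R]_n) (t : R), `|y| <= rho -> `|z| <= rho -> 0 <= t <= T ->
  `|f z t - f y t| <= L * `|z - y|.
Hypothesis g_lip : forall s t : R, 0 <= s <= T -> 0 <= t <= T ->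
  `|g t - g s| <= Lg * `|t - s|.

Local Notation P := (proj_ker B).
Local Notation A := (RKmx tau).

(** The factor n |P| bounds the operator norm of P for the max norm. Summing over all entries of A
    gives one constant for all stages. *)
Definition RKconst : R := (\sum_k \sum_j `|A k j|) * (n%:R * `|P|).

Lemma RKconst_ge0 : 0 <= RKconst.
Proof. by rewrite mulr_ge0 ?mulr_ge0 // sumr_ge0 // => k _; exact: sumr_ge0. Qed.

Lemma RK_sum_bound k (v : 'I_r.+1 -> 'cV[R]_n) V : (forall j, `|v j| <= V) ->
  `|\sum_j A k j *: (P *m v j)| <= RKconst * V.
Proof.
move=> vV; have V0 : 0 <= V := le_trans (normr_ge0 _) (vV ord0).
apply: (@le_trans _ _ (\sum_j `|A k j| * (n%:R * `|P| * V))).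
  apply: le_trans (ler_norm_sum _ _ _) _; apply: ler_sum => j _.
  rewrite normrZ ler_wpM2l //; apply: le_trans (mx_norm_mul _ _) _.
  by rewrite ler_wpM2l // mulr_ge0.
rewrite -mulr_suml -[leRHS]mulrA ler_wpM2r ?mulr_ge0 //.
by rewrite (bigD1 k) //= lerDl sumr_ge0 // => i _; exact: sumr_ge0.
Qed.

Lemma node0 a h : node tau a h ord0 = a.
Proof. by rewrite /node tau0 mulr0 addr0. Qed.

Lemma node_in a h j : 0 <= a -> 0 <= h -> a + h <= T -> 0 <= node tau a h j <= T.
Proof.
move=> a0 h0 ahT; have /andP[t0 t1] := tau01 j; rewrite /node addr_ge0 ?mulr_ge0 //=.
by apply: le_trans ahT; rewrite lerD2l -[leRHS]mulr1 ler_wpM2l.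
Qed.

Definition RK_system a s (y : 'I_r.+1 -> 'cV[R]_n) := forall k,
  y (lift ord0 k) = y ord0
    + pinv_constraint B *m (g (node tau a s (lift ord0 k)) - g a)
    + s *: \sum_j A k j *: (P *m f (y j) (node tau a s j)).

(** Speed at which stages in the ball can leave the start value: the first term comes from the
    constraint data g, the second from f, and 1 is added for positivity. *)
Definition growth : R := m%:R * `|pinv_constraint B| * Lg + RKconst * Fb + 1.

Lemma growth_gt0 : 0 < growth.
Proof.
rewrite ltr_wpDl // addr_ge0 //; last exact: mulr_ge0 RKconst_ge0 Fb_ge0.
by rewrite !mulr_ge0.
Qed.

Lemma increment_bound a s (v : 'I_r.+1 -> 'cV[R]_n) k :
  0 <= a -> 0 <= s -> a + s <= T -> (forall j, `|v j| <= Fb) ->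
  `|pinv_constraint B *m (g (node tau a s (lift ord0 k)) - g a)
    + s *: \sum_j A k j *: (P *m v j)| <= growth * s.
Proof.
move=> a0 s0 asT vF; have aT : 0 <= a <= T by rewrite a0 /= (le_trans _ asT) // lerDl.
have nT := node_in (lift ord0 k) a0 s0 asT.
apply: le_trans (ler_normD _ _) _.
rewrite /growth mulrDl mul1r -[leLHS]addr0 lerD // mulrDl lerD //.
  apply: le_trans (mx_norm_mul _ _) _; rewrite -[leRHS]mulrA ler_wpM2l ?mulr_ge0 //.
  apply: le_trans (g_lip aT nT) _; rewrite ler_wpM2l // /node addrAC subrr add0r.
  have /andP[t0 t1] := tau01 (lift ord0 k).
  by rewrite ger0_norm ?mulr_ge0 // -[leRHS]mulr1 ler_wpM2l.
by rewrite normrZ ger0_norm // mulrC ler_wpM2r // RK_sum_bound.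
Qed.

Lemma RK_growth a s y : 0 <= a -> 0 <= s -> a + s <= T ->
  (forall j, `|y j| <= rho) -> RK_system a s y ->
  forall j, `|y j - y ord0| <= growth * s.
Proof.
move=> a0 s0 asT yr RK j; case: (unliftP ord0 j) => [k|] ->; last first.
  by rewrite subrr normr0 mulr_ge0 // ltW // growth_gt0.
rewrite RK -(addrA (y ord0)) [X in `|X|]addrC addKr; apply: increment_bound => // i.
exact: f_bound (yr i) (node_in i a0 s0 asT).
Qed.

Lemma cG_systemE a s (y : 'I_r.+1 -> 'cV[R]_n) (mu : 'I_r -> 'cV[R]_m) :
  B *m y ord0 = g a ->
  cG_system f B g (Dref tau) (s *: Mref tau) (node tau a s) y mu <->
  RK_system a s y /\
  (forall i, mu i = gram_inv B *m B *m
      (s *: \sum_j Mref tau i j *: f (y j) (node tau a s j) - \sum_j Dref tau i j *: y j)).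
Proof.
by move=> By0; rewrite cG_systemP // node0.
Qed.

(** On the reference element the limit s = 0 becomes an ordinary instance: the factor s of [Mref]
    vanishes and all nodes coincide with a. *)
Lemma branch_system a h (y : R -> 'I_r.+1 -> 'cV[R]_n) (mu : R -> 'I_r -> 'cV[R]_m) :
  0 < h ->
  (cG_system f B g (Dmx tau a h) 0 (fun=> a) (y 0) (mu 0) /\
  (forall s : R, s \in `]0, h] ->
        cG_system f B g (Dmx tau a s) (Mmx tau a s) (node tau a s) (y s) (mu s))) <->
  (forall s : R, 0 <= s <= h ->
     cG_system f B g (Dref tau) (s *: Mref tau) (node tau a s) (y s) (mu s)).
Proof.
move=> h0; have node_0 : node tau a 0 = fun=> a.
  by apply/funext => j; rewrite /node mul0r addr0.
split=> [[s0 ss] s|ss].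
  rewrite le_eqVlt => /andP[/predU1P[<- _|sp sh]].
    by rewrite scale0r node_0 -(Dmx_ref tau a h0).
  by have := ss s; rewrite in_itv /= sp sh Dmx_ref // Mmx_ref //; apply.
split; last first.
  move=> s; rewrite in_itv /= => /andP[s0 sh].
  by rewrite Dmx_ref // Mmx_ref //; apply: ss; rewrite ltW.
have := ss 0; rewrite lexx ltW // scale0r node_0 (Dmx_ref tau a h0); exact.
Qed.

(** Continuation along an arbitrary branch. The total distance [u] of the stages from the start
    value is continuous and vanishes at s = 0. Wherever u <= 1 the stages are in the ball, so
    [RK_growth] forces u < 1. Hence u never takes the value 1, and by the intermediate value theorem
    it stays below. *)
Lemma cG_step_RK a h x lam : 0 <= a -> 0 < h -> a + h <= T ->
  cG_step f B g tau a h x lam -> B *m x ord0 = g a -> `|x ord0| <= rho - 1 ->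
  r.+1%:R * growth * h < 1 ->
  [/\ forall j, `|x j| <= rho, RK_system a h x &
    forall i, lam i = gram_inv B *m B *m
      (h *: \sum_j Mref tau i j *: f (x j) (node tau a h j) - \sum_j Dref tau i j *: x j)].
Proof.
move=> a0 h0 ahT [y [mu [[yc muc] y0 sys0 sys1 [yh muh]]]] Bx0 x0r hsmall.
have sys := (branch_system a y mu h0).1 (conj sys0 sys1).
have {}y0 s : 0 <= s <= h -> y s ord0 = x ord0 by move=> sh; apply: y0; rewrite in_itv.
have RK (s : R) : 0 <= s <= h -> RK_system a s (y s).
  by move=> sh; have /cG_systemE[|//] := sys s sh; rewrite y0.
pose u s := \sum_j `|y s j - x ord0|.
have in_box (s : R) : 0 <= s <= h -> u s <= 1 -> forall j, `|y s j| <= rho.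
  move=> sh us j; rewrite -(subrK (x ord0) (y s j)); apply: le_trans (ler_normD _ _) _.
  suff : `|y s j - x ord0| <= 1 by lra.
  by apply: le_trans us; rewrite /u (bigD1 j) //= lerDl sumr_ge0.
have u_lt1 (s : R) : 0 <= s <= h -> u s <= 1 -> u s < 1.
  move=> /[dup] sh /andP[s0 sh'] us; apply: le_lt_trans hsmall.
  apply: (@le_trans _ _ (\sum_(j < r.+1) growth * s)).
    apply: ler_sum => j _; rewrite -(y0 s) //.
    by apply: (RK_growth a0 s0 _ (in_box s sh us) (RK s sh)); lra.
  rewrite sumr_const card_ord -mulrA mulr_natl lerMn2r ler_wpM2l ?orbT //.
  by rewrite ltW // growth_gt0.
have uc : {within `[0, h], continuous u}.
  apply: within_continuous_sum => j; move=> s; apply: cvg_norm; apply: cvgB; first exact: yc.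
  exact: cvg_cst.
have u0 : u 0 < 1.
  have RK0 : forall j, y 0 j = x ord0.
    move=> j; case: (unliftP ord0 j) => [k|] ->; last by rewrite y0 // lexx ltW.
    rewrite (RK 0) ?lexx ?ltW // scale0r addr0 y0 ?lexx ?ltW //.
    by rewrite /node mul0r addr0 subrr mulmx0 addr0.
  by rewrite /u big1 // => j _; rewrite RK0 subrr normr0.
have uh : u h <= 1.
  rewrite leNgt; apply/negP => uh.
  have [|c] := @IVT R u 0 h 1 (ltW h0) uc.
    by rewrite /Order.min /Order.max (lt_trans u0 uh) !ltW.
  rewrite in_itv => ch uc1; have := u_lt1 c ch.
  by rewrite uc1 lexx ltxx => /(_ isT).
have hh : 0 <= h <= h by rewrite lexx ltW.
rewrite -yh -muh; split; first exact: in_box.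
  exact: RK.
by have /cG_systemE[|//] := sys h hh; rewrite y0.
Qed.

Section Existence.
Variables (a h : R) (y0 : 'cV[R]_n).
Hypothesis a_ge0 : 0 <= a.
Hypothesis h_gt0 : 0 < h.
Hypothesis ah_le : a + h <= T.
Hypothesis By0 : B *m y0 = g a.
Hypothesis y0_rho : `|y0| <= rho - 1.
Hypothesis growth_h : growth * h <= 1.
Hypothesis RK_h : RKconst * L * h <= 2^-1.

(** The unknown stages are the columns of a single matrix, so that the fixed point is sought in a
    complete normed space; node 0 carries the prescribed start value. *)
Definition stages (Y : 'M[R]_(n, r)) (j : 'I_r.+1) : 'cV[R]_n :=
  if unlift ord0 j is Some k then col k Y else y0.

Lemma stages0 Y : stages Y ord0 = y0.
Proof. by rewrite /stages unlift_none. Qed.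

Lemma stages_lift Y k : stages Y (lift ord0 k) = col k Y.
Proof. by rewrite /stages liftK. Qed.

Lemma stages_dist Y Z j : `|stages Y j - stages Z j| <= `|Y - Z|.
Proof.
case: (unliftP ord0 j) => [k|] ->; last by rewrite !stages0 subrr normr0.
rewrite !stages_lift; apply: mx_norm_le => // i i'; rewrite !mxE.
by have := mx_norm_coef (Y - Z) i k; rewrite !mxE.
Qed.

(* Clamping makes the right-hand side globally Lipschitz without changing it
   on the ball of radius [rho], in which the fixed point lies. *)
Definition stage_increment (s : R) Y k :=
  pinv_constraint B *m (g (node tau a s (lift ord0 k)) - g a)
    + s *: \sum_j A k j *: (P *m f (clamp rho (stages Y j)) (node tau a s j)).

Definition stage_map (s : R) Y : 'M[R]_(n, r) :=
  \matrix_(i, k) (y0 + stage_increment s Y k) i ord0.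

Lemma col_stage_map (s : R) Y k : col k (stage_map s Y) = y0 + stage_increment s Y k.
Proof. by apply/colP => i; rewrite !mxE. Qed.

Lemma stage_mapB (s s' : R) Y Z i k : (stage_map s Y - stage_map s' Z) i k =
  (stage_increment s Y k - stage_increment s' Z k) i ord0.
Proof.
have mxBE p q (M N : 'M[R]_(p, q)) i' j : (M - N) i' j = M i' j - N i' j by rewrite !mxE.
have coef_map s'' X : stage_map s'' X i k = y0 i ord0 + stage_increment s'' X k i ord0.
  by rewrite [LHS]mxE [LHS]mxE.
by rewrite !mxBE !coef_map; ring.
Qed.

Lemma node_step (s : R) j : 0 <= s <= h -> 0 <= node tau a s j <= T.
Proof. by have := ah_le => ? /andP[s0 sh]; apply: node_in => //; lra. Qed.

Lemma stage_map_contraction (s : R) Y Z : 0 <= s <= h ->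
  `|stage_map s Y - stage_map s Z| <= 2^-1 * `|Y - Z|.
Proof.
move=> /[dup] sh /andP[s0 sh']; apply: mx_norm_le => [|i k]; first by rewrite mulr_ge0.
rewrite stage_mapB.
apply: le_trans (mx_norm_coef _ _ _) _.
rewrite /stage_increment opprD addrACA subrr add0r -scalerBr -sumrB.
under eq_bigr do rewrite -scalerBr -mulmxBr.
rewrite normrZ (ger0_norm s0).
apply: (@le_trans _ _ (s * (RKconst * (L * `|Y - Z|)))).
  rewrite ler_wpM2l //; apply: RK_sum_bound => j.
  apply: le_trans (f_lip _ _ (node_step j sh)) _; try exact: clamp_le.
  rewrite ler_wpM2l //; apply: le_trans (clamp_lipschitz _ _ _) _.
  exact: stages_dist.
have -> : s * (RKconst * (L * `|Y - Z|)) = (RKconst * L * s) * `|Y - Z| by ring.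
rewrite ler_wpM2r //; apply: le_trans RK_h; rewrite ler_wpM2l //.
exact: mulr_ge0 RKconst_ge0 L_ge0.
Qed.

Lemma within_continuous_node j :
  {within `[0, h], continuous (fun s => node tau a s j)}.
Proof.
apply: continuous_subspaceT => s; apply: cvgD; first exact: cvg_cst.
by apply: cvgM; [exact: cvg_id|exact: cvg_cst].
Qed.

Lemma within_continuous_scale V (u : R -> 'cV[R]_V) :
  {within `[0, h], continuous u} -> {within `[0, h], continuous (fun s => s *: u s)}.
Proof.
move=> uc s; apply: cvgZ; last exact: uc.
have idc : {within `[0, h], continuous (fun s : R => s)}.
  by apply: continuous_subspaceT => x; exact: cvg_id.
exact: idc.
Qed.

Lemma g_node_continuous j : {within `[0, h], continuous (fun s => g (node tau a s j))}.
Proof.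
apply/within_continuousP => s sh e e0.
have Lg1 : 0 < Lg + 1 by rewrite ltr_wpDl.
exists (e / (Lg + 1)); first exact: divr_gt0.
have hs (s' : R) : `[0, h]%classic s' -> 0 <= node tau a s' j <= T.
  by rewrite /= in_itv /= => /node_step.
move=> s' s'h ss'; apply: le_trans (g_lip (hs _ sh) (hs _ s'h)) _.
have -> : node tau a s' j - node tau a s j = (s' - s) * tau j by rewrite /node; ring.
have /andP[t0 t1] := tau01 j.
apply: (@le_trans _ _ ((Lg + 1) * (e / (Lg + 1)))); last by rewrite mulrC divfK // gt_eqF.
rewrite ler_pM // ?lerDl // normrM (ger0_norm t0).
by apply: le_trans (ltW ss'); rewrite -[leRHS]mulr1 ler_wpM2l.
Qed.

Lemma stage_map_continuous Y : {within `[0, h], continuous (stage_map^~ Y)}.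
Proof.
have incc k : {within `[0, h], continuous (fun s => stage_increment s Y k)}.
  move=> s; apply: cvgD.
    apply: within_continuous_mulmx => s'; apply: cvgB; first exact: g_node_continuous.
    exact: cvg_cst.
  apply: within_continuous_scale; apply: within_continuous_sum => j s'.
  apply: cvgZr; apply: within_continuous_mulmx.
  apply: (cylinder_within_continuous f_cont (u := fun=> clamp rho (stages Y j))).
  - by move=> x; exact: cvg_cst.
  - exact: within_continuous_node.
  - by move=> s''; exact: node_step.
apply/within_continuousP => s sh e e0.
have /choice[d dP] : forall k, exists d : R, 0 < d /\ forall s' : R,
    `[0, h]%classic s' -> `|s' - s| < d ->
    `|stage_increment s' Y k - stage_increment s Y k| <= e.
  by move=> k; have /within_continuousP/(_ s sh e e0)[d d0 dP] := incc k; exists d.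
exists (\big[Num.min/1]_k d k).
  by apply/bigmin_gtP; split=> // k _; exact: (dP k).1.
move=> s' s'h ss'; apply: mx_norm_le => [|i k]; first exact: ltW.
apply: le_trans ((dP k).2 s' s'h (lt_le_trans ss' (bigmin_le _ _ _))).
apply: le_trans (mx_norm_coef _ i ord0).
by rewrite stage_mapB.
Qed.

Lemma cG_step_exists : exists x lam, x ord0 = y0 /\ cG_step f B g tau a h x lam.
Proof.
have ahT := ah_le; have y0r := y0_rho; have gh := growth_h.
have /choice[Y YP] : forall s : R, exists Y, 0 <= s <= h -> stage_map s Y = Y.
  move=> s; have [sh|sh] := boolP (0 <= s <= h); last by exists 0.
  have [|Y YP] := @contraction_fixed_point R _ (stage_map s) 2^-1 _ (fun Y Z => stage_map_contraction Y Z sh).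
    by rewrite invr_ge0 ler0n invf_lt1 ?ltr1n.
  by exists Y.
(* The fixed points were chosen separately for each s. Continuity comes from the contraction: |Y s'
   - Y s| is at most half of itself plus the change of [stage_map] at the fixed argument Y s. *)
have Yc : {within `[0, h], continuous Y}.
  apply/within_continuousP => s sh e e0; have e20 : 0 < e / 2 by rewrite divr_gt0.
  have /within_continuousP/(_ s sh _ e20)[d d0 dP] := @stage_map_continuous (Y s).
  exists d => // s' s'h ss'; have := dP s' s'h ss'.
  have shh : 0 <= s <= h by move: sh; rewrite /= in_itv.
  have s'hh : 0 <= s' <= h by move: s'h; rewrite /= in_itv.
  rewrite (YP s shh) => h1; have := stage_map_contraction (Y s') (Y s) s'hh.
  rewrite (YP s' s'hh) => h2.
  have : `|Y s' - Y s| <= `|Y s' - stage_map s' (Y s)| + `|stage_map s' (Y s) - Y s|.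
    exact: ler_distD.
  by lra.
pose y s j := stages (Y s) j.
(* The clamped f is bounded by [Fb], so the fixed point is within growth h <= 1 of y0. It lies in
   the ball, where clamping changes nothing. *)
have y_box (s : R) j : 0 <= s <= h -> `|y s j| <= rho.
  move=> /[dup] sh /andP[s0 sh'].
  case: (unliftP ord0 j) => [k|] ->; last by rewrite /y stages0; lra.
  rewrite /y stages_lift -(YP s sh) col_stage_map; apply: le_trans (ler_normD _ _) _.
  have : `|stage_increment s (Y s) k| <= growth * s.
    apply: increment_bound => //; first lra.
    move=> i; apply: f_bound; [exact: clamp_le|exact: node_step].
  have : growth * s <= growth * h by rewrite ler_wpM2l // ltW // growth_gt0.
  by lra.
have RK (s : R) : 0 <= s <= h -> RK_system a s (y s).
  move=> sh k; rewrite {1 2}/y stages_lift stages0 -(YP s sh) col_stage_map -addrA.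
  congr (_ + (_ + _ *: _)); apply: eq_bigr => j _.
  by rewrite clamp_id //; exact: y_box.
have yc j : {within `[0, h], continuous (y^~ j)}.
  apply/within_continuousP => s sh e e0; have /within_continuousP/(_ s sh e e0)[d d0 dP] := Yc.
  by exists d => // s' s'h ss'; apply: le_trans (stages_dist _ _ _) (dP s' s'h ss').
pose mu s i := gram_inv B *m B *m
      (s *: \sum_j Mref tau i j *: f (y s j) (node tau a s j) - \sum_j Dref tau i j *: y s j).
exists (y h), (mu h); split; first exact: stages0.
have sys s : 0 <= s <= h -> cG_system f B g (Dref tau) (s *: Mref tau) (node tau a s) (y s) (mu s).
  by move=> sh; apply/cG_systemE; [rewrite /y stages0|split; [exact: RK|]].
have [sys0 sys1] := (branch_system a y mu h_gt0).2 sys.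
exists y, mu; split => //; last by move=> s _; rewrite /y !stages0.
split=> // i; apply: within_continuous_mulmx => s; apply: cvgB.
  apply: within_continuous_scale; apply: within_continuous_sum => j s'.
  apply: cvgZr; apply: (cylinder_within_continuous f_cont (u := y^~ j) (v := fun s => node tau a s j)).
  - exact: yc.
  - exact: within_continuous_node.
  - by move=> s''; exact: node_step.
by apply: within_continuous_sum => j s'; apply: cvgZr; exact: yc.
Qed.

End Existence.

End LocalStep.

(** * Consistency and stability of one step *)

Section Defect.
Context {R : realType} {r : nat}.
Variables (tau : 'I_r.+1 -> R).
Hypothesis tau_inj : injective tau.
Hypothesis tau01 : forall j, 0 <= tau j <= 1.
Hypothesis tau0 : tau ord0 = 0.
Hypothesis tau1 : tau ord_max = 1.

Local Notation A := (RKmx tau).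

Lemma horner_comp_node a h j (p : {poly R}) :
  (p \Po affine_poly a h).[tau j] = p.[node tau a h j].
Proof. by rewrite horner_comp horner_affine. Qed.

Lemma size_comp_affine a h k (p : {poly R}) : (size p <= k.+1)%N ->
  (size (p \Po affine_poly a h) <= k.+1)%N.
Proof.
move=> sp; apply: leq_trans (size_comp_poly_leq _ _) _; rewrite ltnS.
have : (size (affine_poly a h) <= 2)%N.
  apply: leq_trans (size_polyD _ _) _; rewrite geq_max.
  rewrite (leq_trans (size_polyC_leq1 _)) //.
  by apply: leq_trans (size_scale_leq _ _) _; rewrite size_polyX.
move=> sa; rewrite -[leqRHS]muln1; apply: leq_mul.
  by case: (size p) sp.
by case: (size _) sa.
Qed.

Lemma RK_rule_affine a h k (p : {poly R}) : (size p <= r.+1)%N ->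
  p.[node tau a h (lift ord0 k)] - p.[a] = h * \sum_j A k j * p^`().[node tau a h j].
Proof.
move=> sp; have := RK_rule tau_inj tau0 k (size_comp_affine a h sp).
rewrite horner_comp_node horner_comp horner_affine mulr0 addr0 => ->.
rewrite mulr_sumr; apply: eq_bigr => j _.
by rewrite deriv_affine hornerZ horner_comp_node; ring.
Qed.

Lemma RK_last_affine a h k (p : {poly R}) : lift ord0 k = ord_max ->
  (size p <= r.+2)%N ->
  p.[node tau a h (lift ord0 k)] - p.[a] = h * \sum_j A k j * p^`().[node tau a h j].
Proof.
move=> kmax sp; have := RK_last tau_inj tau0 kmax tau1 (size_comp_affine a h sp).
rewrite kmax -{1}tau1 horner_comp_node horner_comp horner_affine mulr0 addr0 => ->.
rewrite mulr_sumr; apply: eq_bigr => j _.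
by rewrite deriv_affine hornerZ horner_comp_node; ring.
Qed.

Lemma node_seg a h j : 0 <= h -> a <= node tau a h j <= a + h.
Proof.
move=> h0; have /andP[t0 t1] := tau01 j; rewrite /node lerDl mulr_ge0 //= lerD2l.
by rewrite -[leRHS]mulr1 ler_wpM2l.
Qed.

Lemma closed_approx (u : R -> R) (p : {poly R}) (a b e : R) : a < b ->
  {within `[a, b], continuous u} ->
  (forall t, a < t < b -> `|u t - p.[t]| <= e) -> forall t, a <= t <= b -> `|u t - p.[t]| <= e.
Proof.
move=> ab uc; apply: (bound_closed ab) => t; apply: cvgB; first exact: uc.
apply: (@continuous_subspaceT _ _ (`[a, b]%classic : set R) (horner p)) => s.
exact: continuous_horner.
Qed.

(** The rule is exact for p, so only u - p at two points and w - p' at the nodes remain; this is the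
    origin of 2 + sum |A k j|. *)
Lemma scalar_defect_poly (u w : R -> R) (a h e : R) k (p : {poly R}) : 0 <= h ->
  p.[node tau a h (lift ord0 k)] - p.[a] = h * \sum_j A k j * p^`().[node tau a h j] ->
  (forall t, a <= t <= a + h -> `|u t - p.[t]| <= e * h) ->
  (forall t, a <= t <= a + h -> `|w t - p^`().[t]| <= e) ->
  `|u (node tau a h (lift ord0 k)) - u a - h * \sum_j A k j * w (node tau a h j)|
    <= (2 + \sum_j `|A k j|) * (e * h).
Proof.
move=> h0 RKp up wp; set tk := node _ _ _ _.
have -> : u tk - u a - h * \sum_j A k j * w (node tau a h j) =
   (u tk - p.[tk]) - (u a - p.[a]) - h * \sum_j A k j * (w (node tau a h j) - p^`().[node tau a h j]).
  under [in RHS]eq_bigr do rewrite mulrBr.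
  by rewrite sumrB mulrBr -RKp; ring.
apply: le_trans (ler_normB _ _) _; rewrite mulrDl lerD //.
  apply: le_trans (ler_normB _ _) _; rewrite mulrDl mul1r lerD // up ?node_seg //.
  by rewrite lexx lerDl.
have -> : (\sum_j `|A k j|) * (e * h) = h * ((\sum_j `|A k j|) * e) by ring.
rewrite normrM ger0_norm // ler_wpM2l // mulr_suml; apply: le_trans (ler_norm_sum _ _ _) _.
apply: ler_sum => j _; rewrite normrM ler_wpM2l //.
by apply: wp; exact: node_seg.
Qed.

(** The two bounds use approximating polynomials of degree r and r + 1, the degrees of exactness of
    a general stage and of the last one. *)
Lemma scalar_defect (u w : R -> R) (a h K : R) k : 0 < h ->
  {within `[a, a + h], continuous u} -> {within `[a, a + h], continuous w} ->
  (forall t, a < t < a + h -> is_derive t 1 u (w t)) ->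
  deriv_bounded r.+1 a (a + h) K w ->
  `|u (node tau a h (lift ord0 k)) - u a - h * \sum_j A k j * w (node tau a h j)|
    <= (2 + \sum_j `|A k j|) * (K * h ^+ r.+1) /\
  (lift ord0 k = ord_max ->
  `|u (node tau a h (lift ord0 k)) - u a - h * \sum_j A k j * w (node tau a h j)|
    <= (2 + \sum_j `|A k j|) * (K * h ^+ r.+2)).
Proof.
move=> h0 uc wc uw wK; have aah : a < a + h by rewrite ltrDl.
have hE : a + h - a = h by rewrite addrAC subrr add0r.
split=> [|kmax].
  have wK' : deriv_bounded r a (a + h) K w by apply: deriv_bounded_weaken wK.
  have [p [sp up wp]] := taylor_poly_deriv aah uw wK'; rewrite hE in up wp.
  rewrite exprSr mulrA; apply: (@scalar_defect_poly _ _ _ _ _ _ p) (ltW h0) _ _ _.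
  - exact: RK_rule_affine.
  - by apply: closed_approx => // t /up; rewrite exprSr mulrA.
  - exact: closed_approx.
have [p [sp up wp]] := taylor_poly_deriv aah uw wK; rewrite hE in up wp.
rewrite exprSr mulrA; apply: (@scalar_defect_poly _ _ _ _ _ _ p) (ltW h0) _ _ _.
- exact: RK_last_affine.
- by apply: closed_approx => // t /up; rewrite exprSr mulrA.
- exact: closed_approx.
Qed.

End Defect.

(** * Propagation of errors over one step *)

Section StepError.
Context {R : realType} {n m r : nat}.
Variables (f : 'cV[R]_n -> R -> 'cV[R]_n) (B : 'M[R]_(m, n)).
Variables (g : R -> 'cV[R]_m) (tau : 'I_r.+1 -> R) (rho L T : R).
Hypothesis tau01 : forall j, 0 <= tau j <= 1.
Hypothesis tau0 : tau ord0 = 0.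
Hypothesis L_ge0 : 0 <= L.
Hypothesis f_lip : forall (y z : 'cV[R]_n) (t : R), `|y| <= rho -> `|z| <= rho -> 0 <= t <= T ->
  `|f z t - f y t| <= L * `|z - y|.

Local Notation P := (proj_ker B).
Local Notation A := (RKmx tau).
Local Notation cRK := (RKconst B tau).

(** Both X and x satisfy the constraint, so the terms in g cancel and a stage error is the start
    error plus h A P (f(X) - f(x)) minus the defect. The maximal error [E] is absorbed since its
    factor is at most 1/2. Inserting the bound on [E] once more shows that the coarse defect d
    reaches a given stage only with a factor h; its own defect d' enters in full. *)
Lemma step_error (a h d : R) (x : R -> 'cV[R]_n) (X : 'I_r.+1 -> 'cV[R]_n) :
  0 <= a -> 0 <= h -> 0 <= d -> a + h <= T ->
  (forall t, 0 <= t <= T -> B *m x t = g t) ->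
  (forall t, 0 <= t <= T -> `|x t| <= rho) ->
  (forall j, `|X j| <= rho) ->
  RK_system f B g tau a h X ->
  cRK * L * h <= 2^-1 ->
  (forall k, `|P *m x (node tau a h (lift ord0 k)) - P *m x a
       - h *: \sum_j A k j *: (P *m f (x (node tau a h j)) (node tau a h j))| <= d) ->
  (forall j, `|X j - x (node tau a h j)| <= 2 * `|X ord0 - x a| + 2 * d) /\
  (forall k d', `|P *m x (node tau a h (lift ord0 k)) - P *m x a
       - h *: \sum_j A k j *: (P *m f (x (node tau a h j)) (node tau a h j))| <= d' ->
    `|X (lift ord0 k) - x (node tau a h (lift ord0 k))| <=
    `|X ord0 - x a| + cRK * L * h * (2 * `|X ord0 - x a| + 2 * d) + d').
Proof.
move=> a0 h0 d0 ahT Bx xr Xr RK hsmall dP.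
pose t j := node tau a h j; pose e j := X j - x (t j); pose e0 := X ord0 - x a.
have tT j : 0 <= t j <= T by exact: node_in.
have aT : 0 <= a <= T by rewrite a0 (le_trans _ ahT) // lerDl.
pose E : R := \big[Num.max/0]_j `|e j|.
have eE j : `|e j| <= E by exact: le_bigmax.
pose q k := P *m x (t (lift ord0 k)) - P *m x a
       - h *: \sum_j A k j *: (P *m f (x (t j)) (t j)).
have main (k : 'I_r) d' : `|q k| <= d' -> `|e (lift ord0 k)| <= `|e0| + cRK * L * h * E + d'.
  move=> qd; have -> : e (lift ord0 k) = e0
      + h *: (\sum_j A k j *: (P *m (f (X j) (t j) - f (x (t j)) (t j)))) - q k.
    have -> : \sum_j A k j *: (P *m (f (X j) (t j) - f (x (t j)) (t j))) =
      \sum_j A k j *: (P *m f (X j) (t j)) - \sum_j A k j *: (P *m f (x (t j)) (t j)).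
      by rewrite -sumrB; apply: eq_bigr => j _; rewrite mulmxBr scalerBr.
    have := proj_ker_split B (x (t (lift ord0 k))); have := proj_ker_split B (x a).
    rewrite !Bx // /e RK /q /e0 scalerBr -/(t _) mulmxBr.
    set u1 := P *m x a; set u2 := P *m x (t _); set s1 := h *: _; set s2 := h *: _.
    by move=> -> ->; apply/colP => i; rewrite !mxE; ring.
  apply: le_trans (ler_normB _ _) _; rewrite lerD //; apply: le_trans (ler_normD _ _) _.
  rewrite lerD2l normrZ ger0_norm //.
  have -> : cRK * L * h * E = h * (cRK * (L * E)) by ring.
  rewrite ler_wpM2l //; apply: RK_sum_bound => j.
  by apply: le_trans (f_lip (xr _ (tT j)) (Xr j) (tT j)) _; rewrite ler_wpM2l //; exact: eE.
have e0E : e ord0 = e0 by rewrite /e /e0 /t node0.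
have c0 : 0 <= cRK by exact: RKconst_ge0.
have E0 : 0 <= E by apply: le_trans (eE ord0).
have E_le : E <= 2 * `|e0| + 2 * d.
  suff : E <= `|e0| + 2^-1 * E + d by lra.
  apply: bigmax_le => [|j _]; first by rewrite !addr_ge0 // mulr_ge0.
  case: (unliftP ord0 j) => [k|] ->; last first.
    by rewrite e0E -addrA lerDl addr_ge0 // mulr_ge0.
  apply: le_trans (main k d (dP k)) _; rewrite lerD2r lerD2l.
  by rewrite ler_wpM2r.
split=> [j|k d' qd]; first exact: le_trans (eE j) E_le.
apply: le_trans (main k d' qd) _; rewrite lerD2r lerD2l ler_wpM2l //.
exact: mulr_ge0 (mulr_ge0 c0 L_ge0) h0.
Qed.

End StepError.

(** * Interpolation and the multiplier functional *)

Section IntegralClose.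
Context {R : realType}.

(** Written for integrands controlled on the open interval only. The end points are negligible,
    continuity gives measurability, and the closeness to p makes the difference bounded, hence
    integrable. *)
Lemma Rintegral_approx_poly (F G : R -> R) (p : {poly R}) (a b e : R) : a < b ->
  (forall t, a < t < b -> F t = G t) ->
  (forall t, a < t < b -> {for t, continuous G}) ->
  (forall t, a < t < b -> `|F t - p.[t]| <= e) ->
  `|\int[lebesgue_measure]_(t in `[a, b]) F t - poly_int a b p| <= e * (b - a).
Proof.
move=> ab FG Gc Fp; rewrite -(Rintegral_poly p ab).
have inE_oo t : (t \in (`]a, b[%classic : set R)) = (a < t < b).
  by apply/idP/idP; rewrite inE /= in_itv.
have mI : measurable (`]a, b[%classic : set R) by exact: measurable_itv.
have pc : continuous (horner p) by move=> x; exact: continuous_horner.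
have mG : measurable_fun (`]a, b[%classic : set R) G.
  apply: subspace_continuous_measurable_fun => //.
  by apply: continuous_in_subspaceT => t; rewrite inE_oo; exact: Gc.
have mF : measurable_fun (`]a, b[%classic : set R) F.
  by apply: (eq_measurable_fun G) => // t; rewrite inE_oo => tab; rewrite FG.
have mp (A : set R) : measurable A -> measurable_fun A (horner p).
  move=> mA; apply: subspace_continuous_measurable_fun => //.
  exact: continuous_subspaceT.
have to_open (H : R -> R) : measurable_fun (`]a, b[%classic : set R) H ->
    \int[lebesgue_measure]_(t in `[a, b]) H t = \int[lebesgue_measure]_(t in `]a, b[) H t.
  by move=> mH; rewrite /Rintegral integral_itv_bndoo //; exact/measurable_EFinP.
rewrite !to_open //; last exact: mp.
have e0 : 0 <= e by apply: le_trans (Fp ((a + b) / 2) _); rewrite ?normr_ge0 //; lra.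
have mI_fin : (lebesgue_measure (`]a, b[%classic : set R) < +oo)%E.
  by rewrite lebesgue_measure_itv /=; case: ifP => _; rewrite ?ltry // -EFinB ltry.
have pint : lebesgue_measure.-integrable (`]a, b[%classic : set R) (EFin \o horner p).
  have int_cc : lebesgue_measure.-integrable (`[a, b]%classic : set R) (EFin \o horner p).
    by apply: continuous_compact_integrable; [exact: segment_compact|exact: continuous_subspaceT].
  by apply: integrableS int_cc => //; exact: subset_itv_oo_cc.
have dint : lebesgue_measure.-integrable (`]a, b[%classic : set R) (EFin \o (fun t => F t - p.[t])).
  apply: measurable_bounded_integrable => //.
    by apply: measurable_funB => //; exact: mp.
  exists e; split; first exact: num_real.
  move=> K eK t /= tab; apply: le_trans (ltW eK); apply: Fp.
  by move: tab; rewrite in_itv.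
have -> : \int[lebesgue_measure]_(t in `]a, b[) F t =
    \int[lebesgue_measure]_(t in `]a, b[) (p.[t] + (F t - p.[t])).
  by apply: eq_Rintegral => t _; rewrite subrKC.
rewrite RintegralD // addrAC subrr add0r.
apply: le_trans (le_normr_Rintegral _ dint) _ => //.
have -> : e * (b - a) = \int[lebesgue_measure]_(t in `]a, b[) e.
  rewrite Rintegral_cst //; congr (_ * _).
  have := lebesgue_measure_itv (`]a, b[%R : interval R); rewrite /= lte_fin ab -EFinB => H.
  exact: (esym (congr1 fine H)).
apply: le_Rintegral => //.
- exact: integrable_norm dint.
- apply: measurable_bounded_integrable => //.
  by exists e; split=> [|K eK t _]; rewrite ?num_real // (ger0_norm e0) ltW.
Qed.

Lemma poly_bound (p : {poly R}) : exists2 C : R, 0 <= C &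
  forall s, 0 <= s <= 1 -> `|p.[s]| <= C.
Proof.
exists (\sum_(i < size p) `|p`_i|); first exact: sumr_ge0.
move=> s /andP[s0 s1]; rewrite horner_coef; apply: le_trans (ler_norm_sum _ _ _) _.
apply: ler_sum => i _; rewrite normrM -[leRHS]mulr1 ler_wpM2l // ger0_norm ?exprn_ge0 //.
exact: exprn_ile1.
Qed.

Lemma poly_family_bound (I : finType) (p : I -> {poly R}) : exists2 C : R, 0 <= C &
  forall s, 0 <= s <= 1 -> \sum_i `|(p i).[s]| <= C.
Proof.
have /choice[C CP] : forall i, exists C : R, 0 <= C /\
    forall s, 0 <= s <= 1 -> `|(p i).[s]| <= C.
  by move=> i; have [C C0 CP] := poly_bound (p i); exists C.
exists (\sum_i C i); first by apply: sumr_ge0 => i _; exact: (CP i).1.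
by move=> s s01; apply: ler_sum => i _; exact: (CP i).2.
Qed.

(** The interpolant reproduces p, so it sees only the errors y - q of the data, amplified by the
    Lebesgue constant. It is applied with the basis phi, its derivatives, and psi. *)
Lemma interp_error (I : finType) (b y q : I -> R) (u p e d Leb : R) :
  p = \sum_i q i * b i -> `|u - p| <= e -> (forall i, `|y i - q i| <= d) ->
  \sum_i `|b i| <= Leb -> 0 <= d -> `|u - \sum_i y i * b i| <= e + Leb * d.
Proof.
move=> pE up yq bL d0.
have -> : u - \sum_i y i * b i = (u - p) - \sum_i (y i - q i) * b i.
  have -> : \sum_i (y i - q i) * b i = \sum_i y i * b i - p.
    by rewrite pE -sumrB; apply: eq_bigr => i _; rewrite mulrBl.
  by ring.
apply: le_trans (ler_normB _ _) _; rewrite lerD //.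
apply: le_trans (ler_norm_sum _ _ _) _.
apply: (@le_trans _ _ (\sum_i `|b i| * d)); last by rewrite -mulr_suml ler_wpM2r.
by apply: ler_sum => i _; rewrite normrM mulrC ler_wpM2l.
Qed.

End IntegralClose.

(** * Lebesgue constants and local forms of D and M *)

Section Lebesgue.
Context {R : realType} {r : nat}.
Variables (tau : 'I_r.+1 -> R).
Hypothesis tau_inj : injective tau.

Lemma affine_coord (a h t : R) : 0 < h -> a <= t <= a + h ->
  exists2 s, 0 <= s <= 1 & t = a + h * s.
Proof.
move=> h0 /andP[at_ tah]; exists ((t - a) / h); last by rewrite mulrC divfK ?gt_eqF // addrC subrK.
by rewrite ler_pdivrMr // mul1r lerBlDl tah andbT divr_ge0 ?subr_ge0 // ltW.
Qed.

Lemma phi_lebesgue : exists2 Leb : R, 0 <= Leb & forall a h t, 0 < h -> a <= t <= a + h ->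
  \sum_j `|(phi tau a h j).[t]| <= Leb.
Proof.
have [C C0 CP] := poly_family_bound (phi tau 0 1); exists C => // a h t h0 /affine_coord.
move=> /(_ h0)[s s01 ->]; apply: le_trans (CP s s01); apply: ler_sum => j _.
by rewrite -(phi_affine tau a j (h := h)) ?gt_eqF // horner_comp horner_affine.
Qed.

(** Differentiating a rescaled basis costs a factor 1 / h. This is why nodal errors of order r+1
    yield a multiplier of order r only. *)
Lemma dphi_lebesgue : exists2 Leb : R, 0 <= Leb & forall a h t, 0 < h -> a <= t <= a + h ->
  \sum_j `|(phi tau a h j)^`().[t]| <= Leb / h.
Proof.
have [C C0 CP] := poly_family_bound (fun j => (phi tau 0 1 j)^`()).
exists C => // a h t h0 /affine_coord.
move=> /(_ h0)[s s01 ->]; rewrite ler_pdivlMr // mulr_suml.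
apply: le_trans (CP s s01); apply: ler_sum => j _.
rewrite -(phi_affine tau a j (h := h)) ?gt_eqF // deriv_affine hornerZ horner_comp horner_affine.
by rewrite normrM (gtr0_norm h0) mulrC.
Qed.

Lemma psi_lebesgue : exists2 Leb : R, 0 <= Leb & forall a h t, 0 < h -> a <= t <= a + h ->
  \sum_i `|(psi tau a h i).[t]| <= Leb.
Proof.
have [C C0 CP] := poly_family_bound (psi tau 0 1); exists C => // a h t h0 /affine_coord.
move=> /(_ h0)[s s01 ->]; apply: le_trans (CP s s01); apply: ler_sum => j _.
by rewrite -(psi_affine tau a j (h := h)) ?gt_eqF // horner_comp horner_affine.
Qed.

Lemma phi_interp_horner (a h t : R) (p : {poly R}) : 0 < h -> (size p <= r.+1)%N ->
  p.[t] = \sum_j p.[node tau a h j] * (phi tau a h j).[t].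
Proof.
move=> h0 sp; rewrite -{1}(phi_interp tau_inj a (lt0r_neq0 h0) sp) horner_sum.
by apply: eq_bigr => j _; rewrite hornerZ.
Qed.

Lemma dphi_interp_horner (a h t : R) (p : {poly R}) : 0 < h -> (size p <= r.+1)%N ->
  p^`().[t] = \sum_j p.[node tau a h j] * (phi tau a h j)^`().[t].
Proof.
move=> h0 sp; rewrite -{1}(phi_interp tau_inj a (lt0r_neq0 h0) sp) raddf_sum horner_sum.
by apply: eq_bigr => j _; rewrite /= derivZ hornerZ.
Qed.

Lemma psi_interp_horner (a h t : R) (p : {poly R}) : 0 < h -> (size p <= r)%N ->
  p.[t] = \sum_k p.[node tau a h (lift ord0 k)] * (psi tau a h k).[t].
Proof.
move=> h0 sp; rewrite -{1}(psi_interp tau_inj a (lt0r_neq0 h0) sp) horner_sum.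
by apply: eq_bigr => j _; rewrite hornerZ.
Qed.

Lemma Dmx_poly_int (a h : R) i j : 0 < h ->
  Dref tau i j = poly_int a (a + h) ((phi tau a h j)^`() * psi tau a h i).
Proof.
move=> h0; rewrite -(Dmx_ref tau a h0) mxE -Rintegral_poly ?ltrDl //.
by apply: eq_Rintegral => t _; rewrite hornerM.
Qed.

Lemma Mmx_poly_int (a h : R) i j : 0 < h ->
  h * Mref tau i j = poly_int a (a + h) (phi tau a h j * psi tau a h i).
Proof.
move=> h0; have -> : h * Mref tau i j = (h *: Mref tau) i j by rewrite mxE.
rewrite -(Mmx_ref tau a h0) mxE -Rintegral_poly ?ltrDl //.
by apply: eq_Rintegral => t _; rewrite hornerM.
Qed.

End Lebesgue.

Section Pairing.
Context {R : realType} {n m r : nat}.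
Variables (f : 'cV[R]_n -> R -> 'cV[R]_n) (tau : 'I_r.+1 -> R).

(** Component c of W (F - X'), with F and X the interpolants of the nodal data: the discrete
    counterpart of lambda = W (f(x,t) - x') for W = [gram_inv B *m B]. *)
Definition multiplier_poly (W : 'M[R]_(m, n)) (a h : R) (X F : 'I_r.+1 -> 'cV[R]_n) (c : 'I_m) : {poly R} :=
  \sum_l W c l *: \sum_j (F j l ord0 *: phi tau a h j - X j l ord0 *: (phi tau a h j)^`()).

(** The entries of h M and D are integrals against psi_k, so each lambda_k is the moment of the
    multiplier polynomial against psi_k. Weighting with v(t_k) replaces psi_k by the interpolant of
    v. *)
Lemma Lam_pairing_poly (W : 'M[R]_(m, n)) (a h : R) (X F : 'I_r.+1 -> 'cV[R]_n)
    (lam : 'I_r -> 'cV[R]_m) (v : 'I_r -> R) (c : 'I_m) : 0 < h ->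
  (forall k, lam k = W *m (h *: \sum_j Mref tau k j *: F j - \sum_j Dref tau k j *: X j)) ->
  (\sum_k v k *: lam k) c ord0 =
  poly_int a (a + h) (multiplier_poly W a h X F c * \sum_k v k *: psi tau a h k).
Proof.
move=> h0 lamE; rewrite summxE mulr_sumr raddf_sum; apply: eq_bigr => k _ /=.
rewrite -scalerAr linearZ /= [LHS]mxE; congr (_ * _).
rewrite /multiplier_poly mulr_suml raddf_sum lamE [LHS]mxE; apply: eq_bigr => l _ /=.
rewrite -scalerAl linearZ /=; congr (_ * _).
have -> : (h *: (\sum_j Mref tau k j *: F j) - \sum_j Dref tau k j *: X j) l ord0 =
    \sum_j (F j l ord0 * (h * Mref tau k j) - X j l ord0 * Dref tau k j).
  rewrite sumrB !(mxE, summxE) mulr_sumr; congr (_ - _).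
    by apply: eq_bigr => j _; rewrite mxE; ring.
  by apply: eq_bigr => j _; rewrite mxE mulrC.
rewrite mulr_suml raddf_sum; apply: eq_bigr => j _ /=.
rewrite mulrBl linearB /= -!scalerAl !linearZ /=.
by rewrite -(Dmx_poly_int tau a k j h0) -(Mmx_poly_int tau a k j h0).
Qed.

Lemma multiplier_poly_horner (W : 'M[R]_(m, n)) (a h t : R) (X F : 'I_r.+1 -> 'cV[R]_n) (c : 'I_m) :
  (multiplier_poly W a h X F c).[t] =
  \sum_l W c l * (\sum_j F j l ord0 * (phi tau a h j).[t]
    - \sum_j X j l ord0 * (phi tau a h j)^`().[t]).
Proof.
rewrite horner_sum; apply: eq_bigr => l _; rewrite hornerZ horner_sum -sumrB; congr (_ * _).
by apply: eq_bigr => j _; rewrite !hornerE.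
Qed.

End Pairing.

(** * Test functions and piecewise polynomials *)

Section Smooth.
Context {R : realType}.

Lemma within_continuous_coef (A : set R) n (u : R -> 'cV[R]_n) i :
  {within A, continuous u} -> {within A, continuous (fun t => u t i ord0)}.
Proof.
move=> /within_continuousP uc; apply/within_continuousP => t At e e0.
have [d d0 dP] := uc t At e e0; exists d => // s As sd.
by apply: le_trans (dP s As sd); have := mx_norm_coef (u s - u t) i ord0; rewrite !mxE.
Qed.

Lemma is_derive_mulmx m n (B : 'M[R]_(m, n)) (u : R -> 'cV[R]_n) (t : R) (l : 'cV[R]_n) :
  is_derive t 1 u l -> is_derive t 1 (fun s => B *m u s) (B *m l).
Proof.
move=> /is_derive_quotient ul; apply: is_deriveP => e e0.
have K0 : 0 < n%:R * `|B| + 1 by rewrite ltr_wpDl // mulr_ge0.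
have [d d0 dP] := ul (e / (n%:R * `|B| + 1)) (divr_gt0 e0 K0).
exists d => // s st sd.
rewrite /diff_quotient -mulmxBr scalemxAr -mulmxBr; apply: le_trans (mx_norm_mul _ _) _.
apply: (@le_trans _ _ ((n%:R * `|B| + 1) * (e / (n%:R * `|B| + 1)))).
  by rewrite ler_pM // ?mulr_ge0 ?lerDl // dP.
by rewrite mulrC divfK // gt_eqF.
Qed.

Lemma bounded_derivs_family k a b (I : finType) (u : I -> R -> R) :
  (forall i, bounded_derivs k a b (u i)) ->
  exists2 K, 0 <= K & forall i, deriv_bounded k a b K (u i).
Proof.
move=> /choice[K KP]; exists (\sum_i `|K i|); first exact: sumr_ge0.
move=> i; apply: deriv_bounded_weaken (KP i) => //.
apply: le_trans (ler_norm _) _.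
by rewrite (bigD1 i) //= lerDl sumr_ge0.
Qed.

Lemma Cinfty_is_derive (a b : R) (v : R -> R) j t : Cinfty_on `[a, b] v -> a < t < b ->
  is_derive t 1 (iter j (@derive_on R R^o `[a, b]) v) (iter j.+1 (@derive_on R R^o `[a, b]) v t).
Proof.
move=> vC tab; apply: (diff_quotient_is_derive tab).
by apply: vC; rewrite /= in_itv /=; case/andP: tab => /ltW -> /ltW ->.
Qed.

Lemma Cinfty_continuous (a b : R) (v : R -> R) : Cinfty_on `[a, b] v ->
  {within `[a, b], continuous v}.
Proof.
move=> vC; apply/within_continuousP => t tab.
exact: diff_quotient_continuous (vC 0%N t tab).
Qed.

Lemma Cinfty_deriv_bounded (a b N : R) (v : R -> R) k : Cinfty_on `[a, b] v ->
  (forall j t, a <= t <= b -> `|iter j (@derive_on R R^o `[a, b]) v t| <= N) ->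
  deriv_bounded k a b N v.
Proof.
move=> vC vN; rewrite -[v]/(iter 0 (@derive_on R R^o `[a, b]) v).
elim: k 0%N => [|k IH] j; (split; first by move=> t /andP[/ltW at_ /ltW tb]; apply: vN; rewrite at_).
  by [].
exists (iter j.+1 (@derive_on R R^o `[a, b]) v); last exact: IH.
by move=> t; exact: Cinfty_is_derive.
Qed.

Lemma dual_norm_le m (a b C : R) (F : (R -> R) -> 'cV[R]_m) : 0 <= C ->
  (forall v N, 0 <= N -> Cinfty_on `[a, b] v ->
    (forall j t, a <= t <= b -> `|iter j (@derive_on R R^o `[a, b]) v t| <= N) ->
    norm2 (F v) <= C * N) ->
  (dual_norm `[a, b] F <= C%:E)%E.
Proof.
move=> C0 FC; apply: ge_ereal_sup => y /= [v [vC [t0 t0ab vt0]] <-].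
have vle j t : a <= t <= b ->
    (`|iter j (@derive_on R R^o `[a, b]) v t|%:E <= Cinfty_norm `[a, b] v)%E.
  move=> tab.
  apply: (@le_trans _ _ (ereal_sup
    [set `|iter j (@derive_on R R^o `[a, b]) v t|%:E | t in `[a, b]%classic])).
    by apply: ereal_sup_ubound; exists t => //=; rewrite in_itv.
  by apply: ereal_sup_ubound; exists j.
have N_gt0 : (0 < Cinfty_norm `[a, b] v)%E.
  have t0ab' : a <= t0 <= b by move: t0ab; rewrite /= in_itv.
  by apply: lt_le_trans (vle 0%N t0 t0ab'); rewrite lte_fin normr_gt0.
(* An infinite norm gives the quotient 0, and -oo contradicts positivity; a finite norm is a bound N
   for all derivatives of v. *)
move: vle N_gt0; case: (Cinfty_norm `[a, b] v) => [N vle N_gt0|_ _|//]; last first.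
  by rewrite invey mule0 lee_fin.
rewrite lte_fin in N_gt0.
rewrite inver gt_eqF // -EFinM lee_fin ler_pdivrMr //; apply: FC => //; first exact: ltW.
Qed.

End Smooth.

(** * Gluing of the local polynomials *)

Section Glue.
Context {R : realType}.

Lemma is_derive_ext (u v : R -> R) (a b t l : R) : a < t < b ->
  (forall s, a < s < b -> u s = v s) -> is_derive t 1 u l -> is_derive t 1 v l.
Proof.
move=> /andP[at_ tb] uv /is_derive_quotient ul; apply: is_deriveP => e e0.
have [d d0 dP] := ul e e0; exists (Num.min d (Num.min (t - a) (b - t))).
  by rewrite !lt_min d0 !subr_gt0 at_.
move=> s st; rewrite !lt_min => /and3P[sd]; rewrite !ltr_norml => /andP[? ?] /andP[? ?].
have := dP s st sd; rewrite /diff_quotient !uv //.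
- by rewrite at_.
- by apply/andP; split; lra.
Qed.

Lemma deriv_bounded_ext k (u v : R -> R) (a b K : R) :
  (forall s, a < s < b -> u s = v s) -> deriv_bounded k a b K u -> deriv_bounded k a b K v.
Proof.
case: k => [|k] uv [uK uD]; split => //.
- by move=> t tab; rewrite -uv //; exact: uK.
- by move=> t tab; rewrite -uv //; exact: uK.
- have [u' du u'K] := uD; exists u' => // t tab.
  by apply: (is_derive_ext tab uv); exact: du.
Qed.

Lemma cover_itv (h t : R) N : (0 < N)%N -> 0 <= t <= N%:R * h ->
  exists2 l, (l < N)%N & l%:R * h <= t <= l.+1%:R * h.
Proof.
elim: N => // N IH _ /andP[t0 tN]; have [NN|] := posnP N.
  by exists 0%N => //; rewrite mul0r t0 /=; move: tN; rewrite NN.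
move=> N0; have [tl|tl] := leP t (N%:R * h).
  by have [|l lN tl'] := IH N0; [rewrite t0|exists l => //; exact: ltnW].
by exists N => //; rewrite (ltW tl).
Qed.

Lemma lipschitz_of_deriv n (T K : R) (x dx : R -> 'cV[R]_n) : 0 <= K ->
  {within `[0, T], continuous x} ->
  (forall t, 0 < t < T -> is_derive t 1 x (dx t)) ->
  (forall t c, 0 < t < T -> `|dx t c ord0| <= K) ->
  forall s t, 0 <= s <= T -> 0 <= t <= T -> `|x t - x s| <= K * `|t - s|.
Proof.
move=> K0 xc xd dxK.
have le_case s t : 0 <= s -> s <= t -> t <= T -> `|x t - x s| <= K * `|t - s|.
  move=> s0 st tT; apply: mx_norm_le => [|c c']; first exact: mulr_ge0.
  rewrite ord1 (ger0_norm (x := t - s)) ?subr_ge0 //.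
  have := @mean_value_ineq R (fun t => x t c ord0) (fun t => dx t c ord0) s t 0 K st.
  rewrite mulr0 subr0 => H; rewrite [X in `|X| <= _](_ : _ = x t c ord0 - x s c ord0).
    apply: H => [|u /andP[? ?]|u /andP[? ?]].
    - apply: within_continuous_coef; apply: continuous_subspaceW xc => u /=.
      by rewrite !in_itv /= => /andP[? ?]; apply/andP; split; lra.
    - by apply: is_derive_coef; apply: xd; apply/andP; split; lra.
    - by rewrite subr0; apply: dxK; apply/andP; split; lra.
  by rewrite !mxE.
move=> s t /andP[s0 sT] /andP[t0 tT]; have [st|/ltW ts] := leP s t; first exact: le_case.
by rewrite distrC (distrC t); exact: le_case.
Qed.

Lemma phi_sum_node n r (tau : 'I_r.+1 -> R) (a h : R) k (y : 'I_r.+1 -> 'cV[R]_n) :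
  injective tau -> h != 0 ->
  \sum_j (phi tau a h j).[node tau a h k] *: y j = y k.
Proof.
move=> tau_inj h0; rewrite (bigD1 k) //= big1 => [|j jk].
  by rewrite phi_node // eqxx scale1r addr0.
by rewrite phi_node // (negbTE jk) scale0r.
Qed.

(** Two sub-intervals meet only if they are adjacent, and then in a point that is the last node of
    one and the first of the other. There [chain] makes the two polynomials agree, so any choice of
    a sub-interval containing t defines the same value. *)
Lemma piecewise_exists n r (tau : 'I_r.+1 -> R) (h : R) N (xs : nat -> 'I_r.+1 -> 'cV[R]_n) :
  injective tau -> tau ord0 = 0 -> tau ord_max = 1 -> 0 < h ->
  (forall l, (l.+1 < N)%N -> xs l.+1 ord0 = xs l ord_max) ->
  exists X : R -> 'cV[R]_n, forall l t, (l < N)%N -> sub_itv h l t ->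
    X t = \sum_j (phi tau (l%:R * h) h j).[t] *: xs l j.
Proof.
move=> tau_inj tau0 tau1 h0 chain.
pose val l t := \sum_j (phi tau (l%:R * h) h j).[t] *: xs l j.
have agree l l' t : (l < l')%N -> (l' < N)%N -> sub_itv h l t -> sub_itv h l' t ->
    val l t = val l' t.
  move=> ll' l'N; rewrite /sub_itv /= !in_itv /= => /andP[_ tl] /andP[l't _].
  have l'E : l' = l.+1.
    apply/eqP; rewrite eqn_leq ll' andbT -(ler_nat R) -(ler_pM2r h0).
    exact: le_trans l't tl.
  have tE : t = l.+1%:R * h by apply/eqP; rewrite eq_le tl -l'E l't.
  have max_node : t = node tau (l%:R * h) h ord_max.
    by rewrite tE /node tau1 -addn1 natrD; ring.
  have min_node : t = node tau (l'%:R * h) h ord0 by rewrite tE l'E /node tau0; ring.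
  have -> : val l t = xs l ord_max by rewrite /val max_node phi_sum_node // gt_eqF.
  have -> : val l' t = xs l' ord0 by rewrite /val min_node phi_sum_node // gt_eqF.
  by rewrite l'E chain // -l'E.
have /choice[l lP] : forall t, exists l, forall l', (l' < N)%N -> sub_itv h l' t ->
    (l < N)%N /\ sub_itv h l t.
  move=> t; have [[l [lN lt]]|no] := pselect (exists l, (l < N)%N /\ sub_itv h l t).
    by exists l.
  by exists 0%N => l' l'N l't; case: no; exists l'.
exists (fun t => val (l t) t) => l' t l'N l't.
have [lN lt] := lP t l' l'N l't.
have [ll'|l'l|->//] := ltngtP (l t) l'; first exact: agree.
by apply: esym; exact: agree.
Qed.

End Glue.

(** * Convergence *)

Section Convergence.
Context {R : realType} {n m r : nat}.
Variables (f : 'cV[R]_n -> R -> 'cV[R]_n) (B : 'M[R]_(m, n)).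
Variables (g : R -> 'cV[R]_m) (tau : 'I_r.+1 -> R) (T M Fb L Lg K : R).
Variables (x : R -> 'cV[R]_n) (lam : R -> 'cV[R]_m).
Hypothesis r_gt0 : (0 < r)%N.
Hypothesis B_free : row_free B.
Hypothesis tau_inj : injective tau.
Hypothesis tau01 : forall j, 0 <= tau j <= 1.
Hypothesis tau0 : tau ord0 = 0.
Hypothesis tau1 : tau ord_max = 1.
Hypothesis T_gt0 : 0 < T.
Hypothesis M_ge0 : 0 <= M.
Hypothesis Fb_ge0 : 0 <= Fb.
Hypothesis L_ge0 : 0 <= L.
Hypothesis Lg_ge0 : 0 <= Lg.
Hypothesis K_ge0 : 0 <= K.

(** The exact solution is bounded by M, start values stay within 1 of it, and stages stay within 1
    of their start value. *)
Local Notation rho := (M + 2).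
Local Notation P := (proj_ker B).
Local Notation A := (RKmx tau).
Local Notation cRK := (RKconst B tau).

Hypothesis f_cont : {within [set z : 'cV[R]_n * R | z.2 \in `[0, T]],
    continuous (fun z : 'cV[R]_n * R => f z.1 z.2)}.
Hypothesis f_bound : forall (y : 'cV[R]_n) (t : R), `|y| <= rho -> 0 <= t <= T -> `|f y t| <= Fb.
Hypothesis f_lip : forall (y z : 'cV[R]_n) (t : R), `|y| <= rho -> `|z| <= rho -> 0 <= t <= T ->
  `|f z t - f y t| <= L * `|z - y|.
Hypothesis g_lip : forall s t : R, 0 <= s <= T -> 0 <= t <= T ->
  `|g t - g s| <= Lg * `|t - s|.

Hypothesis x_cont : {within `[0, T], continuous x}.
Hypothesis x_deriv : forall t, 0 < t < T -> is_derive t 1 x (f (x t) t - B^T *m lam t).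
Hypothesis x_bound : forall t, 0 <= t <= T -> `|x t| <= M.
Hypothesis Bx : forall t, 0 <= t <= T -> B *m x t = g t.
Hypothesis x_smooth : forall c,
  deriv_bounded r 0 T K (fun t => (f (x t) t - B^T *m lam t) c ord0).
Hypothesis fx_smooth : forall c, deriv_bounded r.+1 0 T K (fun t => f (x t) t c ord0).
Hypothesis Pfx_smooth : forall c, deriv_bounded r.+1 0 T K (fun t => (P *m f (x t) t) c ord0).

Definition defect_const : R := (2 + \sum_k \sum_j `|A k j|) * K.

Lemma defect_const_ge0 : 0 <= defect_const.
Proof.
by rewrite mulr_ge0 // addr_ge0 // sumr_ge0 // => k _; exact: sumr_ge0.
Qed.

Lemma within_sub (V : normedModType R) (u : R -> V) (a b : R) : 0 <= a -> b <= T ->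
  {within `[0, T], continuous u} -> {within `[a, b], continuous u}.
Proof.
move=> a0 bT; apply: continuous_subspaceW => t /=.
by rewrite !in_itv /= => /andP[? ?]; apply/andP; split; lra.
Qed.

Lemma fx_cont (a b : R) : 0 <= a -> b <= T ->
  {within `[a, b], continuous (fun t => f (x t) t)}.
Proof.
move=> a0 bT; apply: (cylinder_within_continuous f_cont (u := x) (v := id)).
- exact: within_sub.
- by apply: continuous_subspaceT => t; exact: cvg_id.
- by move=> s /andP[? ?]; apply/andP; split; lra.
Qed.

Lemma P_deriv t : 0 < t < T -> is_derive t 1 (fun s => P *m x s) (P *m f (x t) t).
Proof.
move=> t0T; have := is_derive_mulmx P (x_deriv t0T).
by rewrite mulmxBr mulmxA proj_ker_tr // mul0mx subr0.
Qed.

Lemma defect_bound (a h : R) (k : 'I_r) : 0 <= a -> 0 < h -> a + h <= T ->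
  `|P *m x (node tau a h (lift ord0 k)) - P *m x a
       - h *: \sum_j A k j *: (P *m f (x (node tau a h j)) (node tau a h j))|
    <= defect_const * h ^+ r.+1 /\
  (lift ord0 k = ord_max ->
    `|P *m x (node tau a h (lift ord0 k)) - P *m x a
       - h *: \sum_j A k j *: (P *m f (x (node tau a h j)) (node tau a h j))|
    <= defect_const * h ^+ r.+2).
Proof.
move=> a0 h0 ahT.
set q := P *m x _ - _ - _.
have qE c : q c ord0 = (P *m x (node tau a h (lift ord0 k))) c ord0 - (P *m x a) c ord0
    - h * \sum_j A k j * (P *m f (x (node tau a h j)) (node tau a h j)) c ord0.
  have addE (y z : 'cV[R]_n) : (y - z) c ord0 = y c ord0 - z c ord0 by rewrite !mxE.
  rewrite /q !addE; congr (_ - _); rewrite [LHS]mxE summxE; congr (_ * _).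
  by apply: eq_bigr => j _; rewrite [LHS]mxE.
have def c := @scalar_defect R r tau tau_inj tau01 tau0 tau1
  (fun t => (P *m x t) c ord0) (fun t => (P *m f (x t) t) c ord0) a h K k h0.
have {}def c : `|q c ord0| <= (2 + \sum_j `|A k j|) * (K * h ^+ r.+1) /\
  (lift ord0 k = ord_max -> `|q c ord0| <= (2 + \sum_j `|A k j|) * (K * h ^+ r.+2)).
  rewrite qE; apply: def.
  - apply: within_continuous_coef; apply: within_continuous_mulmx; exact: within_sub.
  - apply: within_continuous_coef; apply: within_continuous_mulmx; exact: fx_cont.
  - move=> t /andP[? ?]; apply: is_derive_coef; apply: P_deriv; apply/andP; split; lra.
  - by apply: deriv_bounded_weaken (Pfx_smooth c).
have leC e : 0 <= e -> (2 + \sum_j `|A k j|) * (K * e) <= defect_const * e.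
  move=> e0; rewrite /defect_const mulrA ler_wpM2r // ler_wpM2r // lerD2l.
  by rewrite (bigD1 k) //= lerDl sumr_ge0 // => i _; exact: sumr_ge0.
have h0' := ltW h0.
split=> [|kmax]; apply: mx_norm_le => [|c c'].
- by rewrite mulr_ge0 ?exprn_ge0 // defect_const_ge0.
- by rewrite ord1; apply: le_trans (def c).1 _; apply: leC; exact: exprn_ge0.
- by rewrite mulr_ge0 ?exprn_ge0 // defect_const_ge0.
- by rewrite ord1; apply: le_trans ((def c).2 kmax) _; apply: leC; exact: exprn_ge0.
Qed.

(** [alpha] and [beta] collect the terms of [step_error] at the last stage when the two defects are
    [defect_const] times h^(r+1) and h^(r+2). *)
Definition alpha : R := 2 * cRK * L.
Definition beta : R := 2 * cRK * L * defect_const + defect_const.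

Lemma alpha_ge0 : 0 <= alpha.
Proof. exact: mulr_ge0 (mulr_ge0 _ (RKconst_ge0 _ _)) _. Qed.

Lemma beta_ge0 : 0 <= beta.
Proof.
by apply: addr_ge0; [apply: mulr_ge0 alpha_ge0 _|]; exact: defect_const_ge0.
Qed.

Lemma ord_max_lift : exists k : 'I_r, lift ord0 k = ord_max.
Proof.
case: (unliftP ord0 (ord_max : 'I_r.+1)) => [k|] /esym; first by exists k.
by move=> /(congr1 val) /= r0; move: r_gt0; rewrite -r0.
Qed.

Lemma node_max a h : node tau a h ord_max = a + h.
Proof. by rewrite /node tau1 mulr1. Qed.

(** The first condition keeps every branch in the ball, the second makes the stage map a contraction
    with factor 1/2. *)
Definition small_step (h : R) :=
  [/\ r.+1%:R * growth B tau Fb Lg * h < 1, cRK * L * h <= 2^-1 & h <= 1].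

Lemma one_step (a h : R) X (Lam : 'I_r -> 'cV[R]_m) : 0 <= a -> 0 < h -> a + h <= T -> small_step h ->
  cG_step f B g tau a h X Lam -> B *m X ord0 = g a -> `|X ord0 - x a| <= 1 ->
  [/\ B *m X ord_max = g (a + h), forall j, `|X j| <= rho,
     forall j, `|X j - x (node tau a h j)| <= 2 * `|X ord0 - x a| + 2 * (defect_const * h ^+ r.+1),
     `|X ord_max - x (a + h)| <= (1 + alpha * h) * `|X ord0 - x a| + beta * h ^+ r.+2 &
     forall i, Lam i = gram_inv B *m B *m
      (h *: \sum_j Mref tau i j *: f (X j) (node tau a h j) - \sum_j Dref tau i j *: X j)].
Proof.
move=> a0 h0 ahT [hs1 hs2 hs3] stepX BX0 X0x; have M0 := M_ge0.
have aT : 0 <= a <= T by rewrite a0 (le_trans _ ahT) // lerDl ltW.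
have X0r : `|X ord0| <= rho - 1.
  rewrite -(subrK (x a) (X ord0)); apply: le_trans (ler_normD _ _) _.
  by have := x_bound aT; lra.
have rho0 : 0 <= rho by lra.
have [Xr RK LamE] := cG_step_RK B_free tau_inj tau01 tau0 Fb_ge0 Lg_ge0 f_bound g_lip
   a0 h0 ahT stepX BX0 X0r hs1.
have xr t : 0 <= t <= T -> `|x t| <= rho by move=> /x_bound; lra.
have d0 : 0 <= defect_const * h ^+ r.+1 by rewrite mulr_ge0 ?defect_const_ge0 // exprn_ge0 // ltW.
have [err errmax] := step_error tau01 tau0 L_ge0 f_lip a0 (ltW h0) d0 ahT Bx xr Xr RK hs2
  (fun k => (defect_bound k a0 h0 ahT).1).
have [k kmax] := ord_max_lift.
split => //.
(* B kills the P-part of the increment and cancels [pinv_constraint], so the constraint holds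
   exactly at the end point and the next start value is consistent. *)
- rewrite -kmax RK 2!mulmxDr mulmxA mul_pinv_constraint // mul1mx BX0 kmax node_max.
  rewrite -scalemxAr mulmx_sumr big1 ?scaler0 ?addr0 => [|j _].
    by rewrite addrC subrK.
  by rewrite -scalemxAr mulmxA mul_proj_ker // mul0mx scaler0.
- have := errmax k _ ((defect_bound k a0 h0 ahT).2 kmax).
  rewrite kmax node_max => h1; apply: le_trans h1 _.
  set e := `|X ord0 - x a|; set D := defect_const.
  have -> : h ^+ r.+2 = h * h ^+ r.+1 by rewrite exprS.
  by rewrite /alpha /beta -/D le_eqVlt; apply/orP; left; apply/eqP; ring.
Qed.

(** An explicit upper solution of the recursion e_(l+1) = (1 + alpha h) e_l + beta h^(r+2), e_0 =
    0. *)
Definition start_error (h : R) (l : nat) : R :=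
  beta * h ^+ r.+1 * (l%:R * h) * expR (alpha * (l%:R * h)).

(** From 1 + alpha h <= exp(alpha h); the new local error may be multiplied by the exponentials
    because they are at least 1. *)
Lemma start_errorS h l : 0 < h ->
  (1 + alpha * h) * start_error h l + beta * h ^+ r.+2 <= start_error h l.+1.
Proof.
move=> h0; rewrite /start_error; set q := beta * h ^+ r.+1.
have q0 : 0 <= q by rewrite mulr_ge0 ?beta_ge0 // exprn_ge0 // ltW.
have -> : beta * h ^+ r.+2 = q * h by rewrite /q exprSr mulrA.
have l1 : l.+1%:R * h = l%:R * h + h by rewrite -addn1 natrD; ring.
have lh0 : 0 <= l%:R * h by rewrite mulr_ge0 // ltW.
have ah0 : 0 <= alpha * h := mulr_ge0 alpha_ge0 (ltW h0).
have -> : expR (alpha * (l.+1%:R * h)) = expR (alpha * h) * expR (alpha * (l%:R * h)).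
  by rewrite -expRD l1; congr expR; ring.
set E1 := expR (alpha * h); set E2 := expR (alpha * (l%:R * h)).
have E2_ge1 : 1 <= E2 by rewrite -[leLHS]expR0 ler_expR; exact: mulr_ge0 alpha_ge0 lh0.
have E1_ge : 1 + alpha * h <= E1 by exact: expR_ge1Dx.
have -> : q * (l.+1%:R * h) * (E1 * E2) = q * (l%:R * h) * (E1 * E2) + q * h * (E1 * E2).
  by rewrite l1; ring.
apply: lerD.
  have -> : (1 + alpha * h) * (q * (l%:R * h) * E2) =
    q * (l%:R * h) * ((1 + alpha * h) * E2) by ring.
  have ql0 : 0 <= q * (l%:R * h) by exact: mulr_ge0.
  by rewrite (ler_wpM2l ql0) // ler_wpM2r // expR_ge0.
have qh0 : 0 <= q * h by rewrite mulr_ge0 // ltW.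
rewrite -[leLHS]mulr1 (ler_wpM2l qh0) // -[leLHS]mulr1 ler_pM //.
by apply: le_trans E1_ge; rewrite lerDl.
Qed.

Definition global_const : R := beta * T * expR (alpha * T).

Lemma start_error_le h l : 0 < h -> l%:R * h <= T -> start_error h l <= global_const * h ^+ r.+1.
Proof.
move=> h0 lT; rewrite /start_error /global_const.
have -> : beta * T * expR (alpha * T) * h ^+ r.+1 = beta * h ^+ r.+1 * T * expR (alpha * T) by ring.
have hr : 0 <= beta * h ^+ r.+1 by rewrite mulr_ge0 ?beta_ge0 // exprn_ge0 // ltW.
have lh0 : 0 <= l%:R * h by rewrite mulr_ge0 // ltW.
apply: ler_pM; [exact: mulr_ge0|exact: expR_ge0|exact: ler_wpM2l|].
by rewrite ler_expR (ler_wpM2l alpha_ge0).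
Qed.


Variables (Lphi Ldphi Lpsi : R).
Hypothesis Lphi_ge0 : 0 <= Lphi.
Hypothesis Ldphi_ge0 : 0 <= Ldphi.
Hypothesis Lpsi_ge0 : 0 <= Lpsi.
Hypothesis phi_le : forall a h t : R, 0 < h -> a <= t <= a + h ->
  \sum_j `|(phi tau a h j).[t]| <= Lphi.
Hypothesis dphi_le : forall a h t : R, 0 < h -> a <= t <= a + h ->
  \sum_j `|(phi tau a h j)^`().[t]| <= Ldphi / h.
Hypothesis psi_le : forall a h t : R, 0 < h -> a <= t <= a + h ->
  \sum_i `|(psi tau a h i).[t]| <= Lpsi.

Lemma x_approx (a h : R) c : 0 <= a -> 0 < h -> a + h <= T ->
  exists p : {poly R}, [/\ (size p <= r.+1)%N,
    forall t, a <= t <= a + h -> `|x t c ord0 - p.[t]| <= K * h ^+ r.+1 &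
    forall t, a < t < a + h ->
      `|(f (x t) t - B^T *m lam t) c ord0 - p^`().[t]| <= K * h ^+ r].
Proof.
move=> a0 h0 ahT; have aah : a < a + h by rewrite ltrDl.
have xK : deriv_bounded r a (a + h) K (fun t => (f (x t) t - B^T *m lam t) c ord0).
  exact: deriv_bounded_weaken (x_smooth c).
have xd t : a < t < a + h ->
    is_derive t 1 (fun t => x t c ord0) ((f (x t) t - B^T *m lam t) c ord0).
  by move=> /andP[? ?]; apply: is_derive_coef; apply: x_deriv; apply/andP; split; lra.
have [p [sp xp dxp]] := taylor_poly_deriv aah xd xK.
have hE : a + h - a = h by rewrite addrAC subrr add0r.
rewrite hE in xp dxp; exists p; split=> //; apply: closed_approx => //.
by apply: within_continuous_coef; exact: within_sub.
Qed.

Lemma node_error (a h E e : R) c (X : 'I_r.+1 -> 'cV[R]_n) (p : {poly R}) : 0 < h ->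
  (forall j, `|X j - x (node tau a h j)| <= E) ->
  (forall t, a <= t <= a + h -> `|x t c ord0 - p.[t]| <= e) ->
  forall j, `|X j c ord0 - p.[node tau a h j]| <= E + e.
Proof.
move=> h0 XE xp j.
have -> : X j c ord0 - p.[node tau a h j] =
  (X j - x (node tau a h j)) c ord0 + (x (node tau a h j) c ord0 - p.[node tau a h j]).
  by rewrite !mxE; ring.
apply: le_trans (ler_normD _ _) _; apply: lerD; first exact: le_trans (mx_norm_coef _ _ _) (XE j).
by apply: xp; apply: node_seg => //; exact: ltW.
Qed.

Lemma state_error (a h E : R) (X : 'I_r.+1 -> 'cV[R]_n) : 0 <= a -> 0 < h -> a + h <= T ->
  (forall j, `|X j - x (node tau a h j)| <= E) ->
  forall t, a <= t <= a + h ->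
    `|x t - \sum_j (phi tau a h j).[t] *: X j| <= K * h ^+ r.+1 + Lphi * (E + K * h ^+ r.+1).
Proof.
move=> a0 h0 ahT XE t tah.
have E0 : 0 <= E := le_trans (normr_ge0 _) (XE ord0).
have Kh : 0 <= K * h ^+ r.+1 by rewrite mulr_ge0 // exprn_ge0 // ltW.
apply: mx_norm_le => [|c c']; first by rewrite addr_ge0 // mulr_ge0 // addr_ge0.
have [p [sp xp _]] := x_approx c a0 h0 ahT.
rewrite ord1.
have -> : (x t - \sum_j (phi tau a h j).[t] *: X j) c ord0 =
    x t c ord0 - \sum_j X j c ord0 * (phi tau a h j).[t].
  rewrite !mxE summxE; congr (_ - _); apply: eq_bigr => j _.
  by rewrite mxE mulrC.
apply: (interp_error (phi_interp_horner tau_inj a t h0 sp) (xp t tah) _ (phi_le h0 tah)).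
  exact: node_error.
exact: addr_ge0.
Qed.

Local Notation W := (gram_inv B *m B).

Definition coef_sum : R := \sum_c \sum_l `|W c l|.

Lemma coef_sum_bound c (y : 'I_n -> R) (e : R) : 0 <= e -> (forall l, `|y l| <= e) ->
  `|\sum_l W c l * y l| <= coef_sum * e.
Proof.
move=> e0 ye; apply: le_trans (ler_norm_sum _ _ _) _.
apply: (@le_trans _ _ (\sum_l `|W c l| * e)).
  by apply: ler_sum => l _; rewrite normrM ler_wpM2l.
rewrite -mulr_suml ler_wpM2r // /coef_sum.
by rewrite [leRHS](bigD1 c) //= lerDl sumr_ge0 // => i _; exact: sumr_ge0.
Qed.

(** [gram_inv B *m B] inverts B^T from the left. This puts lambda into the form of
    [multiplier_poly], so the two can be compared term by term. *)
Lemma lam_coef t c : lam t c ord0 =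
  \sum_l W c l * (f (x t) t l ord0 - (f (x t) t - B^T *m lam t) l ord0).
Proof.
have lamE : lam t = W *m (f (x t) t - (f (x t) t - B^T *m lam t)).
  by rewrite opprB addrC subrK mulmxA gram_invK // mul1mx.
rewrite {1}lamE mxE; apply: eq_bigr => l _; congr (_ * _).
by rewrite [LHS]mxE [X in _ + X]mxE.
Qed.

Definition nodal_const : R := 2 * global_const + 2 * defect_const.

Definition multiplier_const : R :=
  (K + Lphi * (L * nodal_const + K)) + (K + Ldphi * (nodal_const + K)).

Lemma nodal_const_ge0 : 0 <= nodal_const.
Proof.
apply: addr_ge0; apply: mulr_ge0 => //; last exact: defect_const_ge0.
by apply: mulr_ge0 (expR_ge0 _); apply: mulr_ge0 beta_ge0 (ltW T_gt0).
Qed.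

Lemma multiplier_const_ge0 : 0 <= multiplier_const.
Proof.
have C1 := nodal_const_ge0.
by apply: addr_ge0; apply: addr_ge0 => //; apply: mulr_ge0 => //; apply: addr_ge0 => //; exact: mulr_ge0.
Qed.

(** * Error of the multiplier functional on one sub-interval *)

Section Multiplier.
Variables (a h : R) (X : 'I_r.+1 -> 'cV[R]_n).
Hypothesis a_ge0 : 0 <= a.
Hypothesis h_gt0 : 0 < h.
Hypothesis h_le1 : h <= 1.
Hypothesis ah_le : a + h <= T.
Hypothesis X_rho : forall j, `|X j| <= rho.
Hypothesis X_err : forall j, `|X j - x (node tau a h j)| <= nodal_const * h ^+ r.+1.

Local Notation F := (fun j => f (X j) (node tau a h j)).

(** The interpolated values of f carry L times the nodal error; as h <= 1, the surplus power of h is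
    dropped to match the order of [dx_approx]. *)
Lemma fx_approx t l : a < t < a + h ->
  `|f (x t) t l ord0 - \sum_j F j l ord0 * (phi tau a h j).[t]|
    <= (K + Lphi * (L * nodal_const + K)) * h ^+ r.
Proof.
move=> tah; have a0 := a_ge0; have ahT := ah_le; have h0 := h_gt0; have M0 := M_ge0.
have aah : a < a + h by rewrite ltrDl.
have wK : deriv_bounded r a (a + h) K (fun t => f (x t) t l ord0).
  by apply: deriv_bounded_weaken (fx_smooth l).
have [p sp wp] := taylor_poly aah wK.
have hE : a + h - a = h by rewrite addrAC subrr add0r.
rewrite {}hE in wp.
have wpc : forall t, a <= t <= a + h -> `|f (x t) t l ord0 - p.[t]| <= K * h ^+ r.
  apply: closed_approx => //; apply: within_continuous_coef; exact: fx_cont.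
have hr0 : 0 <= h ^+ r by rewrite exprn_ge0 // ltW.
have d0 : 0 <= (L * nodal_const + K) * h ^+ r.
  by apply: mulr_ge0 => //; apply: addr_ge0 => //; apply: mulr_ge0 nodal_const_ge0.
rewrite [leRHS]mulrDl -(mulrA Lphi).
apply: (interp_error (phi_interp_horner tau_inj a t h0 (leqW sp)) (wp t tah) _ (phi_le h0 _) d0).
  move=> j; have nT : 0 <= node tau a h j <= T by apply: node_in => //; exact: ltW.
  have -> : F j l ord0 - p.[node tau a h j] =
     (F j - f (x (node tau a h j)) (node tau a h j)) l ord0
     + (f (x (node tau a h j)) (node tau a h j) l ord0 - p.[node tau a h j]).
    by rewrite !mxE; ring.
  rewrite mulrDl; apply: le_trans (ler_normD _ _) _; apply: lerD; last first.
    by apply: wpc; apply: node_seg => //; exact: ltW.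
  apply: le_trans (mx_norm_coef _ _ _) _.
  have xr : `|x (node tau a h j)| <= rho by have := x_bound nT; lra.
  apply: le_trans (f_lip xr (X_rho j) nT) _; rewrite -mulrA ler_wpM2l //.
  apply: le_trans (X_err j) _; rewrite ler_wpM2l ?nodal_const_ge0 //.
  by rewrite exprS ler_piMl.
by case/andP: tah => /ltW -> /ltW ->.
Qed.

(** Here the derivative of the interpolant is compared with x'. The data have errors of order r+1,
    and the factor [Ldphi / h] lowers this to r. *)
Lemma dx_approx t l : a < t < a + h ->
  `|(f (x t) t - B^T *m lam t) l ord0 - \sum_j X j l ord0 * (phi tau a h j)^`().[t]|
    <= (K + Ldphi * (nodal_const + K)) * h ^+ r.
Proof.
move=> tah; have h0 := h_gt0; have [p [sp xp dxp]] := x_approx l a_ge0 h_gt0 ah_le.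
have tah' : a <= t <= a + h by case/andP: tah => /ltW -> /ltW ->.
have hr0 : 0 <= h ^+ r.+1 by rewrite exprn_ge0 // ltW.
have -> : (K + Ldphi * (nodal_const + K)) * h ^+ r =
   K * h ^+ r + (Ldphi / h) * (nodal_const * h ^+ r.+1 + K * h ^+ r.+1).
  by rewrite exprS; field; rewrite gt_eqF.
apply: (interp_error (dphi_interp_horner tau_inj a t h0 sp) (dxp t tah) _ (dphi_le h0 tah')).
  exact: node_error.
by apply: addr_ge0; apply: mulr_ge0 => //; exact: nodal_const_ge0.
Qed.

Lemma multiplier_approx t c : a < t < a + h ->
  `|lam t c ord0 - (multiplier_poly tau W a h X F c).[t]| <= coef_sum * (multiplier_const * h ^+ r).
Proof.
move=> tah; rewrite multiplier_poly_horner lam_coef -sumrB.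
have hr0 : 0 <= h ^+ r by rewrite exprn_ge0 // ltW.
under eq_bigr do rewrite -mulrBr.
apply: coef_sum_bound => [|l]; first exact: mulr_ge0 multiplier_const_ge0 _.
set y1 := f _ _ _ _; set y2 := (_ - _ *m _) _ _; set s1 := \sum_j _; set s2 := \sum_j _.
have -> : y1 - y2 - (s1 - s2) = (y1 - s1) - (y2 - s2) by ring.
apply: le_trans (ler_normB _ _) _; rewrite /multiplier_const mulrDl; apply: lerD.
  exact: fx_approx.
exact: dx_approx.
Qed.

Lemma lam_bound t c : a < t < a + h -> `|lam t c ord0| <= coef_sum * (2 * K).
Proof.
move=> /andP[at_ tah]; have a0 := a_ge0; have ahT := ah_le; have K0 := K_ge0.
have t0T : 0 < t < T by apply/andP; split; lra.
rewrite lam_coef; apply: coef_sum_bound => [|l]; first by rewrite mulr_ge0.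
have -> : 2 * K = K + K by ring.
apply: le_trans (ler_normB _ _) _; apply: lerD.
  exact: (deriv_bounded0 (fx_smooth l)).
exact: (deriv_bounded0 (x_smooth l)).
Qed.

(** The regularity of lambda is inherited: by [lam_coef] it is a combination of f(x,t) and x', which
    have r >= 1 bounded derivatives. *)
Lemma lam_continuous t c : a < t < a + h -> {for t, continuous (fun t => lam t c ord0)}.
Proof.
move=> /andP[at_ tah]; have a0 := a_ge0; have ahT := ah_le.
have t0T : 0 < t < T by apply/andP; split; lra.
have : bounded_derivs r 0 T (fun t => lam t c ord0).
  have -> : (fun t => lam t c ord0) = fun t => \sum_l W c l *
      (f (x t) t l ord0 + (-1) * (f (x t) t - B^T *m lam t) l ord0).
    by apply/funext => s; rewrite lam_coef; apply: eq_bigr => l _; rewrite mulN1r.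
  apply: bounded_derivs_sum => l; apply: bounded_derivs_mul; first exact: bounded_derivs_cst.
  apply: bounded_derivs_add.
    by exists K; apply: deriv_bounded_weaken (fx_smooth l).
  by apply: bounded_derivs_mul; [exact: bounded_derivs_cst|exists K].
move=> [K' lamK].
have [_ [u' du _]] := deriv_bounded_weaken r_gt0 (lexx 0) (lexx T) (lexx K') lamK.
have [dl _] := du t t0T.
by apply/differentiable_continuous/derivable1_diffP.
Qed.

Section TestFunction.
Variables (v : R -> R) (N : R).
Hypothesis N_ge0 : 0 <= N.
Hypothesis v_smooth : Cinfty_on `[a, a + h] v.
Hypothesis v_bound : forall j t, a <= t <= a + h ->
  `|iter j (@derive_on R R^o `[a, a + h]) v t| <= N.

Local Notation Jv := (\sum_k v (node tau a h (lift ord0 k)) *: psi tau a h k).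

Lemma horner_Jv t : Jv.[t] = \sum_k v (node tau a h (lift ord0 k)) * (psi tau a h k).[t].
Proof. by rewrite horner_sum; apply: eq_bigr => k _; rewrite hornerZ. Qed.

Lemma Jv_error t : a < t < a + h -> `|v t - Jv.[t]| <= (1 + Lpsi) * (N * h ^+ r).
Proof.
move=> tah; have h0 := h_gt0; have aah : a < a + h by rewrite ltrDl.
have [p sp vp] := taylor_poly aah (Cinfty_deriv_bounded r v_smooth v_bound).
have hE : a + h - a = h by rewrite addrAC subrr add0r.
rewrite {}hE in vp.
have vpc := closed_approx aah (Cinfty_continuous v_smooth) vp.
have hr0 : 0 <= N * h ^+ r by rewrite mulr_ge0 // exprn_ge0 // ltW.
rewrite horner_Jv mulrDl mul1r.
apply: (interp_error (psi_interp_horner tau_inj a t h0 sp) (vp t tah) _ (psi_le h0 _) hr0).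
  by move=> k; apply: vpc; apply: node_seg => //; exact: ltW.
by case/andP: tah => /ltW -> /ltW ->.
Qed.

Lemma Jv_bound t : a < t < a + h -> `|Jv.[t]| <= Lpsi * N.
Proof.
move=> /andP[/ltW at_ /ltW tah]; have h0 := h_gt0; rewrite horner_Jv.
apply: le_trans (ler_norm_sum _ _ _) _.
apply: (@le_trans _ _ (\sum_k `|(psi tau a h k).[t]| * N)).
  apply: ler_sum => k _; rewrite normrM mulrC ler_wpM2l //.
  by apply: (v_bound 0); apply: node_seg => //; exact: ltW.
by rewrite -mulr_suml ler_wpM2r // psi_le // at_.
Qed.

(** The summands belong to the two terms of lam v - q w = lam (v - w) + (lam - q) w, where q is the
    multiplier polynomial and w the interpolant [Jv]. *)
Definition pairing_const : R :=
  coef_sum * (2 * K) * (1 + Lpsi) + coef_sum * multiplier_const * Lpsi.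

Lemma pairing_error (Lm : 'I_r -> 'cV[R]_m) c :
  (forall i, Lm i = W *m (h *: \sum_j Mref tau i j *: F j - \sum_j Dref tau i j *: X j)) ->
  `|\int[lebesgue_measure]_(t in `[a, a + h]) (lam t c ord0 * v t)
    - (\sum_k v (node tau a h (lift ord0 k)) *: Lm k) c ord0|
   <= pairing_const * h ^+ r.+1 * N.
Proof.
move=> LmE; have h0 := h_gt0; have aah : a < a + h by rewrite ltrDl.
rewrite (Lam_pairing_poly a (fun k => v (node tau a h (lift ord0 k))) c h0 LmE).
(* The last power of h is the length of the sub-interval; the integrand is estimated with h^r. *)
have -> : pairing_const * h ^+ r.+1 * N = (pairing_const * h ^+ r * N) * (a + h - a).
  by rewrite exprS; ring.
apply: (@Rintegral_approx_poly _ _ (fun t => lam t c ord0 * v t)) => // t tah.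
  apply: continuousM; first exact: lam_continuous.
  apply: (within_continuous_continuous aah (Cinfty_continuous v_smooth)).
  by rewrite in_itv.
rewrite hornerM; set q := (multiplier_poly _ _ _ _ _ _ _).[t]; set w := Jv.[t].
have -> : lam t c ord0 * v t - q * w = lam t c ord0 * (v t - w) + (lam t c ord0 - q) * w by ring.
apply: le_trans (ler_normD _ _) _; rewrite !normrM.
have -> : pairing_const * h ^+ r * N = coef_sum * (2 * K) * ((1 + Lpsi) * (N * h ^+ r))
   + coef_sum * (multiplier_const * h ^+ r) * (Lpsi * N) by rewrite /pairing_const; ring.
apply: lerD; apply: ler_pM => //.
- exact: lam_bound.
- exact: Jv_error.
- exact: multiplier_approx.
- exact: Jv_bound.
Qed.

End TestFunction.

End Multiplier.

(** * From one sub-interval to [0, T] *)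

Section Sequence.
Variables (h : R) (N : nat).
Hypothesis h_gt0 : 0 < h.
Hypothesis Nh : N%:R * h = T.
Hypothesis h_small : small_step h.
Hypothesis h_global : global_const * h ^+ r.+1 <= 1.

Lemma sub_itv_end l : l.+1%:R * h = l%:R * h + h.
Proof. by rewrite -addn1 natrD mulrDl mul1r. Qed.

Lemma start_ge0 l : 0 <= l%:R * h.
Proof. by rewrite mulr_ge0 // ltW. Qed.

Lemma end_leT l : (l < N)%N -> l%:R * h + h <= T.
Proof. by move=> lN; rewrite -sub_itv_end -Nh ler_wpM2r ?ler_nat // ltW. Qed.

Lemma start_error_le1 l : (l <= N)%N -> start_error h l <= 1.
Proof.
move=> lN; apply: le_trans h_global; apply: start_error_le => //.
by rewrite -Nh ler_wpM2r ?ler_nat // ltW.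
Qed.

(** The invariant of the induction over the sub-intervals, used both to estimate a given
    approximation and to construct one. *)
Definition good_start l (y : 'cV[R]_n) :=
  B *m y = g (l%:R * h) /\ `|y - x (l%:R * h)| <= start_error h l.

Lemma good_start_step l X (Lam : 'I_r -> 'cV[R]_m) : (l < N)%N ->
  good_start l (X ord0) -> cG_step f B g tau (l%:R * h) h X Lam ->
  good_start l.+1 (X ord_max).
Proof.
move=> lN [By ye] st; have al0 := alpha_ge0.
have [] := one_step (start_ge0 l) h_gt0 (end_leT lN) h_small st By.
  exact: le_trans ye (start_error_le1 (ltnW lN)).
move=> h1 _ _ h2 _; split; first by rewrite sub_itv_end.
rewrite sub_itv_end; apply: le_trans h2 _; apply: le_trans (start_errorS l h_gt0).
rewrite lerD2r ler_wpM2l // addr_ge0 // mulr_ge0 // ltW //.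
Qed.

Lemma good_start0 : good_start 0 (x 0).
Proof.
have T0 := ltW T_gt0; split; first by rewrite mul0r Bx // lexx T0.
by rewrite mul0r subrr normr0 /start_error !(mul0r, mulr0).
Qed.

Lemma good_start_seq (xs : nat -> 'I_r.+1 -> 'cV[R]_n) (Lam : nat -> 'I_r -> 'cV[R]_m) :
  xs 0%N ord0 = x 0 ->
  (forall l, (l.+1 < N)%N -> xs l.+1 ord0 = xs l ord_max) ->
  (forall l, (l < N)%N -> cG_step f B g tau (l%:R * h) h (xs l) (Lam l)) ->
  forall l, (l < N)%N -> good_start l (xs l ord0).
Proof.
move=> xs0 chain steps; elim=> [|l IH] lN.
  by rewrite xs0; exact: good_start0.
by rewrite chain //; apply: good_start_step (IH (ltnW lN)) (steps l (ltnW lN)); exact: ltnW.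
Qed.

(** A step is solvable only from a good start, so the choice function [Z] takes a dummy value
    elsewhere. The recursion is defined first, and its start values are then shown to be good. *)
Lemma cG_sequence_exists : exists xs : nat -> 'I_r.+1 -> 'cV[R]_n,
  exists Lam : nat -> 'I_r -> 'cV[R]_m,
  [/\ xs 0%N ord0 = x 0, forall l, (l.+1 < N)%N -> xs l.+1 ord0 = xs l ord_max &
     forall l, (l < N)%N -> cG_step f B g tau (l%:R * h) h (xs l) (Lam l)].
Proof.
have M0 := M_ge0; have [hs1 hs2 hs3] := h_small; have h0 := h_gt0.
have rho0 : 0 <= rho by lra.
have gr0 : 0 < growth B tau Fb Lg := growth_gt0 B tau Fb_ge0 Lg_ge0.
have gh : growth B tau Fb Lg * h <= 1.
  apply: le_trans (ltW hs1); rewrite -mulrA ler_peMl //; first by rewrite mulr_ge0 // ltW.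
  by rewrite ler1n.
have ex (ly : nat * 'cV[R]_n) : exists Z : ('I_r.+1 -> 'cV[R]_n) * ('I_r -> 'cV[R]_m),
    (ly.1 < N)%N -> good_start ly.1 ly.2 ->
    Z.1 ord0 = ly.2 /\ cG_step f B g tau (ly.1%:R * h) h Z.1 Z.2.
  case: ly => l y /=; have [lN|lN] := boolP (l < N)%N; last by exists (fun=> 0, fun=> 0).
  have [[By ye]|ng] := pselect (good_start l y); last by exists (fun=> 0, fun=> 0).
  have lT := end_leT lN; have l0 := start_ge0 l.
  have yr : `|y| <= rho - 1.
    rewrite -(subrK (x (l%:R * h)) y); apply: le_trans (ler_normD _ _) _.
    have := start_error_le1 (ltnW lN).
    have : `|x (l%:R * h)| <= M by apply: x_bound; apply/andP; split; lra.
    by lra.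
  have [X [Lm [X0 XL]]] := cG_step_exists B_free tau_inj tau01 tau0 rho0 Fb_ge0 L_ge0 Lg_ge0
     f_cont f_bound f_lip g_lip l0 h_gt0 lT By yr gh hs2.
  by exists (X, Lm).
have [Z ZP] := choice ex.
pose start := fix start l := if l is l'.+1 then (Z (l', start l')).1 ord_max else x 0.
exists (fun l => (Z (l, start l)).1), (fun l => (Z (l, start l)).2).
have good l : (l < N)%N -> good_start l (start l).
  elim: l => [|l IH] lN; first exact: good_start0.
  have gl := IH (ltnW lN); have [Z0 Zs] := ZP (l, start l) (ltnW lN) gl.
  by apply: good_start_step Zs; [exact: ltnW|rewrite Z0].
have N0 : (0 < N)%N.
  by rewrite lt0n; apply/eqP => N0; move: T_gt0; rewrite -Nh N0 mul0r ltxx.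
split.
- by have [] := ZP (0%N, start 0%N) N0 (good 0%N N0).
- by move=> l lN; have [] := ZP (l.+1, start l.+1) lN (good l.+1 lN).
- by move=> l lN; have [] := ZP (l, start l) lN (good l lN).
Qed.

Lemma nodal_error l X (Lam : 'I_r -> 'cV[R]_m) : (l < N)%N ->
  good_start l (X ord0) -> cG_step f B g tau (l%:R * h) h X Lam ->
  [/\ forall j, `|X j| <= rho,
     forall j, `|X j - x (node tau (l%:R * h) h j)| <= nodal_const * h ^+ r.+1 &
     forall i, Lam i = gram_inv B *m B *m
      (h *: \sum_j Mref tau i j *: f (X j) (node tau (l%:R * h) h j)
         - \sum_j Dref tau i j *: X j)].
Proof.
move=> lN [By ye] st.
have [] := one_step (start_ge0 l) h_gt0 (end_leT lN) h_small st By.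
  exact: le_trans ye (start_error_le1 (ltnW lN)).
move=> _ Xr Xe _ LamE; split => // j; apply: le_trans (Xe j) _.
have -> : nodal_const * h ^+ r.+1 =
    2 * (global_const * h ^+ r.+1) + 2 * (defect_const * h ^+ r.+1) by rewrite /nodal_const; ring.
apply: lerD => //.
rewrite ler_wpM2l //; apply: le_trans ye _; apply: start_error_le => //.
by rewrite -Nh ler_wpM2r ?ler_nat ?(ltnW lN) // ltW.
Qed.

End Sequence.

Lemma pairing_const_ge0 : 0 <= pairing_const.
Proof.
have cs0 : 0 <= coef_sum by rewrite sumr_ge0 // => c _; exact: sumr_ge0.
apply: addr_ge0; apply: mulr_ge0 => //.
- by apply: mulr_ge0 => //; exact: mulr_ge0.
- exact: addr_ge0.
- exact: mulr_ge0 cs0 multiplier_const_ge0.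
Qed.

Definition state_const : R := K + Lphi * (nodal_const + K).

Lemma state_const_ge0 : 0 <= state_const.
Proof.
apply: addr_ge0 => //; apply: mulr_ge0 => //; apply: addr_ge0 => //.
exact: nodal_const_ge0.
Qed.

Lemma global_const_ge0 : 0 <= global_const.
Proof. by apply: mulr_ge0 (expR_ge0 _); apply: mulr_ge0 beta_ge0 (ltW T_gt0). Qed.

Lemma cG_convergence : exists Delta0 C : R,
  [/\ 0 < Delta0, 0 < C &
    forall (Delta : R) (N : nat),
    0 < Delta -> Delta <= Delta0 -> T / Delta = N%:R ->
    (exists X Lam, cG_approximation f B g tau (x 0) Delta N X Lam) /\
    (forall X Lam, cG_approximation f B g tau (x 0) Delta N X Lam ->
       (forall t : R, t \in `[0, T] -> norm2 (x t - X t) <= C * Delta ^+ r.+1) /\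
       (forall l, (l < N)%N ->
          (dual_norm (sub_itv Delta l)
             (fun v => lam_pairing (sub_itv Delta l) lam v
                         - Lam_pairing tau Delta l Lam v)%R
           <= (C * Delta ^+ r.+1)%:E)%E))].
Proof.
have gr0 : 0 < growth B tau Fb Lg := growth_gt0 B tau Fb_ge0 Lg_ge0.
have RL0 : 0 <= cRK * L by apply: mulr_ge0 => //; exact: RKconst_ge0.
have gc0 := global_const_ge0.
have G0 : 0 <= r.+1%:R * growth B tau Fb Lg by rewrite mulr_ge0 // ltW.
(* h S <= 1 implies all smallness conditions at once. The summand 1 gives h <= 1 and, as h > 0, the
   strict inequality in [small_step]; the factor 2 gives the bound 1/2; [global_const] keeps start
   errors at most 1. *)
pose S := 1 + r.+1%:R * growth B tau Fb Lg + 2 * (cRK * L) + global_const.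
have S0 : 0 < S by rewrite /S; lra.
(* The factors n and m come from passing from the max norm to the Euclidean norm, the summand 1
   makes C positive. *)
pose C := n%:R * state_const + m%:R * pairing_const + 1.
have nS0 : 0 <= n%:R * state_const by rewrite mulr_ge0 // state_const_ge0.
have mP0 : 0 <= m%:R * pairing_const by rewrite mulr_ge0 // pairing_const_ge0.
exists S^-1, C; split; [by rewrite invr_gt0|by rewrite /C; lra|].
move=> h N h0 hS TN.
have Nh : N%:R * h = T by rewrite -TN divfK // gt_eqF.
have hS1 : h * S <= 1 by rewrite -ler_pdivlMr // div1r.
have h_expand : h * S = h + r.+1%:R * growth B tau Fb Lg * h + 2 * (cRK * L * h) + global_const * h.
  by rewrite /S; ring.
have Gh0 : 0 <= r.+1%:R * growth B tau Fb Lg * h by rewrite mulr_ge0 // ltW.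
have RLh0 : 0 <= cRK * L * h by rewrite mulr_ge0 // ltW.
have gch0 : 0 <= global_const * h by rewrite mulr_ge0 // ltW.
have h1 : h <= 1 by lra.
have small : small_step h by split; lra.
have glob : global_const * h ^+ r.+1 <= 1.
  apply: (@le_trans _ _ (global_const * h)); last lra.
  by rewrite ler_wpM2l // exprS ler_piMr ?exprn_ile1 // ltW.
have hr0 : 0 <= h ^+ r.+1 by rewrite exprn_ge0 // ltW.
have N0 : (0 < N)%N.
  by rewrite lt0n; apply/eqP => N0; move: T_gt0; rewrite -Nh N0 mul0r ltxx.
have subE l : sub_itv h l = `[l%:R * h, l%:R * h + h]%classic by rewrite /sub_itv sub_itv_end.
split.
  have [xs [Lm [xs0 chain steps]]] := cG_sequence_exists h0 Nh small glob.
  have [X XP] := piecewise_exists tau_inj tau0 tau1 h0 chain.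
  by exists X, Lm, xs; split.
move=> X Lm [xs [xs0 chain steps XP]].
have good := good_start_seq h0 Nh small glob xs0 chain steps.
split=> [t|l lN].
  rewrite in_itv /= -Nh => /(cover_itv N0)[l lN tl].
  have tl' : l%:R * h <= t <= l%:R * h + h by rewrite -sub_itv_end.
  have lt : sub_itv h l t by rewrite /sub_itv /= in_itv.
  have [_ Xe _] := nodal_error h0 Nh small glob lN (good l lN) (steps l lN).
  have se := state_error (start_ge0 h0 l) h0 (end_leT h0 Nh lN) Xe tl'.
  rewrite (XP l t lN lt); apply: le_trans (norm2_le _) _.
  apply: (@le_trans _ _ (n%:R * (state_const * h ^+ r.+1))).
    rewrite ler_wpM2l //; apply: le_trans se _.
    by rewrite le_eqVlt; apply/orP; left; apply/eqP; rewrite /state_const; ring.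
  by rewrite mulrA ler_wpM2r // /C; lra.
have [Xr Xe LmE] := nodal_error h0 Nh small glob lN (good l lN) (steps l lN).
rewrite subE; apply: dual_norm_le => [|v V V0 vC vV]; first by rewrite mulr_ge0 // /C; lra.
apply: le_trans (norm2_le _) _.
apply: (@le_trans _ _ (m%:R * (pairing_const * h ^+ r.+1 * V))); last first.
  rewrite mulrA ler_wpM2r // mulrA ler_wpM2r // /C; lra.
rewrite ler_wpM2l //; apply: mx_norm_le => [|c c'].
  by rewrite !mulr_ge0 // pairing_const_ge0.
rewrite ord1.
have := pairing_error (start_ge0 h0 l) h0 h1 (end_leT h0 Nh lN) Xr Xe V0 vC vV c LmE.
by rewrite /lam_pairing /Lam_pairing [X in _ -> `|X| <= _]mxE [X in _ -> `|X + _| <= _]mxE [X in _ -> `|_ + X| <= _]mxE.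
Qed.

End Convergence.

Theorem theorem3p2 (R : realType) (r : nat) (r_ge1 : (1 <= r)%N) :
  exists K : nat,
  forall (n m : nat) (tau : 'I_r.+1 -> R) (T : R)
    (f : 'cV[R]_n -> R -> 'cV[R]_n) (B : 'M[R]_(m, n)) (g : R -> 'cV[R]_m)
    (x0 : 'cV[R]_n) (x : R -> 'cV[R]_n) (lam : R -> 'cV[R]_m),
  injective tau ->
  (forall j, tau j \in `[0, 1]) ->
  tau ord0 = 0 ->
  tau ord_max = 1 ->
  0 < T ->
  Ck_cylinder T K f ->
  row_free B ->
  Ck_bounded r.+2 T g ->
  B *m x0 = g 0 ->
  DAE_unique_solution f B g T x0 x lam ->
  Ck_bounded r.+1 T x ->
  exists Delta0 C : R,
  [/\ 0 < Delta0, 0 < C &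
    forall (Delta : R) (N : nat),
    0 < Delta -> Delta <= Delta0 -> T / Delta = N%:R ->
    (exists X Lam, cG_approximation f B g tau x0 Delta N X Lam) /\
    (forall X Lam, cG_approximation f B g tau x0 Delta N X Lam ->
       (forall t : R, t \in `[0, T] -> norm2 (x t - X t) <= C * Delta ^+ r.+1) /\
       (forall l, (l < N)%N ->
          (dual_norm (sub_itv Delta l)
             (fun v => lam_pairing (sub_itv Delta l) lam v
                         - Lam_pairing tau Delta l Lam v)%R
           <= (C * Delta ^+ r.+1)%:E)%E))].
Proof.
(* With f of class C^(r+1), f(x(t),t) has r+1 bounded derivatives, as the defect of the last stage
   requires. *)
exists r.+1 => n m tau T f B g x0 x lam tau_inj tau01 tau0 tau1 T0 fC B_free _ Bx0.
move=> [[dae cons x00] _] xC.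
have {}tau01 j : 0 <= tau j <= 1 by have := tau01 j; rewrite in_itv.
have {}dae t : 0 <= t <= T -> diff_quotient x t @ within `[0, T] t^' --> f (x t) t - B^T *m lam t.
  by move=> tT; apply: dae; rewrite in_itv.
have Bx t : 0 <= t <= T -> B *m x t = g t.
  by move=> tT; apply/eqP; rewrite -subr_eq0 cons // in_itv.
have x_cont : {within `[0, T], continuous x}.
  apply/within_continuousP => t tT; apply: diff_quotient_continuous; apply: dae.
  by move: tT; rewrite /= in_itv.
have T0' := ltW T0.
pose dx t := f (x t) t - B^T *m lam t.
have x_deriv t : 0 < t < T -> is_derive t 1 x (dx t).
  move=> tT; apply: (diff_quotient_is_derive tT); apply: dae.
  by case/andP: tT => /ltW -> /ltW ->.
have [M M0 x_bound] : exists2 M, 0 <= M & forall t, 0 <= t <= T -> `|x t| <= M.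
  have [_ _ /(_ 0%N isT)[M MP]] := xC.
  exists `|M| => //; apply: (bound_closed T0 x_cont) => t tT.
  apply: mx_norm_le => // i j; rewrite ord1; apply: le_trans (norm2_coef _ _) _.
  by apply: le_trans (ler_norm _); apply: MP; rewrite in_itv.
have dx_smooth c : bounded_derivs r 0 T (fun t => dx t c ord0).
  have [K KP] : bounded_derivs (r.+1 - 1) 0 T (fun t => derive1n 1 x t c ord0).
    exact: Ck_bounded_derivs xC.
  rewrite subn1 /= in KP; exists K; apply: deriv_bounded_ext KP => t tT.
  by rewrite /derive1n /= derive1E; have [_ ->] := x_deriv t tT.
have fx_smooth c : bounded_derivs r.+1 0 T (fun t => f (x t) t c ord0).
  apply: (bounded_derivs_comp (M := M) (dx := dx)) => // t /andP[/ltW ? /ltW ?].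
  by apply: x_bound; apply/andP.
have Pfx_smooth := bounded_derivs_mulmx (proj_ker B) fx_smooth.
have [K1 K10 K1P] := bounded_derivs_family dx_smooth.
have [K2 K20 K2P] := bounded_derivs_family fx_smooth.
have [K3 K30 K3P] := bounded_derivs_family Pfx_smooth.
pose K := K1 + K2 + K3.
have K0 : 0 <= K by rewrite !addr_ge0.
have K1K : K1 <= K by rewrite /K; lra.
have K2K : K2 <= K by rewrite /K; lra.
have K3K : K3 <= K by rewrite /K; lra.
have {}K1P c : deriv_bounded r 0 T K (fun t => dx t c ord0) by apply: deriv_bounded_weaken (K1P c).
have {}K2P c : deriv_bounded r.+1 0 T K (fun t => f (x t) t c ord0).
  exact: deriv_bounded_weaken (K2P c).
have {}K3P c : deriv_bounded r.+1 0 T K (fun t => (proj_ker B *m f (x t) t) c ord0).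
  exact: deriv_bounded_weaken (K3P c).
have [Fb Fb0 f_bound] := cylinder_bounded (Ck_cylinder_cont fC) (M + 2).
have [L L0 f_lip] := cylinder_lipschitz (M + 2) (Ck_cylinder_C1 fC).
(* Since g = B x on [0, T], a Lipschitz constant of g comes from the bound on x'. *)
pose Lg := n%:R * `|B| * K.
have Lg0 : 0 <= Lg by rewrite !mulr_ge0.
have g_lip s t : 0 <= s <= T -> 0 <= t <= T -> `|g t - g s| <= Lg * `|t - s|.
  move=> sT tT; rewrite -!Bx // -mulmxBr; apply: le_trans (mx_norm_mul _ _) _.
  rewrite /Lg -[leRHS]mulrA ler_wpM2l ?mulr_ge0 //.
  apply: (lipschitz_of_deriv K0 x_cont x_deriv) => // u c uT.
  exact: (deriv_bounded0 (K1P c)).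
have [Lphi Lphi0 phi_le] := phi_lebesgue tau.
have [Ldphi Ldphi0 dphi_le] := dphi_lebesgue tau.
have [Lpsi Lpsi0 psi_le] := psi_lebesgue tau.
rewrite -x00.
exact: (cG_convergence r_ge1 B_free tau_inj tau01 tau0 tau1 T0 M0 Fb0 L0 Lg0 K0
  (Ck_cylinder_cont fC) f_bound f_lip g_lip x_cont x_deriv x_bound Bx K1P K2P K3P
  Lphi0 Ldphi0 Lpsi0 phi_le dphi_le psi_le).
Qed.
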